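(* Let $\lambda\in\mathbb{N}_0^{N}$ with $\lambda_1\ge\cdots\ge\lambda_N$, let $k\in\{0,1\}$ and $E\in\mathcal{E}_k$, suppose that $\lfloor\lambda,E\rfloor$ is column-strict, and let $$p_{\lambda,E}=\sum_{(\alpha,F):\ \lfloor\alpha,F\rfloor=\lfloor\lambda,E\rfloor}\frac{\mathcal{R}_1(\alpha,F)}{\mathcal{C}_1^{(k)}(F)}\,J_{\alpha,F}.$$ Then $$\|p_{\lambda,E}\|^2=\nu_k\,\frac{N!}{\#G_{E_R}}\;\frac{\mathcal{C}_0^{(k)}(E_R)\,\mathcal{P}(\lambda,E_R)}{\mathcal{R}_0(\lambda^-,E_R)\,\mathcal{C}_1^{(k)}(E_S)},$$ where $\nu_0=m+1$, $\nu_1=N-m+1$, $\lambda^-$ is the nondecreasing rearrangement of $\lambda$, and $\|p\|^2=\langle p,p\rangle$.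
   Context: Fix integers $N\ge2$, $1\le m\le N-1$, and a real parameter $\kappa$ which is generic: $\kappa\ne a/n$ for all integers $a,n$ with $1\le n\le N$. Anticommuting variables. $\theta_1,\dots,\theta_N$ satisfy $\theta_i\theta_j=-\theta_j\theta_i$ for all $i,j$ (so $\theta_i^2=0$). For $E=\{i_1<\dots<i_r\}\subset\{1,\dots,N\}$ put $\phi_E=\theta_{i_1}\cdots\theta_{i_r}$; $E^C$ is the complement in $\{1,\dots,N\}$; $s(j,E)=\#\{i\in E: i>j\}$; $\mathrm{inv}(E)=\#\{(i,j)\in E\times E^C:i<j\}$. $\mathcal{P}_m=\mathrm{span}\{\phi_E:\#E=m\}$ with inner product making $\{\phi_E\}$ orthonormal. The commuting variables $x_1,\dots,x_N$ commute with each other and with all $\theta_j$; $x^\alpha=\prod_i x_i^{\alpha_i}$; $s\mathcal{P}_m=\mathrm{span}\{x^\alpha\phi_E:\alpha\in\mathbb{N}_0^N,\#E=m\}$. The symmetric group $\mathcal{S}_N$ acts by algebra automorphisms with $w x_i=x_{w(i)}$, $w\theta_i=\theta_{w(i)}$, i.e. $wp(x;\theta)=p(xw;\theta w)$ with $(xw)_i=x_{w(i)}$, $(\theta w)_i=\theta_{w(i)}$. It acts on $\mathbb{N}_0^N$ by $(w\alpha)_i=\alpha_{w^{-1}(i)}$. $s_i=(i,i+1)$. The vectors $T_E$. $\mathcal{E}_0=\{E:\#E=m+1,\ N\in E\}$, $\mathcal{E}_1=\{E:\#E=m-1,\ N\notin E\}$. Contents: for $E\in\mathcal{E}_0$, $c(i,E)=-s(i,E)$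 if $i\in E$ and $c(i,E)=s(i,E^C)+1$ if $i\notin E$; for $E\in\mathcal{E}_1$, $c(i,E)=-1-s(i,E)$ if $i\in E$ and $c(i,E)=s(i,E^C)$ if $i\notin E$. For $E\in\mathcal{E}_0\cup\mathcal{E}_1$ there are vectors $T_E\in\mathcal{P}_m$ satisfying $\sum_{j>i}(i,j)T_E=c(i,E)T_E$ for $1\le i\le N$, normalized by: $T_{E_0}=\sum_{j\in E_0}(-1)^{s(j,E_0)}\phi_{E_0\setminus\{j\}}$ for $E_0=\{N-m,\dots,N\}\in\mathcal{E}_0$; $T_{E_1}=\sum_{j=m}^{N}\phi_{E_1\cup\{j\}}$ for $E_1=\{1,\dots,m-1\}\in\mathcal{E}_1$; and $T_{s_iE}=s_iT_E-(c(i,E)-c(i+1,E))^{-1}T_E$ whenever either $E\in\mathcal{E}_0$, $i\notin E$, $i+1\in E\setminus\{N\}$, or $E\in\mathcal{E}_1$, $i\in E$, $i+1\in E^C\setminus\{N\}$. (Here $s_iE$ is the image of the set $E$.) Nonsymmetric Jack polynomials. For $p\in s\mathcal{P}_m$, $$\mathcal{D}_ip=\frac{\partial p}{\partial x_i}+\kappa\sum_{j\ne i}\frac{p(x;\theta(i,j))-p(x(i,j);\theta(i,j))}{x_i-x_j},\qquad \mathcal{U}_ip=\mathcal{D}_i(x_ip)-\kappa\sum_{j=1}^{i-1}p(x(i,j);\theta(i,j)).$$ The $\mathcal{U}_i$ commute. For $\alpha\in\mathbb{N}_0^N$, $\alpha^+$ is its nonincreasing rearrangement and $r_\alpha\in\mathcal{S}_N$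 is $r_\alpha(i)=\#\{j:\alpha_j>\alpha_i\}+\#\{j\le i:\alpha_j=\alpha_i\}$. Write $\alpha\prec\beta$ if $\alpha\neq\beta$ and $\sum_{j\le i}\alpha_j\le\sum_{j\le i}\beta_j$ for all $i$; write $\alpha\lhd\beta$ if $\sum_i\alpha_i=\sum_i\beta_i$ and either $\alpha^+\prec\beta^+$, or $\alpha^+=\beta^+$ and $\alpha\prec\beta$. For $\alpha\in\mathbb{N}_0^N$ and $E\in\mathcal{E}_k$, $J_{\alpha,E}$ is the unique polynomial of the form $x^\alpha\,(r_\alpha^{-1}T_E)+\sum_{\beta\lhd\alpha}x^\beta v_\beta(\theta)$, with $v_\beta\in\mathrm{span}\{T_F:F\in\mathcal{E}_k\}$, such that $\mathcal{U}_iJ_{\alpha,E}=(\alpha_i+1+\kappa c(r_\alpha(i),E))J_{\alpha,E}$ for $1\le i\le N$. Bilinear form. $\langle\cdot,\cdot\rangle$ is the symmetric bilinear form on $s\mathcal{P}_m$ extending the inner product on $\mathcal{P}_m$ and satisfying $\langle wf,wg\rangle=\langle f,g\rangle$ for $w\in\mathcal{S}_N$, $\langle x_if,g\rangle=\langle f,\mathcal{D}_ig\rangle$ for $1\le i\le N$, and $\langle f,g\rangle=0$ if $f,g$ are homogeneous of different degrees in $x$. Known facts about this form (from the literature): the $J_{\alpha,E}$ are mutually orthogonal, and $\|J_{\alpha,E}\|^2=|T_E|^2\,\mathcal{P}(\alpha^+,E)/(\mathcal{R}_0(\alpha,E)\mathcal{R}_1(\alpha,E))$ with the products defined below. Tableaux.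 For $E\in\mathcal{E}_0$, $Y_E$ is the filling of the hook Ferrers diagram of shape $(N-m,1^m)$ with the elements of $E$ in column 1, decreasing downwards (so $N$ is in cell $[1,1]$), and the elements of $E^C$ in cells $[1,2],[1,3],\dots$ of row 1, decreasing. For $E\in\mathcal{E}_1$, $Y_E$ is the filling of shape $(N-m+1,1^{m-1})$ with the elements of $E^C$ in row 1, decreasing (so $N$ is in $[1,1]$), and the elements of $E$ in cells $[2,1],[3,1],\dots$ of column 1, decreasing. $\lfloor\alpha,E\rfloor$ is obtained from $Y_E$ by replacing each entry $i$ by $\alpha^+_i$. It is column-strict if the entries in column 1 are pairwise distinct (equivalently strictly increasing from top to bottom). Root and sink. Among the sets $F\in\mathcal{E}_k$ with $\lfloor\lambda,F\rfloor=\lfloor\lambda,E\rfloor$: if $k=0$, $E_R$ is the one minimizing $\mathrm{inv}(F)$ and $E_S$ the one maximizing $\mathrm{inv}(F)$; if $k=1$, $E_R$ is the one maximizing and $E_S$ the one minimizing $\mathrm{inv}(F)$. $G_\lambda=\{w\in\mathcal{S}_N:w\lambda=\lambda\}$ and $G_{E_R}=\{w\in G_\lambda:wT_{E_R}=T_{E_R}\}$. Products. $(a)_n=\prod_{i=0}^{n-1}(a+i)$; for $z\in\{0,1\}$, $$\mathcal{P}(\lambda,E)=\prod_{i=1}^N(1+\kappa c(i,E))_{\lambda_i}\prod_{1\le i<j\le N}\ \prod_{l=1}^{\lambda_i-\lambda_j}\Bigl(1-\Bigl(\frac{\kappa}{l+\kappa(c(i,E)-c(j,E))}\Bigr)^2\Bigr),$$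 $$\mathcal{R}_z(\alpha,E)=\prod_{\substack{1\le i<j\le N\\ \alpha_i<\alpha_j}}\Bigl(1+\frac{(-1)^z\kappa}{\alpha_j-\alpha_i+\kappa(c(r_\alpha(j),E)-c(r_\alpha(i),E))}\Bigr),$$ $$\mathcal{C}^{(0)}_z(E)=\prod_{\substack{1\le i<j<N\\ i\in E,\,j\notin E}}\Bigl(1+\frac{(-1)^z}{c(i,E)-c(j,E)}\Bigr)\ (E\in\mathcal{E}_0),\qquad \mathcal{C}^{(1)}_z(F)=\prod_{\substack{1\le i<j<N\\ i\notin F,\,j\in F}}\Bigl(1+\frac{(-1)^z}{c(i,F)-c(j,F)}\Bigr)\ (F\in\mathcal{E}_1).$$ *)

(* Defs.v *)
(* Conventions:
   the 1-based label of i : 'I_N is i.+1,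
   and the index k in {0, 1} is a boolean (false = 0, true = 1). *)
From HB Require Import structures.
From mathcomp Require Import all_boot all_order all_fingroup all_algebra.
From mathcomp Require Import mpoly.
From Stdlib Require Import ClassicalEpsilon.

Set Implicit Arguments.
Unset Strict Implicit.
Unset Printing Implicit Defensive.

Import Order.TTheory GRing.Theory Num.Theory.
Local Open Scope ring_scope.

(* p : superpoly R N stands for \sum_E (p E) phi_E, where phi_E is the product
   of the theta_i, i in E, in increasing order. *)
Notation superpoly R N := {ffun {set 'I_N} -> {mpoly R[N]}}.

Section Combinatorics.
Context (N : nat).
Implicit Types (m : nat) (E F : {set 'I_N}) (k : bool) (alpha beta : 'X_{1..N}).

Definition scount (i : nat) E : nat := #|[set j in E | (i < j)%N]|.

Definition inv E : nat :=
  #|[set u : 'I_N * 'I_N | [&& u.1 \in E, u.2 \notin E & (u.1 < u.2)%N]]|.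

Definition hasN E : bool := [exists i in E, i.+1 == N].

Definition EE m k : {set {set 'I_N}} :=
  if k then [set E : {set 'I_N} | (#|E|.+1 == m) && ~~ hasN E]
  else [set E : {set 'I_N} | (#|E| == m.+1) && hasN E].

Definition content k (i : 'I_N) E : int :=
  if k then (if i \in E then - 1 - (scount i E)%:Z else (scount i (~: E))%:Z)
  else (if i \in E then - (scount i E)%:Z else (scount i (~: E))%:Z + 1).

Definition aplus alpha : 'X_{1..N} := [multinom nth 0%N (sort geq alpha) i | i < N].
Definition aminus alpha : 'X_{1..N} := [multinom nth 0%N (sort leq alpha) i | i < N].

Definition rnk alpha (i : 'I_N) : nat :=
  (#|[set j : 'I_N | (alpha i < alpha j)%N]|
   + #|[set j : 'I_N | (j <= i)%N && (alpha j == alpha i)]|)%N.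

Lemma rnkE alpha (oi : 'I_N) :
  rnk alpha oi = #|[set j : 'I_N | (alpha oi < alpha j)%N
                                    || (j < oi)%N && (alpha j == alpha oi)]|.+1.
Proof.
rewrite /rnk (cardsD1 oi [set j : 'I_N | (j <= oi)%N && _]) inE leqnn eqxx /=.
rewrite add1n addnS; congr _.+1.
rewrite -cardsUI (_ : _ :&: _ = set0) ?cards0 ?addn0; last first.
  by apply/setP=> j; rewrite !inE; case: (ltngtP (alpha j)); rewrite ?andbF.
by apply: eq_card=> j; rewrite !inE andbA -(inj_eq val_inj) /= -ltn_neqAle.
Qed.

Lemma rnk_lt alpha i : ((rnk alpha i).-1 < N)%N.
Proof.
rewrite rnkE /= -[X in (_ < X)%N]card_ord -cardsT.
apply: proper_card; rewrite properE subsetT; apply/subsetPn.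
by exists i; rewrite ?inE // !ltnn.
Qed.

Definition rnk_fun alpha (i : 'I_N) : 'I_N := Ordinal (rnk_lt alpha i).

Lemma rnk_fun_inj alpha : injective (rnk_fun alpha).
Proof.
have mono i j : (alpha j < alpha i)%N || (i < j)%N && (alpha i == alpha j) ->
    ((rnk alpha i).-1 < (rnk alpha j).-1)%N.
  move=> lt_ij; rewrite !rnkE /=; apply: proper_card.
  apply/properP; split; last by exists i; rewrite !inE ?ltnn //.
  apply/subsetP=> h; rewrite !inE.
  case/orP: lt_ij => [ltji | /andP[/= ltij /eqP eij]].
    case/orP=> [lth | /andP[_ /eqP ->]]; last by rewrite ltji.
    by rewrite (ltn_trans ltji lth).
  rewrite eij => /orP[-> // | /andP[lth ->]].
  by rewrite (ltn_trans lth ltij) orbT.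
move=> i j /(congr1 val) /= eq_r; apply: contraTeq (leqnn (rnk alpha i).-1).
rewrite -ltnNge => neq_ij.
case: (ltngtP (alpha i) (alpha j)) => [lt | lt | eqa].
- by have := mono j i; rewrite lt eq_r ltnn => /(_ isT).
- by have := mono i j; rewrite lt eq_r ltnn => /(_ isT).
case: (ltngtP i j) => [lt | lt | /val_inj eq]; last by rewrite eq eqxx in neq_ij.
- by have := mono i j; rewrite lt eqa eqxx orbT eq_r ltnn => /(_ isT).
- by have := mono j i; rewrite lt eqa eqxx orbT eq_r ltnn => /(_ isT).
Qed.

(* r_alpha; its values are shifted by one, like all labels *)
Definition rperm alpha : 'S_N := perm (@rnk_fun_inj alpha).

Definition prec alpha beta : bool :=
  (alpha != beta) &&
  [forall i : 'I_N,
    (\sum_(j : 'I_N | (j <= i)%N) alpha j <= \sum_(j : 'I_N | (j <= i)%N) beta j)%N].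

Definition lhd alpha beta : bool :=
  (mdeg alpha == mdeg beta) &&
  (prec (aplus alpha) (aplus beta)
   || (aplus alpha == aplus beta) && prec alpha beta).

(* Y_E, encoded as the pair (row 1 from left to right, column 1 from top to
   bottom); both lists contain the entry of the corner cell [1,1]. *)
Definition tableau k E : seq 'I_N * seq 'I_N :=
  if k then
    let row := rev (enum (~: E)) in (row, take 1 row ++ rev (enum E))
  else
    let col := rev (enum E) in (take 1 col ++ rev (enum (~: E)), col).

Definition filling k alpha E : seq nat * seq nat :=
  (map (aplus alpha) (tableau k E).1, map (aplus alpha) (tableau k E).2).

Definition column_strict k alpha E : bool := uniq (filling k alpha E).2.

(* For E in EE m k, the set of the F over which root and sink are chosen. *)
Definition same_filling m k lambda E : {set {set 'I_N}} :=
  [set F in EE m k | filling k lambda F == filling k lambda E].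

Definition root_set m k lambda E : {set 'I_N} :=
  if k then [arg max_(F > E in same_filling m k lambda E) inv F]
  else [arg min_(F < E in same_filling m k lambda E) inv F].

Definition sink_set m k lambda E : {set 'I_N} :=
  if k then [arg min_(F < E in same_filling m k lambda E) inv F]
  else [arg max_(F > E in same_filling m k lambda E) inv F].

End Combinatorics.

Section SuperPolynomials.
Context (R : realFieldType) (N : nat).
Implicit Types (p f g : superpoly R N) (E F : {set 'I_N}) (q d : {mpoly R[N]}).
Implicit Types (w : 'S_N) (k : bool) (alpha beta : 'X_{1..N}) (m : nat).

Definition phi E : superpoly R N := [ffun F => (F == E)%:R].

Definition xmul q p : superpoly R N := [ffun E => q * p E].

(* left multiplication by theta_i:
   theta_i phi_E = (-1)^#{j in E : j < i} phi_(E u {i}) if i notin E, else 0 *)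
Definition thmul (i : 'I_N) p : superpoly R N :=
  [ffun E : {set 'I_N} =>
    if i \in E then (-1) ^+ #|[set j in E | (j < i)%N]| * p (E :\ i) else 0].

(* theta_(i_1) ... theta_(i_r) *)
Definition thword (s : seq 'I_N) : superpoly R N := foldr thmul (phi set0) s.

Lemma thmulC i j p : thmul i (thmul j p) = - thmul j (thmul i p).
Proof.
wlog ltij : i j / (i < j)%N => [hw|].
  case: (ltngtP i j) => [|/hw ->|/val_inj ->]; [exact: hw | by rewrite opprK |].
  by apply/ffunP=> E; rewrite !ffunE !inE eqxx /= mulr0 !if_same oppr0.
have neij : (i == j) = false by apply/eqP=> eqij; rewrite eqij ltnn in ltij.
apply/ffunP=> E; rewrite !ffunE !inE neij (eq_sym j) neij /=.
case: ifP => [iE|]; case: ifP => [jE|]; rewrite ?mulr0 ?oppr0 //.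
rewrite !mulrA -mulNr -!exprD setDDl setDDl [[set j] :|: _]setUC.
congr (_ * _); rewrite -[RHS]mulN1r -exprS.
have -> : [set h in E :\ i | (h < j)%N] = [set h in E | (h < j)%N] :\ i.
  by apply/setP=> h; rewrite !inE andbA.
have -> : [set h in E :\ j | (h < i)%N] = [set h in E | (h < i)%N].
  apply/setP=> h; rewrite !inE; case: eqP => //= ->.
  by rewrite ltnNge (ltnW ltij) andbF.
by rewrite [in RHS](cardsD1 i) inE iE ltij /= add1n addSn exprS exprS mulN1r mulN1r
           opprK addnC.
Qed.

Lemma thword_enum E : thword (enum E) = phi E.
Proof.
suff thw_sorted (s : seq 'I_N) : sorted ltn (map val s) ->
    thword s = phi [set i in s].
  rewrite thw_sorted; first by congr phi; apply/setP=> i; rewrite inE mem_enum.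
  have [e ->] : exists e : {pred 'I_N}, enum E = filter e (enum 'I_N).
    by exists (fun i => i \in E); rewrite {1}/enum_mem enumT.
  rewrite sorted_map; apply: sorted_filter; first by move=> ? ? ?; apply: ltn_trans.
  by rewrite -sorted_map val_enum_ord iota_ltn_sorted.
elim: s => [|i s IHs] /= => [_|].
  by congr phi; apply/setP=> i; rewrite !inE.
rewrite (path_sortedE ltn_trans) all_map => /andP[/allP lt_i /IHs ->].
apply/ffunP=> F; rewrite !ffunE; have [iF | niF] := boolP (i \in F); last first.
  by case: eqP => // eqF; rewrite eqF !inE eqxx in niF.
have -> : (F :\ i == [set j in s]) = (F == [set j in i :: s]).
  apply/eqP/eqP => [eqF | ->]; apply/setP=> j.
    by have /setP/(_ j) := eqF; rewrite !inE; case: eqP => [-> _|//]; rewrite iF.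
  rewrite !inE; case: eqP => [-> /=|//].
  by apply/esym/negbTE/negP=> /lt_i /=; rewrite ltnn.
case: eqP => [-> |]; last by rewrite mulr0.
rewrite (_ : [set j in _ | _] = set0) ?cards0 ?mulr1 //.
apply/setP=> j; rewrite !inE; case: eqP => [-> |_ /=]; first by rewrite ltnn.
by case: (boolP (j \in s)) => //= /lt_i /= ltij; rewrite ltnNge (ltnW ltij).
Qed.

(* p(x; theta w) and p(xw; theta w), with (xw)_i = x_(w i),
   (theta w)_i = theta_(w i) *)
Definition thact w p : superpoly R N :=
  \sum_(E : {set 'I_N}) xmul (p E) (thword (map w (enum E))).

Definition sact w p : superpoly R N := thact w [ffun E => msym w (p E)].

Definition macts w alpha : 'X_{1..N} := [multinom alpha ((w^-1)%g i) | i < N].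

(* p lies in sP_m, resp. in P_m *)
Definition in_sP m p : Prop := forall E, #|E| <> m -> p E = 0.
Definition in_P m p : Prop :=
  in_sP m p /\ forall E, exists c : R, p E = c%:MP.

(* the exact quotient q / d of polynomials; see xdiffK for the case at hand *)
Definition mquo q d : {mpoly R[N]} := epsilon (inhabits 0) (fun q' => q' * d = q).

Definition xdiff (i j : 'I_N) p : superpoly R N :=
  [ffun E => mquo ((thact (tperm i j) p - sact (tperm i j) p) E) ('X_i - 'X_j)].

Lemma xdiffK i j p :
  xmul ('X_i - 'X_j) (xdiff i j p) = thact (tperm i j) p - sact (tperm i j) p.
Proof.
set t := tperm i j; set d : {mpoly R[N]} := _ - _.
have divM (a b a' b' : {mpoly R[N]}) :
    (exists q, q * d = a - a') -> (exists q, q * d = b - b') ->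
    exists q, q * d = a * b - a' * b'.
  move=> [u eu] [v ev]; exists (u * b + a' * v).
  by rewrite mulrDl mulrAC eu -mulrA ev mulrBl mulrBr addrA subrK.
have divD q : exists q', q' * d = q - msym t q.
  elim/mpolyind: q => [|c mm q _ _ [q' e]]; first by exists 0; rewrite msym0 subrr mul0r.
  suff [r er] : exists r, r * d = 'X_[mm] - msym t 'X_[mm].
    by exists (c *: r + q'); rewrite mulrDl -scalerAl er e msymD msymZ scalerBr opprD addrACA.
  rewrite mpolyXE_id rmorph_prod /=.
  apply: (big_ind2 (fun a b : {mpoly R[N]} => exists q, q * d = a - b)).
  - by exists 0; rewrite subrr mul0r.
  - by move=> a a' b b'; apply: divM.
  move=> h _; elim: (mm h) => [|e' IHe]; first by exists 0; rewrite rmorphXn !expr0 subrr mul0r.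
  rewrite rmorphXn !exprS -rmorphXn; apply: divM => //.
  rewrite /= msymX.
  have -> : [multinom U_(h)%MM ((t^-1)%g l) | l < N] = U_(t h)%MM.
    apply/mnmP=> l; rewrite !mnmE; congr (nat_of_bool _).
    by rewrite tpermV -(inj_eq (@perm_inj _ t)) tpermK.
  rewrite /t; case: tpermP => [->|->|_ _].
  - by exists 1; rewrite mul1r.
  - by exists (-1); rewrite mulN1r opprB.
  - by exists 0; rewrite subrr mul0r.
apply/ffunP=> E; rewrite /xdiff ffunE ffunE mulrC.
apply: (@epsilon_spec _ _ (fun q' => q' * d = _)).
rewrite /sact /thact -sumrB sum_ffunE.
elim/big_ind: _ => [|a b [u eu] [v ev]|F _]; first by exists 0; rewrite mul0r.
  by exists (u + v); rewrite mulrDl eu ev.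
rewrite !ffunE; have [q' e] := divD (p F).
by exists (q' * thword (map t (enum F)) E); rewrite mulrAC e mulrBl.
Qed.

Definition dunkl (kappa : R) (i : 'I_N) p : superpoly R N :=
  [ffun E => mderiv i (p E)] + kappa *: \sum_(j : 'I_N | j != i) xdiff i j p.

Definition cherednik (kappa : R) (i : 'I_N) p : superpoly R N :=
  dunkl kappa i (xmul 'X_i p)
  - kappa *: \sum_(j : 'I_N | (j < i)%N) sact (tperm i j) p.

Definition generic (kappa : R) : Prop :=
  forall (a : int) (n : nat), (1 <= n <= N)%N -> kappa <> a%:~R / n%:R.

Definition E0set m : {set 'I_N} := [set i : 'I_N | (N - m <= i.+1)%N].
Definition E1set m : {set 'I_N} := [set i : 'I_N | (i.+1 < m)%N].

Record is_Tfamily m (T : {set 'I_N} -> superpoly R N) : Prop := IsTfamily {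
  T_in_P : forall k E, E \in EE N m k -> in_P m (T E);
  T_eigen : forall k E, E \in EE N m k -> forall i : 'I_N,
    \sum_(j : 'I_N | (i < j)%N) sact (tperm i j) (T E)
      = (content k i E)%:~R *: T E;
  T_E0 : T (E0set m)
    = \sum_(j in E0set m) (-1) ^+ scount j (E0set m) *: phi (E0set m :\ j);
  T_E1 : T (E1set m) = \sum_(j : 'I_N | (m <= j.+1)%N) phi (j |: E1set m);
  T_step : forall k E, E \in EE N m k ->
    forall i j : 'I_N, j = i.+1 :> nat -> (j.+1 < N)%N ->
    (if k then (i \in E) && (j \notin E) else (i \notin E) && (j \in E)) ->
    T (tperm i j @: E)
      = sact (tperm i j) (T E)
        - ((content k i E - content k j E)%:~R)^-1 *: T E
}.

(* The index of the first sum ranges over the exponents of degree at most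
   mdeg alpha; lhd keeps only those of degree mdeg alpha. *)
Definition is_Jack (kappa : R) m (T : {set 'I_N} -> superpoly R N)
    k alpha E (p : superpoly R N) : Prop :=
  (exists a : 'X_{1..N} -> {set 'I_N} -> R,
     p = xmul 'X_[alpha] (sact (rperm alpha)^-1%g (T E))
         + \sum_(beta : 'X_{1..N < (mdeg alpha).+1} | lhd beta alpha)
             xmul 'X_[beta] (\sum_(F in EE N m k) a beta F *: T F))
  /\ forall i : 'I_N,
       cherednik kappa i p
         = ((alpha i + 1)%:R + kappa * (content k (rperm alpha i) E)%:~R) *: p.

Definition xhomog (d : nat) f : Prop := forall E, f E \is d.-homog.

Record is_form (kappa : R) m (B : superpoly R N -> superpoly R N -> R) : Prop :=
IsForm {
  form_sym : forall f g, in_sP m f -> in_sP m g -> B f g = B g f;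
  form_lin : forall (c : R) f g h, in_sP m f -> in_sP m g -> in_sP m h ->
    B (c *: f + g) h = c * B f h + B g h;
  form_phi : forall E F, #|E| = m -> #|F| = m -> B (phi E) (phi F) = (E == F)%:R;
  form_act : forall w f g, in_sP m f -> in_sP m g -> B (sact w f) (sact w g) = B f g;
  form_dunkl : forall (i : 'I_N) f g, in_sP m f -> in_sP m g ->
    B (xmul 'X_i f) g = B f (dunkl kappa i g);
  form_homog : forall (d e : nat) f g, in_sP m f -> in_sP m g ->
    xhomog d f -> xhomog e g -> d <> e -> B f g = 0
}.

Definition poch (a : R) (n : nat) : R := \prod_(i < n) (a + i%:R).

Definition Pprod (kappa : R) k (lambda : 'X_{1..N}) E : R :=
  (\prod_(i < N) poch (1 + kappa * (content k i E)%:~R) (lambda i))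
  * \prod_(i < N) \prod_(j < N | (i < j)%N)
      \prod_(1 <= l < (lambda i - lambda j).+1)
        (1 - (kappa / (l%:R + kappa * (content k i E - content k j E)%:~R)) ^+ 2).

Definition Rprod (kappa : R) k (z : nat) alpha E : R :=
  \prod_(i < N) \prod_(j < N | (i < j)%N && (alpha i < alpha j)%N)
    (1 + (-1) ^+ z * kappa /
         ((alpha j - alpha i)%:R
          + kappa * (content k (rperm alpha j) E - content k (rperm alpha i) E)%:~R)).

Definition Cprod k (z : nat) E : R :=
  \prod_(i < N)
    \prod_(j < N | [&& (i < j)%N, (j.+1 < N)%N &
                      if k then (i \notin E) && (j \in E)
                      else (i \in E) && (j \notin E)])
      (1 + (-1) ^+ z / (content k i E - content k j E)%:~R).

(* The index alpha ranges over exponents of bounded degree: equality of the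
   fillings forces alpha to be a rearrangement of lambda. *)
Definition super_p (kappa : R) m (J : 'X_{1..N} -> {set 'I_N} -> superpoly R N)
    k (lambda : 'X_{1..N}) E : superpoly R N :=
  \sum_(alpha : 'X_{1..N < (mdeg lambda).+1})
    \sum_(F in EE N m k | filling k alpha F == filling k lambda E)
      (Rprod kappa k 1 alpha F / Cprod k 1 F) *: J alpha F.

Definition stab_root (T : {set 'I_N} -> superpoly R N) (lambda : 'X_{1..N}) E :
    {set 'S_N} :=
  [set w : 'S_N | (macts w lambda == lambda) && (sact w (T E) == T E)].

Definition nu m k : nat := if k then (N - m + 1)%N else (m + 1)%N.

End SuperPolynomials.

(* Main.v *)
From HB Require Import structures.
Require Import Defs.
From mathcomp Require Import all_boot all_order all_fingroup all_algebra.
From mathcomp Require Import mpoly zify ring lra.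

(** Write J for J_(alpha,F). The Cherednik operators U_i are self-adjoint:
    <D_i x_i f, g> = <x_i f, x_i g> is symmetric in f and g, and reflections
    are self-adjoint ([cherednik_sym]). By genericity the joint eigenvalues of
    distinct J are distinct ([spectrum_inj]), so the J are orthogonal
    ([Jack_orth]), and they are determined by their eigenvalues and leading
    terms ([Jack_unique]). This yields two recursions. If alpha_i < alpha_(i+1),
    then s_i J - b J, with b the quotient of kappa by the difference of the
    eigenvalues of U_i and U_(i+1), is the polynomial of s_i alpha; since it is
    orthogonal to J and s_i is an isometry, its norm is (1 - b^2) |J|^2
    ([Jack_norm_swap]). The affine raising operator, a cyclic shift w
    followed by multiplication by x_N, maps J to another Jack polynomial, and by
    <x_N w f, x_N w f> = <f, U_1 f> it multiplies the norm by an eigenvalue ([Jack_norm_affine]). Both recursions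
    reduce alpha to 0, which gives [Jack_norm]: |J|^2 R_0 R_1 = |T_F|^2 P. The
    same argument with Jucys-Murphy elements in place of the U_i gives
    |T_F|^2 = nu C_0 C_1 ([T_norm]).

    By orthogonality |p|^2 is therefore a sum over the pairs (alpha, F) of
    nu P (R_1 / R_0) (C_0 / C_1). Fix the root E_R, and give the cell with
    label x the coordinate z_x = lambda_x + kappa c(x, E_R). A pair (alpha, F)
    is a way of listing the cells: each cell goes to the position of its entry
    in alpha. Up to a constant, (R_1 / R_0) (C_0 / C_1) is then the product over
    the pairs of cells, x listed before y, of 1 + kappa / (z_x - z_y)
    ([pair_weight]). A listing that does not come from a pair (alpha, F)
    reverses two adjacent cells of row 1 with equal entries, and its product
    vanishes ([word_support]). The sum may thus be extended to all the N!
    listings, where it equals N! for any distinct z_x: multiplied by the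
    Vandermonde product, \prod (z_x - z_y + kappa) differs from
    \prod (z_x - z_y) by terms of lower degree, which antisymmetrise to zero
    ([young_identity]). This is [super_p_norm].

    It remains to evaluate the constant. Call p special if its cell lies in
    column 1, below the corner. The same identity, for the Young subgroup that
    preserves the values lambda_p and the special labels, shows that the order
    of this group is a product of factors 1 + 1 / (c_i - c_j), because only the
    identity contributes to the sum ([class_product_card]). The root and the
    sink are extremal for the number of inversions, hence within each level
    their labels are completely sorted by lines of the hook, in opposite
    directions; so the remaining factors form C_1(E_S) / C_1(E_R)
    ([root_level_product_sink]). Finally that Young subgroup is the stabiliser
    of lambda and T_(E_R) ([stab_young]): swaps of adjacent cells of row 1
    fix T_(E_R), and if a special label could be moved, some simple reflection
    would act on T_(E_R) by a scalar other than 1 and -1. *)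

Set Implicit Arguments.
Unset Strict Implicit.
Unset Printing Implicit Defensive.

Import Order.TTheory GRing.Theory Num.Theory.
Local Open Scope ring_scope.

(** * The symmetric group and the Dunkl operators on superpolynomials *)

Section Action.
Context (R : realFieldType) (N : nat).
Local Notation V := (superpoly R N).
Implicit Types (m : nat) (f g : V) (q : {mpoly R[N]}) (E F : {set 'I_N}).
Implicit Types (w v : 'S_N) (i j h k : 'I_N).

Lemma xmul_is_linear q : linear (xmul q : V -> V).
Proof.
by move=> c f g; apply/ffunP=> E; rewrite !ffunE mulrDr scalerAr.
Qed.
HB.instance Definition _ q := GRing.isLinear.Build R V V *:%R (xmul q) (xmul_is_linear q).

Lemma xmulDr q f g : xmul q (f + g) = xmul q f + xmul q g. Proof. exact: linearD. Qed.
Lemma xmulBr q f g : xmul q (f - g) = xmul q f - xmul q g. Proof. exact: linearB. Qed.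
Lemma xmulZr (c : R) q f : xmul q (c *: f) = c *: xmul q f. Proof. exact: linearZ. Qed.
Lemma xmul_sumr (I : Type) (r : seq I) (P : pred I) q (G : I -> V) :
  xmul q (\sum_(x <- r | P x) G x) = \sum_(x <- r | P x) xmul q (G x).
Proof. exact: linear_sum. Qed.

Lemma xmulA q q' f : xmul q (xmul q' f) = xmul (q * q') f.
Proof. by apply/ffunP=> E; rewrite !ffunE mulrA. Qed.

Lemma xmulC q q' f : xmul q (xmul q' f) = xmul q' (xmul q f).
Proof. by rewrite !xmulA mulrC. Qed.

Lemma xmul1 f : xmul 1 f = f.
Proof. by apply/ffunP=> E; rewrite !ffunE mul1r. Qed.

Lemma xmulZ (c : R) q f : xmul (c *: q) f = c *: xmul q f.
Proof. by apply/ffunP=> E; rewrite !ffunE scalerAl. Qed.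

Lemma xmulDl q q' f : xmul (q + q') f = xmul q f + xmul q' f.
Proof. by apply/ffunP=> E; rewrite !ffunE mulrDl. Qed.

Lemma xmulBl q q' f : xmul (q - q') f = xmul q f - xmul q' f.
Proof. by apply/ffunP=> E; rewrite !ffunE mulrBl. Qed.

Lemma xmul_inj q : q != 0 -> injective (xmul q : V -> V).
Proof.
move=> q0 f g /ffunP e; apply/ffunP=> E; have := e E; rewrite !ffunE.
exact: mulfI.
Qed.

Lemma superpoly_phi f : f = \sum_E xmul (f E) (phi R E).
Proof.
apply/ffunP=> F; rewrite sum_ffunE (bigD1 F) //= !ffunE eqxx mulr1 big1 ?addr0 // => E.
by rewrite !ffunE eq_sym => /negbTE ->; rewrite mulr0.
Qed.

(** The maps compared below are linear over the scalars but need not be linear over the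
    polynomials, as permutations move the variables: hence the arbitrary coefficient [q]. *)
Lemma linear_eq (G H : {linear V -> V}) :
  (forall q E, G (xmul q (phi R E)) = H (xmul q (phi R E))) -> forall f, G f = H f.
Proof.
move=> e f; rewrite (superpoly_phi f) !linear_sum.
by apply: eq_bigr => E _; apply: e.
Qed.

Lemma thmul_is_linear i : linear (thmul i : V -> V).
Proof.
move=> c f g; apply/ffunP=> E; rewrite !ffunE.
by case: ifP => _; rewrite ?scaler0 ?addr0 // mulrDr scalerAr.
Qed.
HB.instance Definition _ i := GRing.isLinear.Build R V V *:%R (thmul i) (thmul_is_linear i).

Lemma thmul_xmul i q f : thmul i (xmul q f) = xmul q (thmul i f).
Proof.
by apply/ffunP=> E; rewrite !ffunE; case: ifP; rewrite ?mulr0 // mulrCA.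
Qed.

Lemma thmulK i f : thmul i (thmul i f) = 0.
Proof. by apply/ffunP=> E; rewrite !ffunE !inE eqxx mulr0 if_same. Qed.

(** The sign is left unspecified: only the support of the product matters later. *)
Lemma thmul_phi i E :
  exists c : R, thmul i (phi R E) = c *: phi R (i |: E) /\ (i \in E -> c = 0).
Proof.
exists (if i \in E then 0 else (-1) ^+ #|[set j in E | (j < i)%N]|).
split; last by move=> ->.
apply/ffunP=> F; rewrite !ffunE.
case: (boolP (i \in E)) => iE; rewrite ?scale0r.
  case: ifP => // iF; have -> : (F :\ i == E) = false.
    by apply/eqP=> e; move: iE; rewrite -e !inE eqxx.
  by rewrite mulr0.
case: (boolP (i \in F)) => iF; last first.
  have -> : (F == i |: E) = false by apply/eqP=> e; move: iF; rewrite e !inE eqxx.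
  by rewrite scaler0.
have -> : (F == i |: E) = (F :\ i == E).
  apply/eqP/eqP => [->|<-]; first by rewrite setU1K.
  by rewrite setD1K.
case: eqP => [eE|]; last by rewrite mulr0 scaler0.
have -> : [set j in F | (j < i)%N] = [set j in E | (j < i)%N].
  by rewrite -eE; apply/setP=> j; rewrite !inE; case: eqP => [->|]; rewrite ?ltnn ?andbF.
by rewrite mulr1 -mul_mpolyC rmorphXn /= mpolyCN mulr1.
Qed.

Lemma thact_is_linear w : linear (thact w : V -> V).
Proof.
move=> c f g; rewrite /thact scaler_sumr -big_split /=.
by apply: eq_bigr => E _; rewrite !ffunE xmulDl xmulZ.
Qed.
HB.instance Definition _ w := GRing.isLinear.Build R V V *:%R (thact w) (thact_is_linear w).

Lemma thact_xmul w q f : thact w (xmul q f) = xmul q (thact w f).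
Proof.
rewrite /thact (linear_sum (xmul q)) /=.
by apply: eq_bigr => E _; rewrite ffunE xmulA.
Qed.

Lemma thact_phi w E : thact w (phi R E) = thword R (map w (enum E)).
Proof.
rewrite /thact (bigD1 E) //= ffunE eqxx xmul1 big1 ?addr0 // => F.
by rewrite ffunE => /negbTE ->; apply/ffunP=> G; rewrite !ffunE mul0r.
Qed.

Lemma sorted_enum E : sorted (relpre val ltn) (enum E).
Proof.
have [e ->] : exists e : {pred 'I_N}, enum E = filter e (enum 'I_N).
  by exists (fun i => i \in E); rewrite {1}/enum_mem enumT.
apply: sorted_filter; first by move=> ? ? ?; apply: ltn_trans.
by rewrite -sorted_map val_enum_ord iota_ltn_sorted.
Qed.

Lemma enum_cons_min i E : (forall j, j \in E -> (i < j)%N) -> enum (i |: E) = i :: enum E.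
Proof.
move=> imin; apply: (@irr_sorted_eq _ (relpre val ltn)).
- by move=> a b c; apply: ltn_trans.
- by move=> a; rewrite /= ltnn.
- exact: sorted_enum.
- rewrite /= path_sortedE; last by move=> a b c; apply: ltn_trans.
  by rewrite sorted_enum andbT; apply/allP=> j; rewrite mem_enum; apply: imin.
- by move=> j; rewrite mem_enum !inE mem_enum.
Qed.

Lemma thmul_phi_min i E : (forall j, j \in E -> (i < j)%N) ->
  thmul i (phi R E) = phi R (i |: E).
Proof.
move=> imin; rewrite -(thword_enum R (i |: E)) enum_cons_min //=.
by rewrite thword_enum.
Qed.

Lemma thact_thmul_min w i E : (forall j, j \in E -> (i < j)%N) ->
  thact w (thmul i (phi R E)) = thmul (w i) (thact w (phi R E)).
Proof. by move=> imin; rewrite thmul_phi_min // !thact_phi enum_cons_min. Qed.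

(** Induction on the size of [E]. If [i] is smaller than [min E], then
    [theta_i phi_E] is in increasing order; if it is larger, [theta_i] is moved past the
    first factor of [phi_E]; if it is equal, both sides vanish. *)
Lemma thact_thmul_phi w i E :
  thact w (thmul i (phi R E)) = thmul (w i) (thact w (phi R E)).
Proof.
have [n] := ubnP #|E|; elim: n => // n IHn in i E *; rewrite ltnS => leE.
have [->|[h0 h0E]] := set_0Vmem E.
  by apply: thact_thmul_min => j; rewrite inE.
pose h := [arg min_(j < h0 in E) val j].
have [hE hmin] : h \in E /\ forall j, j \in E -> (h <= j)%N.
  by rewrite /h; case: arg_minnP.
pose E' := E :\ h.
have hE' j : j \in E' -> (h < j)%N.
  by rewrite !inE ltn_neqAle => /andP[ne jE]; rewrite hmin // eq_sym andbT.
have eE : E = h |: E' by rewrite setD1K.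
have phiE : phi R E = thmul h (phi R E') by rewrite thmul_phi_min // -eE.
have ltE' : (#|E'| < n)%N by rewrite (leq_trans _ leE) // (cardsD1 h E) hE.
case: (ltngtP i h) => [lt|lt|/val_inj ->].
- by apply: thact_thmul_min => j jE; apply: (leq_trans lt); apply: hmin.
- rewrite phiE thmulC linearN /= (thact_thmul_min _ hE') [in RHS]thmulC -IHn //.
  have [c [-> _]] := thmul_phi i E'; rewrite !linearZ /= thact_thmul_min ?scalerN //.
  by move=> j; rewrite !inE => /orP[/eqP -> //|/andP[ne jE]]; apply: hE'; rewrite !inE ne.
- by rewrite phiE thmulK linear0 (thact_thmul_min _ hE') thmulK.
Qed.

Lemma thact_thmul w i f : thact w (thmul i f) = thmul (w i) (thact w f).
Proof.
apply: (linear_eq (G := thact w \o thmul i) (H := thmul (w i) \o thact w)) => q E /=.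
by rewrite thmul_xmul !thact_xmul thmul_xmul thact_thmul_phi.
Qed.

Lemma thact_thword w (s : seq 'I_N) : thact w (thword R s) = thword R (map w s).
Proof.
elim: s => [|i s IHs] /=; last by rewrite thact_thmul IHs.
by rewrite thact_phi enum_set0.
Qed.

(** The word [map w (enum E)] is in general not increasing, hence the detour through
    the action on arbitrary words in the thetas. *)
Lemma thactM w v f : thact (w * v)%g f = thact v (thact w f).
Proof.
apply: (linear_eq (G := thact (w * v)) (H := thact v \o thact w)) => q E /=.
rewrite !thact_xmul !thact_phi thact_thword -map_comp; congr (xmul _ (thword _ _)).
by apply: eq_map => i; rewrite /= permM.
Qed.

Lemma thact1 f : thact 1%g f = f.
Proof.
rewrite [in RHS](superpoly_phi f) /thact; apply: eq_bigr => E _.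
by rewrite (eq_map (@perm1 _)) map_id thword_enum.
Qed.

(** The action on the variables [x] alone. It commutes with the action [thact] on the
    thetas, and [sact] is the composite of the two. *)
Definition xact w f : V := [ffun E => msym w (f E)].

Lemma sactE w f : sact w f = thact w (xact w f). Proof. by []. Qed.

Lemma xact_is_linear w : linear (xact w).
Proof. by move=> c f g; apply/ffunP=> E; rewrite !ffunE linearP. Qed.
HB.instance Definition _ w := GRing.isLinear.Build R V V *:%R (xact w) (xact_is_linear w).

Lemma sact_is_linear w : linear (sact w : V -> V).
Proof. by move=> c f g; rewrite !sactE !linearP. Qed.
HB.instance Definition _ w := GRing.isLinear.Build R V V *:%R (sact w) (sact_is_linear w).

Lemma sactD w f g : sact w (f + g) = sact w f + sact w g. Proof. exact: linearD. Qed.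
Lemma sactB w f g : sact w (f - g) = sact w f - sact w g. Proof. exact: linearB. Qed.
Lemma sactZ w (c : R) f : sact w (c *: f) = c *: sact w f. Proof. exact: linearZ. Qed.
Lemma sact_sum (I : Type) (r : seq I) (P : pred I) w (G : I -> V) :
  sact w (\sum_(x <- r | P x) G x) = \sum_(x <- r | P x) sact w (G x).
Proof. exact: linear_sum. Qed.

Lemma xact_thmul w i f : xact w (thmul i f) = thmul i (xact w f).
Proof.
apply/ffunP=> E; rewrite !ffunE; case: ifP => _; rewrite ?msym0 //.
by rewrite msymM rmorphXn /= msymN msym1.
Qed.

Lemma xact_xmul w q f : xact w (xmul q f) = xmul (msym w q) (xact w f).
Proof. by apply/ffunP=> E; rewrite !ffunE msymM. Qed.

Lemma xact_phi w E : xact w (phi R E) = phi R E.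
Proof. by apply/ffunP=> F; rewrite !ffunE rmorph_nat. Qed.

Lemma xact_thword w s : xact w (thword R s) = thword R s.
Proof. by elim: s => [|i s IHs] /=; rewrite ?xact_phi // xact_thmul IHs. Qed.

Lemma xact_thact w v f : xact w (thact v f) = thact v (xact w f).
Proof.
apply: (linear_eq (G := xact w \o thact v) (H := thact v \o xact w)) => q E /=.
by rewrite xact_xmul !thact_xmul xact_xmul xact_phi thact_phi xact_thword.
Qed.

Lemma sactM w v f : sact (w * v)%g f = sact v (sact w f).
Proof.
rewrite !sactE thactM xact_thact; congr (thact _ (thact _ _)).
by apply/ffunP=> E; rewrite !ffunE msymMm.
Qed.

Lemma sact1 f : sact 1%g f = f.
Proof. by rewrite sactE thact1; apply/ffunP=> E; rewrite !ffunE msym1m. Qed.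

Lemma sactVK w f : sact w^-1%g (sact w f) = f.
Proof. by rewrite -sactM mulgV sact1. Qed.

Lemma sact_xmul w q f : sact w (xmul q f) = xmul (msym w q) (sact w f).
Proof. by rewrite !sactE xact_xmul thact_xmul. Qed.

Lemma msym_var w i : msym w ('X_i : {mpoly R[N]}) = 'X_(w i).
Proof.
rewrite msymX; congr mpolyX; apply/mnmP=> l; rewrite !mnmE; congr (nat_of_bool _).
by rewrite -(inj_eq (@perm_inj _ w)) permKV.
Qed.

Lemma sact_xvar w i f : sact w (xmul 'X_i f) = xmul 'X_(w i) (sact w f).
Proof. by rewrite sact_xmul msym_var. Qed.

Lemma tpermS_sact i j f : sact (tperm i j) (sact (tperm i j) f) = f.
Proof. by rewrite -sactM tperm2 sact1. Qed.

Lemma in_sP0 m : in_sP m (0 : V). Proof. by move=> E _; rewrite ffunE. Qed.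
Lemma in_sPD m f g : in_sP m f -> in_sP m g -> in_sP m (f + g).
Proof. by move=> hf hg E hE; rewrite ffunE hf // hg // addr0. Qed.
Lemma in_sPZ m (c : R) f : in_sP m f -> in_sP m (c *: f).
Proof. by move=> hf E hE; rewrite ffunE hf // scaler0. Qed.
Lemma in_sPN m f : in_sP m f -> in_sP m (- f).
Proof. by move=> hf E hE; rewrite ffunE hf // oppr0. Qed.
Lemma in_sPB m f g : in_sP m f -> in_sP m g -> in_sP m (f - g).
Proof. by move=> hf hg; apply: in_sPD => //; apply: in_sPN. Qed.
Lemma in_sP_xmul m q f : in_sP m f -> in_sP m (xmul q f).
Proof. by move=> hf E hE; rewrite ffunE hf // mulr0. Qed.
Lemma in_sP_sum m (I : Type) (s : seq I) (P : pred I) (G : I -> V) :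
  (forall x, P x -> in_sP m (G x)) -> in_sP m (\sum_(x <- s | P x) G x).
Proof.
by move=> h; apply: (big_ind (in_sP m)) => //; [apply: in_sP0 | move=> *; apply: in_sPD].
Qed.

Lemma in_sP_phi E : in_sP #|E| (phi R E).
Proof. by move=> F; rewrite ffunE; case: eqP => // ->. Qed.

Lemma in_sP_thword (s : seq 'I_N) : in_sP (size s) (thword R s).
Proof.
elim: s => [|i s IHs] /=; first by have := in_sP_phi (E := set0); rewrite cards0.
move=> E hE; rewrite ffunE; case: ifP => // iE; rewrite IHs ?mulr0 //.
by move=> e; apply: hE; rewrite (cardsD1 i E) iE e.
Qed.

Lemma in_sP_thact m w f : in_sP m f -> in_sP m (thact w f).
Proof.
move=> hf; apply: in_sP_sum => E _.
have [<-|/eqP ne] := eqVneq #|E| m.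
  apply: in_sP_xmul; have := in_sP_thword (s := map w (enum E)).
  by rewrite size_map -cardE.
by rewrite hf //; move=> F _; rewrite ffunE mul0r.
Qed.

Lemma in_sP_sact m w f : in_sP m f -> in_sP m (sact w f).
Proof.
by move=> hf; apply: in_sP_thact => E hE; rewrite ffunE hf // msym0.
Qed.

Lemma subX_neq0 (i j : 'I_N) : i != j -> ('X_i - 'X_j : {mpoly R[N]}) != 0.
Proof.
move=> ne; apply/eqP=> /(congr1 (mcoeff U_(i))); rewrite mcoeffB !mcoeffXU mcoeff0.
by rewrite eqxx eq_sym (negbTE ne) subr0 => /eqP; rewrite oner_eq0.
Qed.

(** [xdiff] is a chosen quotient; quotients in an integral domain are unique, so it is
    identified by the equation that it solves. *)
Lemma xdiff_eq i j f g : i != j ->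
  xmul ('X_i - 'X_j) g = thact (tperm i j) f - sact (tperm i j) f -> xdiff i j f = g.
Proof. by move=> ne e; apply: (xmul_inj (subX_neq0 ne)); rewrite xdiffK. Qed.

Lemma xdiff_is_linear i j : i != j -> linear (xdiff i j : V -> V).
Proof.
move=> ne c f g; apply: xdiff_eq => //.
rewrite xmulDr xmulZr [X in c *: X + _ = _](xdiffK i j f) (xdiffK i j g) thact_is_linear sact_is_linear.
by rewrite scalerBr addrACA opprD.
Qed.

Lemma in_sP_xdiff m i j f : i != j -> in_sP m f -> in_sP m (xdiff i j f).
Proof.
move=> ne hf E hE; apply: (mulfI (subX_neq0 ne)).
have /ffunP/(_ E) := xdiffK i j f; rewrite ffunE => ->.
by rewrite mulr0 (in_sPB (m := m)) //; [apply: in_sP_thact | apply: in_sP_sact].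
Qed.

Lemma tperm_conj w (i j : 'I_N) : (w * tperm (w i) (w j) = tperm i j * w)%g.
Proof.
apply/permP=> x; rewrite !permM.
have [->|nei] := eqVneq x i; first by rewrite !tpermL.
have [->|nej] := eqVneq x j; first by rewrite !tpermR.
by rewrite !tpermD // ?(inj_eq perm_inj) // eq_sym.
Qed.

Lemma thact_sact_conj w i j f :
  thact (tperm (w i) (w j)) (sact w f) = sact w (thact (tperm i j) f).
Proof.
rewrite !sactE -thactM tperm_conj thactM; congr thact.
by rewrite -xact_thact.
Qed.

Lemma sact_sact_conj w i j f :
  sact (tperm (w i) (w j)) (sact w f) = sact w (sact (tperm i j) f).
Proof. by rewrite -!sactM tperm_conj. Qed.

Lemma xdiff_sact w i j f : i != j ->
  xdiff (w i) (w j) (sact w f) = sact w (xdiff i j f).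
Proof.
move=> ne; apply: xdiff_eq; first by rewrite (inj_eq perm_inj).
by rewrite -!msym_var -msymB -sact_xmul xdiffK linearB /= thact_sact_conj sact_sact_conj.
Qed.

(** A divided difference is a twisted derivation: each variable moved by [(i, j)]
    contributes a reflection. *)
Lemma xdiff_xvar i j k f : i != j ->
  xdiff i j (xmul 'X_k f) = xmul 'X_k (xdiff i j f)
     + ((k == i)%:R - (k == j)%:R) *: sact (tperm i j) f.
Proof.
move=> ne; apply: xdiff_eq => //.
rewrite xmulDr xmulZr /= xmulC xdiffK thact_xmul sact_xvar.
rewrite xmulBr /= -addrA; congr (_ + _).
have -> : ((k == i)%:R - (k == j)%:R) *: xmul ('X_i - 'X_j) (sact (tperm i j) f)
     = xmul ('X_k - 'X_(tperm i j k)) (sact (tperm i j) f).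
  case: tpermP => [->|->|/eqP/negbTE -> /eqP/negbTE ->].
  - by rewrite eqxx (negbTE ne) subr0 scale1r.
  - by rewrite eqxx eq_sym (negbTE ne) sub0r scaleN1r !xmulBl opprB.
  - by rewrite !subrr scale0r; apply/ffunP=> E; rewrite !ffunE mul0r.
by rewrite xmulBl addrA addNr add0r.
Qed.

Lemma mderiv_msym w i q : mderiv (w i) (msym w q) = msym w (mderiv i q).
Proof.
apply/mpolyP=> mm; rewrite mcoeff_mderiv !mcoeff_sym mcoeff_mderiv mnmE.
congr (_@_ _ *+ _); apply/mnmP=> j.
by rewrite !mnmE (inj_eq perm_inj).
Qed.

Section Dunkl.
Context (kappa : R).
Local Notation D := (dunkl kappa).
Local Notation U := (cherednik kappa).

Definition xderiv i f : V := [ffun E => mderiv i (f E)].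

Lemma xderiv_is_linear i : linear (xderiv i).
Proof. by move=> c f g; apply/ffunP=> E; rewrite !ffunE linearP. Qed.
HB.instance Definition _ i := GRing.isLinear.Build R V V *:%R (xderiv i) (xderiv_is_linear i).

Lemma xact_xderiv w i f : xderiv (w i) (xact w f) = xact w (xderiv i f).
Proof. by apply/ffunP=> E; rewrite !ffunE mderiv_msym. Qed.

Lemma xderiv_thmul i j f : xderiv i (thmul j f) = thmul j (xderiv i f).
Proof.
apply/ffunP=> E; rewrite !ffunE; case: ifP => _; last by rewrite mderiv0.
by rewrite -mpolyC1 -mpolyCN -rmorphXn /= mderiv_mulC.
Qed.

Lemma xderiv_thword i s : xderiv i (thword R s) = 0.
Proof.
elim: s => [|j s IHs] /=; last by rewrite xderiv_thmul IHs linear0.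
by apply/ffunP=> E; rewrite !ffunE -mpolyC_nat mderivC.
Qed.

Lemma xderiv_xmul i q f : xderiv i (xmul q f) = xmul (mderiv i q) f + xmul q (xderiv i f).
Proof. by apply/ffunP=> E; rewrite !ffunE mderivM. Qed.

Lemma xderiv_thact i w f : xderiv i (thact w f) = thact w (xderiv i f).
Proof.
apply: (linear_eq (G := xderiv i \o thact w) (H := thact w \o xderiv i)) => q E /=.
rewrite thact_xmul !xderiv_xmul linearD /= !thact_xmul thact_phi xderiv_thword.
by rewrite -[in RHS](thword_enum R E) xderiv_thword !linear0.
Qed.

Lemma xderiv_sact w i f : xderiv (w i) (sact w f) = sact w (xderiv i f).
Proof. by rewrite !sactE xderiv_thact xact_xderiv. Qed.

Lemma dunklE i f : D i f = xderiv i f + kappa *: \sum_(j | j != i) xdiff i j f.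
Proof. by []. Qed.

Lemma dunkl_is_linear i : linear (D i : V -> V).
Proof.
move=> c f g; rewrite !dunklE linearP /=.
have e j : j != i -> xdiff i j (c *: f + g) = c *: xdiff i j f + xdiff i j g.
  by move=> ji; rewrite xdiff_is_linear // eq_sym.
rewrite [X in _ + _ *: X = _](eq_bigr _ e) big_split /= -scaler_sumr.
by rewrite !scalerDr !scalerA [kappa * c]mulrC addrACA.
Qed.
HB.instance Definition _ i := GRing.isLinear.Build R V V *:%R (D i) (dunkl_is_linear i).

Lemma in_sP_dunkl m i f : in_sP m f -> in_sP m (D i f).
Proof.
move=> hf; apply: in_sPD; first by move=> E hE; rewrite ffunE hf // mderiv0.
by apply/in_sPZ/in_sP_sum => j ji; apply: in_sP_xdiff; rewrite // eq_sym.
Qed.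

(** Conjugation permutes the reflections, hence the Dunkl operators are permuted like
    the variables. *)
Lemma dunkl_sact w i f : D (w i) (sact w f) = sact w (D i f).
Proof.
rewrite !dunklE xderiv_sact sactD sactZ sact_sum; congr (_ + _ *: _).
rewrite (reindex_inj (@perm_inj _ w)) /=.
apply: eq_big => [j|j]; rewrite (inj_eq perm_inj) // => ji.
by rewrite xdiff_sact // eq_sym.
Qed.

Lemma xderiv_xvar i k f : xderiv i (xmul 'X_k f) = (i == k)%:R *: f + xmul 'X_k (xderiv i f).
Proof.
rewrite xderiv_xmul mderivX; congr (_ + _); rewrite xmulZ mnmE eq_sym.
have [<-|_] := eqVneq i k; last by rewrite !scale0r.
have -> : (U_(i) - U_(i))%MM = 0%MM :> 'X_{1..N} by apply/mnmP=> l; rewrite !mnmE subnn.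
by rewrite mpolyX0 xmul1.
Qed.

(** The commutator of [D_i] and [x_i]: the derivative contributes [f], and every
    divided difference its reflection. *)
Lemma dunkl_xvar_same i f :
  D i (xmul 'X_i f)
    = xmul 'X_i (D i f) + f + kappa *: \sum_(j | j != i) sact (tperm i j) f.
Proof.
rewrite !dunklE xderiv_xvar eqxx scale1r xmulDr xmulZr /=.
rewrite xmul_sumr /= [f + _]addrC -!addrA; congr (_ + _).
rewrite [RHS]addrCA; congr (_ + _); rewrite -scalerDr -big_split /=; congr (_ *: _).
apply: eq_bigr => j ji; rewrite xdiff_xvar ?(eq_sym i) //.
by rewrite eqxx (negbTE ji) subr0 scale1r.
Qed.

(** Only the divided difference along [(i, k)] sees [x_k], with the opposite sign. *)
Lemma dunkl_xvar_other i k f : k != i ->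
  D i (xmul 'X_k f) = xmul 'X_k (D i f) - kappa *: sact (tperm i k) f.
Proof.
move=> ki; rewrite !dunklE xderiv_xvar eq_sym (negbTE ki) scale0r add0r.
rewrite xmulDr xmulZr /= xmul_sumr /=.
rewrite -addrA -scalerBr; congr (_ + _ *: _).
rewrite (bigD1 k) //= [in RHS](bigD1 k) //= xdiff_xvar; last by rewrite eq_sym.
rewrite (negbTE ki) eqxx sub0r scaleN1r -[RHS]addrAC; congr (_ + _).
apply: eq_bigr => j /andP[ji jk]; rewrite xdiff_xvar; last by rewrite eq_sym.
by rewrite (negbTE ki) eq_sym (negbTE jk) subrr scale0r addr0.
Qed.

Lemma cherednikE i f :
  U i f = D i (xmul 'X_i f) - kappa *: \sum_(j : 'I_N | (j < i)%N) sact (tperm i j) f.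
Proof. by []. Qed.

Lemma cherednik_is_linear i : linear (U i : V -> V).
Proof.
move=> c f g; rewrite !cherednikE xmulDr xmulZr linearP /=.
rewrite (eq_bigr (fun j => c *: sact (tperm i j) f + sact (tperm i j) g)); last first.
  by move=> j _; rewrite linearP.
rewrite big_split /= -scaler_sumr scalerBr [kappa *: (_ + _)]scalerDr.
by rewrite !scalerA [kappa * c]mulrC addrACA opprD.
Qed.
HB.instance Definition _ i := GRing.isLinear.Build R V V *:%R (U i) (cherednik_is_linear i).

Lemma dunkl_xvar_sact w i f : D (w i) (xmul 'X_(w i) (sact w f)) = sact w (D i (xmul 'X_i f)).
Proof. by rewrite -sact_xvar dunkl_sact. Qed.

End Dunkl.
End Action.

(** * Hecke relations and the raising operator *)

Section Hecke.
Context (R : realFieldType) (N : nat) (kappa : R).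
Local Notation V := (superpoly R N).
Local Notation D := (dunkl kappa).
Local Notation U := (cherednik kappa).
Implicit Types (m : nat) (f g : V) (q : {mpoly R[N]}) (E F : {set 'I_N}).
Implicit Types (w v : 'S_N) (i j h k : 'I_N).

Section SimpleReflection.
Context (i j : 'I_N) (hij : j = i.+1 :> nat).
Let s := tperm i j.

(** Degenerate Hecke relation: the truncated sums of reflections in [U_i] and
    [U_(i+1)] differ, after conjugation by [s_i], by exactly [s_i], and this produces the
    scalar [kappa]. *)
Lemma cherednik_simple_l f : U j (sact s f) = sact s (U i f) - kappa *: f.
Proof.
rewrite !cherednikE sactB sactZ sact_sum -dunkl_xvar_sact /s tpermL.
rewrite -[RHS]addrA -opprD -scalerDr; congr (_ - _ *: _).
rewrite (bigD1 i) /=; last by rewrite hij.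
rewrite addrC; congr (_ + _); last by rewrite tpermC tpermS_sact.
apply: eq_big => [k|k]; first by rewrite hij ltnS [RHS]ltn_neqAle andbC.
rewrite hij ltnS => /andP[ki nki]; rewrite -[RHS]sact_sact_conj tpermL.
have -> // : tperm i j k = k.
rewrite tpermD // eq_sym //; apply/eqP=> e.
by move: ki; rewrite e hij ltnn.
Qed.

Lemma cherednik_simple_r f : U i (sact s f) = sact s (U j f) + kappa *: f.
Proof.
have := cherednik_simple_l (sact s f); rewrite tpermS_sact => ->.
by rewrite sactB sactZ !tpermS_sact subrK.
Qed.

Lemma cherednik_simple_other k f : k != i -> k != j -> U k (sact s f) = sact s (U k f).
Proof.
move=> ki kj; have sk : s k = k by rewrite tpermD // eq_sym.
rewrite !cherednikE sactB sactZ sact_sum -dunkl_xvar_sact sk.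
congr (_ - _ *: _); rewrite (reindex_inj (@perm_inj _ s)) /=.
apply: eq_big => [l|l _]; last by rewrite -[RHS]sact_sact_conj sk.
rewrite /s; case: tpermP => // ->; move: ki kj; rewrite -!val_eqE /= hij; lia.
Qed.
End SimpleReflection.

End Hecke.

Section Affine.
Context (R : realFieldType) (n : nat) (kappa : R).
Local Notation N := n.+1.
Local Notation V := (superpoly R N).
Local Notation D := (dunkl kappa).
Local Notation U := (cherednik kappa).
Implicit Types (m : nat) (f g : V) (i j h k : 'I_N).

Definition cyc : 'S_N := perm (@ord_pred_inj N).

Lemma cyc0 : cyc ord0 = ord_max.
Proof. by apply: val_inj; rewrite permE /= modn_small. Qed.

Lemma cycS i j : j = i.+1 :> nat -> cyc j = i.
Proof.
move=> e; apply: val_inj; rewrite permE /= e addSn /= modnDr modn_small //.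
Qed.

(** The raising operator of the affine Hecke algebra: it increases the degree by one
    and permutes the Cherednik operators cyclically, up to a shift by 1. *)
Definition affine f : V := xmul 'X_ord_max (sact cyc f).

Lemma affine_is_linear : linear affine.
Proof. by move=> c f g; rewrite /affine sactD sactZ xmulDr xmulZr. Qed.
HB.instance Definition _ := GRing.isLinear.Build R V V *:%R affine affine_is_linear.

Lemma cherednik_first f : U ord0 f = D ord0 (xmul 'X_ord0 f).
Proof. by rewrite cherednikE big_pred0 // scaler0 subr0. Qed.

(** All the reflections in the commutator of [D_N] and [x_N] are cancelled by the
    sum subtracted in [U_N]; the shift by 1 remains. *)
Lemma cherednik_affine_max f : U ord_max (affine f) = affine (U ord0 f + f).
Proof.
rewrite /affine cherednikE dunkl_xvar_same.
have -> : \sum_(j | j != ord_max) sact (tperm ord_max j) (xmul 'X_ord_max (sact cyc f))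
   = \sum_(j : 'I_N | (j < (ord_max : 'I_N))%N) sact (tperm ord_max j) (xmul 'X_ord_max (sact cyc f)).
  apply: eq_big => [j|j _] //.
  by rewrite -val_eqE /= ltn_neqAle -ltnS ltn_ord andbT.
rewrite [X in _ - _ *: X](eq_bigr (fun j => sact (tperm ord_max j)
    (xmul 'X_ord_max (sact cyc f)))); last by move=> j _; rewrite tpermC.
rewrite addrK -xmulDr cherednik_first sactD -dunkl_xvar_sact cyc0.
by [].
Qed.

(** Moving [D_i] past [x_N] produces the reflection [(i, N)], which corresponds under
    the cycle to the reflection [(i+1, 1)] of [U_(i+1)]. *)
Lemma cherednik_affine i j f : j = i.+1 :> nat -> U i (affine f) = affine (U j f).
Proof.
move=> hij; have imax : (i < n)%N by rewrite -ltnS -hij ltn_ord.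
have ne : ord_max != i by rewrite -val_eqE /= gtn_eqF.
rewrite /affine !cherednikE xmulC dunkl_xvar_other // sact_xvar tpermL.
rewrite sactB sactZ -dunkl_xvar_sact (cycS hij) xmulBr xmulZr.
rewrite -[LHS]addrA -opprD -scalerDr; congr (_ - _ *: _).
rewrite [in RHS](bigD1 ord0) /=; last by rewrite hij.
have -> : sact cyc (sact (tperm j ord0) f
      + \sum_(k : 'I_N | (k < j)%N && (k != ord0)) sact (tperm j k) f)
    = sact (tperm i ord_max) (sact cyc f)
      + \sum_(k : 'I_N | (k < i)%N) sact (tperm i k) (sact cyc f).
  rewrite sactD; congr (_ + _); first by rewrite -sact_sact_conj cyc0 (cycS hij).
  rewrite sact_sum.
  rewrite [LHS](reindex_inj (@perm_inj _ cyc^-1%g)) /=.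
  apply: eq_big => [k|k _]; last by rewrite -sact_sact_conj (cycS hij) permKV.
  case: (unliftP ord_max k) => [k' ->|->].
    have -> : (cyc^-1)%g (lift ord_max k') = lift ord0 k'.
      by apply: (@perm_inj _ cyc); rewrite permKV (@cycS (lift ord_max k')) // lift0 lift_max.
    by rewrite lift0 hij ltnS lift_max andbT.
  have -> : (cyc^-1)%g ord_max = ord0 by apply: (@perm_inj _ cyc); rewrite permKV cyc0.
  by rewrite eqxx andbF ltnNge ltnW.
rewrite xmulDr; congr (_ + _); rewrite [RHS]xmul_sumr.
apply: eq_bigr => k ki; rewrite sact_xvar tpermD //; rewrite eq_sym // -val_eqE /=.
by rewrite gtn_eqF // (ltn_trans ki).
Qed.
End Affine.

(** * The bilinear form *)

Section Form.
Context (R : realFieldType) (N : nat) (kappa : R) (m : nat).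
Local Notation V := (superpoly R N).
Local Notation D := (dunkl kappa).
Local Notation U := (cherednik kappa).
Context (B : V -> V -> R) (hB : is_form kappa m B).
Implicit Types (f g h : V) (i j : 'I_N) (E F : {set 'I_N}).

(** The axioms constrain [B] on the superpolynomials of degree [m] in the thetas only,
    so every use of bilinearity carries membership conditions. *)
Lemma bformDl f g h : in_sP m f -> in_sP m g -> in_sP m h -> B (f + g) h = B f h + B g h.
Proof. by move=> hf hg hh; rewrite -[f]scale1r (form_lin hB) // scale1r mul1r. Qed.

Lemma bform0l h : in_sP m h -> B 0 h = 0.
Proof.
move=> hh; have := bformDl (@in_sP0 R N m) (@in_sP0 R N m) hh.
by rewrite addr0 => /eqP; rewrite -subr_eq0 opprD addNKr oppr_eq0 => /eqP.
Qed.

Lemma bformZl (c : R) f h : in_sP m f -> in_sP m h -> B (c *: f) h = c * B f h.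
Proof.
move=> hf hh; rewrite -[c *: f]addr0 (form_lin hB) ?bform0l ?addr0 //.
exact: in_sP0.
Qed.

Lemma bformBl f g h : in_sP m f -> in_sP m g -> in_sP m h -> B (f - g) h = B f h - B g h.
Proof.
move=> hf hg hh; rewrite bformDl //; last exact: in_sPN.
by rewrite -scaleN1r bformZl // mulN1r.
Qed.

Lemma bform_suml (I : Type) (r : seq I) (P : pred I) (G : I -> V) h :
  (forall x, P x -> in_sP m (G x)) -> in_sP m h ->
  B (\sum_(x <- r | P x) G x) h = \sum_(x <- r | P x) B (G x) h.
Proof.
move=> hG hh; pose K f b := in_sP m f /\ B f h = b.
suff [] : K (\sum_(x <- r | P x) G x) (\sum_(x <- r | P x) B (G x) h) by [].
apply: (big_ind2 K); first by split; [apply: in_sP0 | apply: bform0l].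
  by move=> f b g c [hf <-] [hg <-]; split; [apply: in_sPD | apply: bformDl].
by move=> x Px; split; [apply: hG|].
Qed.

Lemma bformZr (c : R) f h : in_sP m f -> in_sP m h -> B h (c *: f) = c * B h f.
Proof.
move=> hf hh; rewrite (form_sym hB) // ?bformZl //; last exact: in_sPZ.
by rewrite (form_sym hB).
Qed.

Lemma bformBr f g h : in_sP m f -> in_sP m g -> in_sP m h -> B h (f - g) = B h f - B h g.
Proof.
move=> hf hg hh; rewrite (form_sym hB) //; last exact: in_sPB.
by rewrite bformBl // ![B _ h](form_sym hB).
Qed.

Lemma form_tperm i j f g : in_sP m f -> in_sP m g ->
  B (sact (tperm i j) f) g = B f (sact (tperm i j) g).
Proof.
move=> hf hg; rewrite -(form_act hB (tperm i j)) ?tpermS_sact //.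
exact: in_sP_sact.
Qed.

(** <D_i x_i f, g> = <x_i f, x_i g> is symmetric in f and g, and the reflections are
    self-adjoint, being isometric involutions. *)
Lemma cherednik_sym i f g : in_sP m f -> in_sP m g -> B (U i f) g = B f (U i g).
Proof.
move=> hf hg; rewrite !cherednikE.
have hx h : in_sP m h -> in_sP m (xmul 'X_i h) by apply: in_sP_xmul.
have hD h : in_sP m h -> in_sP m (D i (xmul 'X_i h)) by move=> hh; apply/in_sP_dunkl/hx.
have hs h : in_sP m h -> in_sP m (\sum_(j : 'I_N | (j < i)%N) sact (tperm i j) h).
  by move=> hh; apply: in_sP_sum => j _; apply: in_sP_sact.
have hks h : in_sP m h -> in_sP m (kappa *: \sum_(j : 'I_N | (j < i)%N) sact (tperm i j) h).
  by move=> hh; apply/in_sPZ/hs.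
rewrite bformBl ?bformBr; do ?[exact: hf|exact: hg|exact: hD|exact: hks].
congr (_ - _).
  rewrite (form_sym hB); do ?[exact: hg|exact: hD].
  rewrite -(form_dunkl hB); do ?[exact: hg|exact: hx].
  rewrite (form_sym hB); do ?[exact: hx].
  by rewrite (form_dunkl hB); do ?[exact: hf|exact: hx].
rewrite bformZl ?bformZr; do ?[exact: hf|exact: hg|exact: hs].
congr (_ * _); rewrite bform_suml // => [|j _]; last exact: in_sP_sact.
rewrite [RHS](form_sym hB) //; last exact: hs.
rewrite bform_suml // => [|j _]; last exact: in_sP_sact.
apply: eq_bigr => j _; rewrite form_tperm // (form_sym hB) //.
exact: in_sP_sact.
Qed.

Lemma form_eigen_orth (L : V -> V) (a b : R) f g :
  (forall f g, in_sP m f -> in_sP m g -> B (L f) g = B f (L g)) ->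
  in_sP m f -> in_sP m g -> L f = a *: f -> L g = b *: g -> a != b -> B f g = 0.
Proof.
move=> symL hf hg ef eg ne; have := symL f g hf hg.
rewrite ef eg bformZl // bformZr // => /eqP; rewrite -subr_eq0 -mulrBl mulf_eq0 subr_eq0.
by rewrite (negbTE ne) => /eqP.
Qed.

(** Pythagoras, applied to [w f = g + b f] with [g := w f - b f] orthogonal to [f]: as
    [w] is an isometry, [g] has norm [(1 - b^2) B f f]. *)
Lemma form_pythagoras w (b : R) f : in_sP m f ->
  B (sact w f - b *: f) f = 0 ->
  B (sact w f - b *: f) (sact w f - b *: f) = (1 - b ^+ 2) * B f f.
Proof.
move=> hf e; have hw : in_sP m (sact w f) by apply: in_sP_sact.
have hb : in_sP m (b *: f) by apply: in_sPZ.
move: e; rewrite bformBl // bformZl // => /eqP; rewrite subr_eq0 => /eqP e.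
rewrite bformBl ?bformBr // ?bformZl ?bformZr //; try exact: in_sPB.
rewrite (form_act hB) // [B f (sact w f)](form_sym hB) // e; ring.
Qed.

Lemma in_P_sum f : in_P m f -> exists c : {set 'I_N} -> R,
  f = \sum_(E : {set 'I_N} | #|E| == m) c E *: phi R E.
Proof.
move=> [hf hc]; have c1 E : {c : R | f E = c%:MP}.
  by exists ((f E)@_0%MM); case: (hc E) => c ->; rewrite mcoeffC eqxx mulr1.
exists (fun E => sval (c1 E)); rewrite [LHS]superpoly_phi (bigID (fun E => #|E| == m)) /=.
rewrite [X in _ + X]big1 ?addr0 => [|E /eqP hE]; last first.
  by rewrite hf //; apply/ffunP=> F; rewrite !ffunE mul0r.
apply: eq_bigr => E _; case: (c1 E) => c /= ->.
by apply/ffunP=> F; rewrite !ffunE mul_mpolyC.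
Qed.

Lemma form_phi_sum (c d : {set 'I_N} -> R) :
  B (\sum_(E : {set 'I_N} | #|E| == m) c E *: phi R E)
    (\sum_(E : {set 'I_N} | #|E| == m) d E *: phi R E)
  = \sum_(E : {set 'I_N} | #|E| == m) c E * d E.
Proof.
have hp E : #|E| == m -> in_sP m (phi R E) by move=> /eqP <-; apply: in_sP_phi.
have hz b E : #|E| == m -> in_sP m (b *: phi R E) by move=> hE; apply/in_sPZ/hp.
have hs b : in_sP m (\sum_(E : {set 'I_N} | #|E| == m) b E *: phi R E).
  by apply: in_sP_sum => E; apply: hz.
rewrite bform_suml; [|by move=> E; apply: hz|exact: hs].
apply: eq_bigr => E hE; rewrite bformZl; [|exact: hp|exact: hs].
congr (_ * _); rewrite (form_sym hB); [|exact: hp|exact: hs].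
rewrite bform_suml; [|by move=> F; apply: hz|exact: hp].
rewrite (bigD1 E) //= big1 => [|F /andP[hF ne]]; last first.
  by rewrite bformZl ?(form_phi hB) ?(negbTE ne) ?mulr0 //; do ?[exact/eqP | exact: hp].
rewrite addr0 bformZl ?(form_phi hB) ?eqxx ?mulr1 //; do ?[exact/eqP | exact: hp].
Qed.

(** In degree 0 in [x] the form is a sum of squares; in higher degrees it need not be
    definite. *)
Lemma form_def f : in_P m f -> B f f = 0 -> f = 0.
Proof.
move=> /in_P_sum [c ->]; rewrite form_phi_sum => /eqP.
rewrite psumr_eq0 => [/allP h|E _]; last by rewrite -expr2 sqr_ge0.
rewrite big1 // => E hE; have := h E (mem_index_enum E).
by rewrite hE /= mulf_eq0 orbb => /eqP ->; rewrite scale0r.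
Qed.

End Form.

Section AffineNorm.
Context (R : realFieldType) (n : nat) (kappa : R) (m : nat).
Local Notation N := n.+1.
Context (B : superpoly R N -> superpoly R N -> R) (hB : is_form kappa m B).

(** The adjoint of [x_N] is [D_N], and conjugation by the cycle, which is an isometry,
    turns [D_N x_N] into [D_1 x_1 = U_1]. *)
Lemma form_affine f : in_sP m f -> B (affine f) (affine f) = B f (cherednik kappa ord0 f).
Proof.
move=> hf; have hw : in_sP m (sact (cyc n) f) by apply: in_sP_sact.
rewrite /affine (form_dunkl hB) //; last exact: in_sP_xmul.
rewrite -(cyc0 n) dunkl_xvar_sact (form_act hB) //; last exact/in_sP_dunkl/in_sP_xmul.
by rewrite cherednik_first.
Qed.
End AffineNorm.

(** * Adjacent transpositions *)

Section PermInd.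
Context (N : nat).
Implicit Types (w : 'S_N) (i j : 'I_N).

Lemma ord_adj_homo (K : 'I_N -> nat) :
  (forall i j, j = i.+1 :> nat -> (K i < K j)%N) -> forall i j, (i < j)%N -> (K i < K j)%N.
Proof.
move=> hK i j; have [d] := ubnP (j - i); elim: d => // d IHd in j *; rewrite ltnS => hd lt.
have lt' : (j.-1 < N)%N by rewrite (leq_ltn_trans (leq_pred _)).
have ej : j = (Ordinal lt').+1 :> nat by rewrite /= prednK // (leq_trans _ lt).
have := hK _ _ ej; have [->//|ne] := eqVneq i (Ordinal lt').
apply: ltn_trans; apply: IHd; first by rewrite /=; lia.
by move: ne; rewrite -val_eqE /=; lia.
Qed.

(** No label lies between [i] and [i + 1], so their transposition reverses no pair but
    its own. *)
Lemma tperm_adj_lt i j (x y : 'I_N) : j = i.+1 :> nat -> (x < y)%N ->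
  (x != i) || (y != j) -> (tperm i j x < tperm i j y)%N.
Proof.
move=> ij lt; rewrite -!val_eqE /= => ne.
have tE z : val (tperm i j z) = if val z == val i then val j else if val z == val j then val i else val z.
  rewrite !val_eqE; case: tpermP => [->|->|/eqP/negbTE -> /eqP/negbTE -> //]; rewrite ?eqxx //.
  by case: eqP => // ->.
move: lt ne; rewrite -[(_ < tperm i j y)%N]/(val (tperm i j x) < val (tperm i j y))%N !tE /= ij.
case: (@eqP _ (x : nat) i) => ?; case: (@eqP _ (y : nat) i) => ?;
  case: (@eqP _ (x : nat) i.+1) => ?; case: (@eqP _ (y : nat) i.+1) => ?; lia.
Qed.

(** An increasing [w] satisfies [i <= w i], and both sides have the same sum. *)
Lemma perm_homo_id w : (forall i j, j = i.+1 :> nat -> (w i < w j)%N) -> w = 1%g.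
Proof.
move=> /(ord_adj_homo (K := fun i => val (w i))) hw.
have le i : (i <= w i)%N.
  case: i => k; elim: k => [//|k IHk] lt.
  have lt' : (k < N)%N by apply: ltnW.
  by apply: (leq_ltn_trans (IHk lt')); apply: hw.
have := @leqif_sum _ predT (fun i => i == w i) (fun i => val i) (fun i => val (w i)).
case=> [i _|_]; first exact/leqif_eq/le.
rewrite [X in X == _](reindex_inj (@perm_inj _ w)) /= eqxx => /esym/forallP e.
by apply/permP=> i; rewrite perm1; apply/esym/eqP/e.
Qed.

Lemma adjacentP (r : rel 'I_N) : (exists i j, j = i.+1 :> nat /\ r i j)
  \/ (forall i j, j = i.+1 :> nat -> ~~ r i j).
Proof.
have [/existsP[i /existsP[j /andP[/eqP ij h]]]|noex] :=
  boolP [exists i : 'I_N, exists j : 'I_N, (j == i.+1 :> nat) && r i j].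
  by left; exists i, j.
right=> i j ij; apply: contra noex => h.
by apply/existsP; exists i; apply/existsP; exists j; rewrite ij eqxx.
Qed.

Lemma perm_descentP w : w = 1%g \/ exists i j, j = i.+1 :> nat /\ (w j < w i)%N.
Proof.
have [|noex] := adjacentP (fun i j => w j < w i)%N; [by right | left].
apply: perm_homo_id => i j ij; have := noex i j ij; rewrite -leqNgt leq_eqVlt.
by case/orP=> // /eqP/val_inj/perm_inj e; move: ij; rewrite e; lia.
Qed.

(** Removing a descent increases [\sum_i i * w i], so every permutation is reached from
    the identity by creating descents one at a time. *)
Lemma perm_descent_ind (P : 'S_N -> Prop) : P 1%g ->
  (forall w i j, j = i.+1 :> nat -> (w j < w i)%N -> P (tperm i j * w)%g -> P w) ->
  forall w, P w.
Proof.
(* [N * (N * N)] bounds the sum, so the difference decreases. *)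
move=> P1 Pstep w; have [d] := ubnP (N * (N * N) - \sum_(x < N) x * w x).
elim: d => // d IHd in w *; rewrite ltnS => hd.
have [->//|[i [j [ij lt]]]] := perm_descentP w.
apply: (Pstep _ i j) => //; apply: IHd; apply: leq_trans hd.
have nij : j != i by rewrite -val_eqE /= ij; lia.
have lt_sum : (\sum_(x < N) x * w x < \sum_(x < N) x * (tperm i j * w)%g x)%N.
  rewrite (bigD1 i) //= [X in (_ < X)%N](bigD1 i) //= (bigD1 j) //= [X in (_ < _ + X)%N](bigD1 j) //=.
  rewrite !permM tpermL tpermR !addnA; set S1 := (\sum_(_ | _) _)%N; set S2 := (\sum_(_ | _) _)%N.
  have -> : S1 = S2.
    by apply: eq_bigr => x /andP[xi xj]; rewrite permM tpermD // eq_sym.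
  rewrite ltn_add2r ij !mulSn; move: lt; clear.
  by move: (nat_of_ord (w i)) (nat_of_ord (w j)) (nat_of_ord i) => a b c; nia.
have le_sum : (\sum_(x < N) x * (tperm i j * w)%g x <= N * (N * N))%N.
  rewrite -[X in (_ <= X * _)%N]card_ord -sum_nat_const; apply: leq_sum => x _.
  by apply: leq_mul; apply: ltnW.
by apply: ltn_sub2l => //; apply: leq_trans lt_sum le_sum.
Qed.

Lemma perm_simple_ind (P : 'S_N -> Prop) : P 1%g ->
  (forall w i j, j = i.+1 :> nat -> P w -> P (tperm i j * w)%g) -> forall w, P w.
Proof.
move=> P1 Pstep; apply: perm_descent_ind => // w i j ij _ /(Pstep _ _ _ ij).
by rewrite mulgA tperm2 mul1g.
Qed.
End PermInd.

(** * Contents of hook tableaux *)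

Section LegContents.
Context (n : nat).
Local Notation N := n.+1.
Implicit Types (A E F : {set 'I_N}) (i j : 'I_N) (w : 'S_N).

(** Content of the cell labelled [i] in the hook whose column 1 is filled by [A]. For
    [k = 1] it is used on the transposed shape, where contents change sign. *)
Definition hook_content A i : int :=
  if i \in A then - (scount i A)%:Z else (scount i (~: A))%:Z + 1.

(** The line of [Y_E] whose labels, corner included, are [E] or its complement: column 1
    for [k = 0], row 1 for [k = 1]. Up to transposition this treats both cases at once; the
    rest of the hook is called the arm. *)
Definition leg k (E : {set 'I_N}) : {set 'I_N} := if k then ~: E else E.

Lemma legK k E : leg k (leg k E) = E.
Proof. by case: k => //=; rewrite setCK. Qed.

Lemma content_leg k i E : content k i E = (-1) ^+ k * hook_content (leg k E) i.
Proof.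
rewrite /content /hook_content; case: k => /=; last by rewrite mul1r; case: ifP.
by rewrite inE expr1 mulN1r setCK; case: ifP => _ /=; rewrite ?opprK // opprD addrC.
Qed.

Lemma scount_ltE A i j : i \in A -> (j < i)%N -> (scount i A < scount j A)%N.
Proof.
move=> iA lt; apply: proper_card; apply/properP; split.
  by apply/subsetP=> x; rewrite !inE => /andP[-> h]; apply: ltn_trans h.
by exists i; rewrite !inE iA ?ltnn.
Qed.

Lemma scount_card A i : i \in A -> (scount i A < #|A|)%N.
Proof.
move=> iA; apply: proper_card; apply/properP; split.
  by apply/subsetP=> x; rewrite !inE => /andP[].
by exists i; rewrite // !inE ltnn andbF.
Qed.

Lemma scount_inj A i j : i \in A -> j \in A -> scount i A = scount j A -> i = j.
Proof.
move=> iA jA e; apply: val_inj; case: (ltngtP i j) => // lt.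
  by have := scount_ltE jA lt; rewrite e ltnn.
by have := scount_ltE iA lt; rewrite e ltnn.
Qed.

Lemma hook_content_inj A : injective (hook_content A).
Proof.
move=> i j; rewrite /hook_content; case: ifP => iA; case: ifP => jA e.
- by apply: (scount_inj iA jA); lia.
- lia.
- lia.
- by apply: (@scount_inj (~: A)); rewrite ?inE ?iA ?jA //; lia.
Qed.

Lemma scount_succ A i j : j = i.+1 :> nat -> scount i A = ((j \in A) + scount j A)%N.
Proof.
move=> ij; rewrite /scount (cardsD1 j) !inE ij ltnSn andbT; congr (_ + _)%N.
by apply: eq_card => x; rewrite !inE -ij -val_eqE /= ij; case: (x \in A) => /=; lia.
Qed.

Lemma hook_content_succ A i j : j = i.+1 :> nat -> (i \in A) = (j \in A) ->
  hook_content A j = if j \in A then hook_content A i + 1 else hook_content A i - 1.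
Proof.
move=> ij e; rewrite /hook_content e !(@scount_succ _ i j) //.
by case: ifP => jA; rewrite ?inE ?jA /=; lia.
Qed.

Lemma hook_content_le0 A i : i \in A -> hook_content A i <= 0.
Proof. by rewrite /hook_content => ->; lia. Qed.
Lemma hook_content_ge1 A i : i \notin A -> 1 <= hook_content A i.
Proof. by rewrite /hook_content => /negbTE ->; lia. Qed.

Lemma lt_neq_max i j : (i < j)%N -> i != ord_max.
Proof. by apply: contraTneq => ->; rewrite -leqNgt -ltnS ltn_ord. Qed.

Lemma lt_ord_max i : i != ord_max -> (i < (ord_max : 'I_N))%N.
Proof. by rewrite -val_eqE ltn_neqAle -ltnS ltn_ord andbT. Qed.

Lemma hook_content_corner A : ord_max \in A -> hook_content A ord_max = 0.
Proof.
rewrite /hook_content => ->; rewrite /scount (_ : [set _ in _ | _] = set0) ?cards0 //.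
by apply/setP=> x; rewrite !inE ltnNge -ltnS ltn_ord andbF.
Qed.

Lemma hook_content_lt0 A i : ord_max \in A -> i \in A -> i != ord_max -> hook_content A i <= -1.
Proof.
move=> mA iA ne; have := hook_content_le0 iA; rewrite le_eqVlt => /orP[/eqP e|]; last by lia.
by case/eqP: ne; apply: (@hook_content_inj A); rewrite e hook_content_corner.
Qed.

Lemma hook_content_bound A i :
  - #|A|%:Z + 1 <= hook_content A i <= N%:Z - #|A|%:Z + (#|A| == 0)%N%:Z.
Proof.
have := cardsC A; rewrite card_ord /hook_content; case: ifP => iA hC.
  by have := scount_card iA; lia.
have iA' : i \in ~: A by rewrite inE iA.
by have := scount_card iA'; lia.
Qed.

Lemma scount_mono A w x : {in A &, forall i j, (i < j)%N -> (w i < w j)%N} ->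
  x \in A -> scount (w x) (w @: A) = scount x A.
Proof.
move=> mono xA; rewrite /scount -[in RHS](card_imset _ (@perm_inj _ w)).
apply: eq_card => y; apply/idP/imsetP => [|[z]]; rewrite !inE.
  case/andP=> /imsetP[z zA ->] lt; exists z => //; rewrite inE zA /=.
  by case: (ltngtP x z) => // [l|/val_inj e]; [have := mono _ _ zA xA l; lia | rewrite e ltnn in lt].
by case/andP=> zA lt ->; rewrite imset_f //=; apply: mono.
Qed.

Lemma imset_permC A w : w @: (~: A) = ~: (w @: A).
Proof.
apply/setP=> y; rewrite inE; rewrite -[y](permKV w).
by rewrite !(mem_imset _ _ (@perm_inj _ w)) inE.
Qed.

(** The cell of a label is determined by its rank within [A] or within the complement. *)
Lemma hook_content_mono A w x : {in A &, forall i j, (i < j)%N -> (w i < w j)%N} ->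
  {in ~: A &, forall i j, (i < j)%N -> (w i < w j)%N} ->
  hook_content (w @: A) (w x) = hook_content A x.
Proof.
move=> mono monoC; rewrite /hook_content (mem_imset _ _ (@perm_inj _ w)) -imset_permC.
by case: ifP => xA; rewrite scount_mono // inE xA.
Qed.

Lemma leg_imset k w E : leg k (w @: E) = w @: leg k E.
Proof. by case: k => //=; rewrite imset_permC. Qed.

Lemma tperm_mono A i j : j = i.+1 :> nat -> j \notin A ->
  {in A &, forall x y : 'I_N, (x < y)%N -> (tperm i j x < tperm i j y)%N}.
Proof.
move=> ij jA x y xA yA lt; apply: tperm_adj_lt => //; apply/orP; right.
by apply: contraNneq jA => <-.
Qed.

Lemma tperm_monoR A i j : j = i.+1 :> nat -> i \notin A ->
  {in A &, forall x y : 'I_N, (x < y)%N -> (tperm i j x < tperm i j y)%N}.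
Proof.
move=> ij iA x y xA yA lt; apply: tperm_adj_lt => //; apply/orP; left.
by apply: contraNneq iA => <-.
Qed.

(** An adjacent transposition that exchanges a label of [A] with one outside keeps the
    order within [A] and within its complement. *)
Lemma hook_content_tperm A i j x : j = i.+1 :> nat -> (i \in A) != (j \in A) ->
  hook_content (tperm i j @: A) (tperm i j x) = hook_content A x.
Proof.
move=> ij ne; have [[h1 h2]|[h1 h2]] : (i \in A) /\ (j \notin A) \/ (j \in A) /\ (i \notin A).
  by move: ne; case: (i \in A); case: (j \in A); [| left | right |].
- by apply: hook_content_mono; [apply: tperm_mono | apply: tperm_monoR]; rewrite ?inE ?h1.
- by apply: hook_content_mono; [apply: tperm_monoR | apply: tperm_mono]; rewrite ?inE ?h1.
Qed.

Definition legsize m k : nat := if k then (N - m).+1 else m.+1.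

Lemma hasN_max (E : {set 'I_N}) : hasN E = (ord_max \in E).
Proof.
apply/existsP/idP => [[i /andP[iE /eqP e]]|h]; last by exists ord_max; rewrite h /=.
by have -> : ord_max = i by apply: val_inj; case: e.
Qed.

Lemma EE_leg m k E : (1 <= m <= n)%N ->
  (E \in EE N m k) = (#|leg k E| == legsize m k) && (ord_max \in leg k E).
Proof.
move=> hm; rewrite /EE /leg /legsize; case: k; rewrite inE hasN_max //.
rewrite inE; congr (_ && _); have := cardsC E; rewrite card_ord => h.
apply/eqP/eqP; lia.
Qed.

Lemma EE_imset m k (w : 'S_N) E : (1 <= m <= n)%N -> E \in EE N m k ->
  ord_max \in w @: leg k E -> w @: E \in EE N m k.
Proof.
by move=> hm; rewrite !EE_leg // leg_imset card_imset; [case/andP=> -> _ -> | apply: perm_inj].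
Qed.

Lemma card_top a : (a <= N)%N -> #|[set i : 'I_N | (N <= a + i)%N]| = a.
Proof.
move=> ha; rewrite -[RHS]card_ord.
have hlt (x : 'I_a) : (N - x.+1 < N)%N by rewrite ltn_subrL.
rewrite -(card_imset _ (f := fun x : 'I_a => Ordinal (hlt x))) => [|x y [e]]; last first.
  by apply: val_inj; have := ltn_ord x; have := ltn_ord y; rewrite /=; lia.
apply: eq_card => i; rewrite inE; apply/idP/imsetP => [h|[x _ ->] /=]; last first.
  by have := ltn_ord x; lia.
have hx : (N - i.+1 < a)%N by have := ltn_ord i; lia.
exists (Ordinal hx) => //; apply: val_inj => /=; have := ltn_ord i; lia.
Qed.

(** A set of labels closed upwards is determined by its size. *)
Lemma leg_top A : (forall i j, j = i.+1 :> nat -> i \in A -> j \in A) ->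
  A = [set i : 'I_N | (N <= #|A| + i)%N].
Proof.
move=> up; have up' i j : (i <= j)%N -> i \in A -> j \in A.
  move=> le iA; have [d] := ubnP (j - i); elim: d => // d IHd in j le *; rewrite ltnS => hd.
  case: (ltngtP i j) le => // [lt _|/val_inj <- //].
  have lt' : (j.-1 < N)%N by rewrite (leq_ltn_trans (leq_pred _)).
  have ej : j = (Ordinal lt').+1 :> nat by rewrite /= prednK // (leq_trans _ lt).
  by apply: (up _ _ ej); apply: IHd => /=; lia.
have hA : (#|A| <= N)%N by rewrite -[X in (_ <= X)%N]card_ord max_card.
apply/eqP; rewrite eqEcard card_top // leqnn andbT; apply/subsetP=> i iA; rewrite inE.
have hi : (N - i <= N)%N by rewrite leq_subr.
have : (#|[set j : 'I_N | (N <= (N - i) + j)%N]| <= #|A|)%N.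
  apply: subset_leq_card; apply/subsetP=> j; rewrite inE => h; apply: (up' i) => //.
  by have := ltn_ord i; lia.
by rewrite card_top //; lia.
Qed.

Lemma tperm_mem i j x A : (x \in tperm i j @: A) = (tperm i j x \in A).
Proof. by rewrite -{1}[x](tpermK i j) (mem_imset _ _ (@perm_inj _ _)). Qed.

Lemma tperm_imsetK (i j : 'I_N) E : tperm i j @: (tperm i j @: E) = E.
Proof. by rewrite -imset_comp -[RHS]imset_id; apply: eq_imset => x /=; rewrite tpermK. Qed.

Definition inversions A : nat :=
  #|[set p : 'I_N * 'I_N | [&& (p.1 < p.2)%N, p.1 \in A & p.2 \notin A]]|.

(** The transposition maps the inversions of the new set injectively to inversions of
    [A], and misses [(i, j)]. *)
Lemma inversions_step A i j : j = i.+1 :> nat -> i \in A -> j \notin A ->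
  (inversions (tperm i j @: A) < inversions A)%N.
Proof.
move=> ij iA jA; set s := tperm i j; rewrite /inversions.
pose h (p : 'I_N * 'I_N) := (s p.1, s p.2).
have h_inj : injective h by case=> [a b] [c c'] [/perm_inj -> /perm_inj ->].
rewrite -(card_imset _ h_inj); apply: proper_card; apply/properP; split.
  apply/subsetP=> z /imsetP[[x y] hz ez]; move: hz; rewrite ez !inE /= !tperm_mem => /and3P[lt xA yA].
  rewrite xA yA !andbT; apply: tperm_adj_lt => //; apply/orP; left.
  by apply: contraTneq xA => ->; rewrite /s tpermL.
exists (i, j); first by rewrite inE /= ij ltnSn iA.
apply/imsetP=> -[[x y]]; rewrite inE /= => /and3P[lt _ _] [ex ey].
have := lt; have -> : x = j by rewrite -[x](tpermK i j) -/s -ex /s tpermL.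
by have -> : y = i; [rewrite -[y](tpermK i j) -/s -ey /s tpermR | rewrite ij ltnNge leqnSn].
Qed.

End LegContents.

Section Cproducts.
Context (R : realFieldType) (n m : nat) (hm : (1 <= m <= n)%N).
Local Notation N := n.+1.
Implicit Types (A E F : {set 'I_N}) (i j : 'I_N) (w : 'S_N).

Lemma leg_corner k E : E \in EE N m k -> ord_max \in leg k E.
Proof. by rewrite EE_leg // => /andP[]. Qed.

Lemma EE_tperm k E i j : E \in EE N m k -> j = i.+1 :> nat -> j != ord_max ->
  tperm i j @: E \in EE N m k.
Proof.
move=> hE ij jmax; apply: EE_imset => //; apply/imsetP; exists ord_max; first exact: leg_corner.
by rewrite tpermD //; apply/eqP=> e; have := ltn_ord j; rewrite ij e ltnn.
Qed.

Definition Cfactor k z E (p : 'I_N * 'I_N) : R :=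
  1 + (-1) ^+ z / (content k p.1 E - content k p.2 E)%:~R.

(** The label N lies in the leg, so the restriction [j < N] in [Cprod] is implied by the
    other conditions. *)
Lemma Cprod_leg k z E : E \in EE N m k ->
  Cprod R k z E
    = \prod_(p : 'I_N * 'I_N | [&& (p.1 < p.2)%N, p.1 \in leg k E & p.2 \notin leg k E])
        Cfactor k z E p.
Proof.
move=> hE; rewrite /Cprod pair_big_dep /=; apply: eq_bigl => -[i j] /=.
congr (_ && _); have := leg_corner hE; have -> : (j.+1 < N)%N = (j != ord_max).
  by rewrite -val_eqE /= ltn_neqAle -[X in _ = X]andbT; congr (_ && _); exact: ltn_ord.
rewrite /leg; case: k {hE} => /=; rewrite ?inE ?negbK => hmax.
  by case: (eqVneq j ord_max) hmax => [->|//] /negbTE ->; rewrite andbF.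
by case: (eqVneq j ord_max) hmax => [->|//] ->; rewrite andbF.
Qed.

Lemma content_mono k w E x :
  {in leg k E &, forall i j, (i < j)%N -> (w i < w j)%N} ->
  {in ~: leg k E &, forall i j, (i < j)%N -> (w i < w j)%N} ->
  content k (w x) (w @: E) = content k x E.
Proof. by move=> h1 h2; rewrite !content_leg leg_imset hook_content_mono. Qed.

(** A permutation that is increasing on the leg and on the arm preserves the contents,
    hence only the range of the product changes. *)
Lemma Cprod_imset k z w E : E \in EE N m k -> w @: E \in EE N m k ->
  {in leg k E &, forall i j, (i < j)%N -> (w i < w j)%N} ->
  {in ~: leg k E &, forall i j, (i < j)%N -> (w i < w j)%N} ->
  Cprod R k z (w @: E)
    = \prod_(p : 'I_N * 'I_N | [&& (w p.1 < w p.2)%N, p.1 \in leg k E & p.2 \notin leg k E])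
        Cfactor k z E p.
Proof.
move=> hE hE' h1 h2; rewrite Cprod_leg //.
pose h (p : 'I_N * 'I_N) := (w p.1, w p.2).
have h_inj : injective h by case=> [a b] [c d] [/perm_inj -> /perm_inj ->].
rewrite (reindex_inj h_inj) /=; apply: eq_big => [[i j]|[i j] _] /=.
  by rewrite leg_imset !(mem_imset _ _ (@perm_inj _ w)).
by rewrite /Cfactor /= !content_mono.
Qed.

Section Step.
Context (k : bool) (E : {set 'I_N}) (hE : E \in EE N m k).
Context (i j : 'I_N) (ij : j = i.+1 :> nat) (jmax : j != ord_max).
Hypothesis (iA : i \notin leg k E) (jA : j \in leg k E).
Let s := tperm i j.

(** The exchange puts exactly one more label of the leg before a label of the arm. *)
Lemma Cprod_step z : Cprod R k z (s @: E) = Cfactor k z E (j, i) * Cprod R k z E.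
Proof.
rewrite Cprod_imset ?(EE_tperm hE ij jmax) //; first last.
- by apply: tperm_mono => //; rewrite inE negbK.
- exact: tperm_monoR.
rewrite (bigD1 (j, i)) /=; last by rewrite /s tpermL tpermR ij ltnSn jA iA.
congr (_ * _); rewrite Cprod_leg //; apply: eq_bigl => -[x y] /=; rewrite xpair_eqE.
case: (boolP (x \in leg k E)) => xA; last by rewrite ?andbF ?andFb ?andbF.
case: (boolP (y \in leg k E)) => yA; first by rewrite ?andbF ?andFb.
have xi : x != i by apply: contraNneq iA => <-.
have yj : y != j by apply: contraNneq yA => ->.
rewrite /s !andbT.
case: (tpermP i j x) => [/eqP|->|_ /eqP xj]; first by rewrite (negbTE xi).
  case: (tpermP i j y) => [->|/eqP|/eqP yi _]; [|by rewrite (negbTE yj)|].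
    by rewrite !eqxx andbF ij ltnNge leqnSn.
  by rewrite eqxx (negbTE yi) andbT /=; move: yi yj; rewrite -!val_eqE /= ij; lia.
rewrite (negbTE xj) /= andbT; case: (tpermP i j y) => [->|/eqP|//]; last by rewrite (negbTE yj).
by move: xi xj; rewrite -!val_eqE /= ij; lia.
Qed.
End Step.

End Cproducts.

(** * Norms of the vectors T_E *)

Section TFamily.
Context (R : realFieldType) (n m : nat) (hm : (1 <= m <= n)%N) (kappa : R).
Local Notation N := n.+1.
Local Notation V := (superpoly R N).
Context (B : V -> V -> R) (hB : is_form kappa m B).
Context (T : {set 'I_N} -> V) (hT : is_Tfamily m T).
Implicit Types (A E F : {set 'I_N}) (i j : 'I_N) (w : 'S_N) (f g : V).

Lemma T_in_sP k E : E \in EE N m k -> in_sP m (T E).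
Proof. by move=> /(T_in_P hT) []. Qed.

(** The Jucys-Murphy elements, for the chain of subgroups that fix the smallest labels. *)
Definition JM i f : V := \sum_(l : 'I_N | (i < l)%N) sact (tperm i l) f.

Lemma in_sP_JM i f : in_sP m f -> in_sP m (JM i f).
Proof. by move=> hf; apply: in_sP_sum => l _; apply: in_sP_sact. Qed.

Lemma JM_is_linear i : linear (JM i).
Proof.
move=> c f g; rewrite /JM scaler_sumr -big_split /=; apply: eq_bigr => l _.
by rewrite sactD sactZ.
Qed.
HB.instance Definition _ i := GRing.isLinear.Build R V V *:%R (JM i) (JM_is_linear i).

Lemma JM_sym i f g : in_sP m f -> in_sP m g -> B (JM i f) g = B f (JM i g).
Proof.
move=> hf hg; rewrite (bform_suml hB) // => [|l _]; last exact: in_sP_sact.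
rewrite [RHS](form_sym hB) //; last exact: in_sP_JM.
rewrite (bform_suml hB) // => [|l _]; last exact: in_sP_sact.
apply: eq_bigr => l _; rewrite (form_tperm hB) // (form_sym hB) //.
exact: in_sP_sact.
Qed.

Lemma JM_T k E i : E \in EE N m k -> JM i (T E) = (content k i E)%:~R *: T E.
Proof. by move=> hE; rewrite /JM (T_eigen hT hE). Qed.

Lemma JM_conj w i f :
  sact w (JM i f) = \sum_(l : 'I_N | (i < l)%N) sact (tperm (w i) (w l)) (sact w f).
Proof. by rewrite /JM sact_sum; apply: eq_bigr => l _; rewrite sact_sact_conj. Qed.

(** Conjugation by [s_i] turns the sum for [i] into the sum for [j = i + 1], with the
    additional term [s_i]. *)
Lemma JM_simple i j f : j = i.+1 :> nat ->
  sact (tperm i j) (JM i f) = f + JM j (sact (tperm i j) f).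
Proof.
clear hm; move=> ij; have nij : i != j by rewrite -val_eqE /= ij; lia.
rewrite JM_conj (bigD1 j) /=; last by rewrite ij.
rewrite tpermL tpermR tpermC tpermS_sact; congr (_ + _).
apply: eq_big => [l|l /andP[il lj]]; first by rewrite -val_eqE /= ij; lia.
by rewrite (@tpermD _ i j l) // -?val_eqE /=; [lia | rewrite eq_sym].
Qed.

Section Adjacent.
Context (k : bool) (E : {set 'I_N}) (hE : E \in EE N m k).
Context (i j : 'I_N) (ij : j = i.+1 :> nat).
Local Notation delta := (content k i E - content k j E).

Lemma content_inj : injective (fun x => content k x E).
Proof.
move=> x y; rewrite !content_leg => e; apply: (@hook_content_inj _ (leg k E)).
by case: k e; rewrite ?expr1 ?expr0 ?mul1r ?mulN1r // => /oppr_inj.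
Qed.

Lemma content_diff_neq0 x y : x != y -> content k x E - content k y E != 0.
Proof. by rewrite subr_eq0; apply: contraNneq => /content_inj ->. Qed.

Lemma adj_neq : i != j.
Proof. by rewrite -val_eqE /= ij neq_ltn ltnSn. Qed.

(** The first argument is an eigenvector of [JM j] for the content of [i], whereas
    [T E] is one for the content of [j]. *)
Lemma T_reflection_orth : B (sact (tperm i j) (T E) - (delta%:~R)^-1 *: T E) (T E) = 0.
Proof.
have hTE := T_in_sP hE; have dn0 : (delta%:~R : R) != 0.
  by rewrite intr_eq0 content_diff_neq0 // adj_neq.
apply: (form_eigen_orth hB (L := JM j) (a := (content k i E)%:~R) (b := (content k j E)%:~R)).
- by move=> f g; apply: JM_sym.
- by apply: in_sPB; [apply: in_sP_sact | apply: in_sPZ].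
- by [].
- have := JM_simple (T E) ij; rewrite (JM_T i hE) sactZ => /eqP.
  rewrite addrC -subr_eq => /eqP e; rewrite linearB linearZ /= -e (JM_T j hE).
  rewrite scalerBr !scalerA -addrA; congr (_ + _); rewrite -opprD; congr (- _).
  rewrite -[X in X + _]scale1r -scalerDl; congr (_ *: _).
  by move: dn0; rewrite intrB => dn0; field.
- exact: JM_T.
- by rewrite -subr_eq0 -intrB.
Qed.

Lemma T_reflection_norm :
  B (sact (tperm i j) (T E) - (delta%:~R)^-1 *: T E)
    (sact (tperm i j) (T E) - (delta%:~R)^-1 *: T E)
  = (1 - (delta%:~R)^-1 ^+ 2) * B (T E) (T E).
Proof. by apply: (form_pythagoras hB); [apply: T_in_sP hE | apply: T_reflection_orth]. Qed.

Lemma sact_in_P w f : in_P m f -> in_P m (sact w f).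
Proof.
move=> hf; have [c ->] := in_P_sum hf; split.
  apply/in_sP_sact/in_sP_sum => G /eqP hG; apply/in_sPZ; rewrite -hG; exact: in_sP_phi.
move=> G; rewrite sact_sum sum_ffunE.
elim/big_ind: _ => [|a b [u eu] [v ev]|F _]; first by exists 0; rewrite mpolyC0.
  by exists (u + v); rewrite mpolyCD eu ev.
rewrite sactZ sactE xact_phi thact_phi ffunE.
suff [u eu] : exists u : R, thword R (map w (enum F)) G = u%:MP.
  by exists (c F * u); rewrite eu mpolyCM mul_mpolyC.
elim: (map w (enum F)) G => [|x s IHs] G /=.
  by exists (G == set0)%:R; rewrite ffunE mpolyC_nat.
have [u eu] := IHs (G :\ x); rewrite ffunE eu.
case: ifP => _; last by exists 0; rewrite mpolyC0.
exists ((-1) ^+ #|[set y in G | (y < x)%N]| * u).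
by rewrite mpolyCM rmorphXn /= mpolyCN.
Qed.

(** By [T_reflection_norm] the difference of the two sides has norm 0, and the form is
    definite in degree 0. *)
Lemma T_reflection_scalar : `|delta| = 1 -> sact (tperm i j) (T E) = (delta%:~R) *: T E.
Proof.
clear hm; move=> d1; have eV : ((delta%:~R)^-1 : R) = delta%:~R.
  have [->|->] : delta = 1 \/ delta = -1 by lia.
    by rewrite invr1.
  by rewrite rmorphN1 invrN1.
apply/eqP; rewrite -subr_eq0 -eV; apply/eqP.
apply: (form_def hB); last first.
  rewrite T_reflection_norm exprVn -rmorphXn /=; have -> : delta ^+ 2 = 1.
    by have [->|->] : delta = 1 \/ delta = -1 by lia.
  by rewrite invr1 subrr mul0r.
have [c1 c2] := sact_in_P (tperm i j) (T_in_P hT hE).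
have [d1' d2] := T_in_P hT hE; split.
  by apply: in_sPB; [|apply: in_sPZ].
move=> G; have [u eu] := c2 G; have [v ev] := d2 G.
exists (u - (delta%:~R)^-1 * v); rewrite ffunE [in LHS]ffunE [in X in _ - X]ffunE eu ev.
by rewrite mpolyCB mpolyCM mul_mpolyC.
Qed.

End Adjacent.

Lemma adj_same_leg k E i j : E \in EE N m k -> j = i.+1 :> nat ->
  (i \in leg k E) = (j \in leg k E) -> `|content k i E - content k j E| = 1.
Proof.
clear hm; move=> hE ij e; rewrite !content_leg (hook_content_succ ij e).
by case: ifP => _; case: k {hE e} => /=; rewrite ?expr1 ?expr0; lia.
Qed.

(** In terms of the leg the two normalisations of the [T E] coincide. *)
Lemma T_step_leg k E i j : E \in EE N m k -> j = i.+1 :> nat -> j != ord_max ->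
  i \notin leg k E -> j \in leg k E ->
  T (tperm i j @: E) = sact (tperm i j) (T E)
    - ((content k i E - content k j E)%:~R)^-1 *: T E.
Proof.
move=> hE ij jmax iA jA; apply: (T_step hT hE ij).
  by rewrite ltn_neqAle ltn_ord andbT; move: jmax; rewrite -val_eqE.
by move: iA jA; rewrite /leg; case: k {hE}; rewrite ?inE ?negbK => ->.
Qed.

Lemma form_phi_signs (S : {set 'I_N}) (c : 'I_N -> R) (G : 'I_N -> {set 'I_N}) :
  {in S &, injective G} -> {in S, forall j, #|G j| = m} -> {in S, forall j, c j ^+ 2 = 1} ->
  B (\sum_(j in S) c j *: phi R (G j)) (\sum_(j in S) c j *: phi R (G j)) = #|S|%:R.
Proof.
move=> G_inj cG cc.
have hp j : j \in S -> in_sP m (phi R (G j)).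
  by move=> jS; rewrite -(cG _ jS); apply: in_sP_phi.
have hz j : j \in S -> in_sP m (c j *: phi R (G j)) by move=> jS; apply/in_sPZ/hp.
have hs : in_sP m (\sum_(j in S) c j *: phi R (G j)) by apply: in_sP_sum.
rewrite (bform_suml hB) // -sum1_card natr_sum; apply: eq_bigr => j jS.
rewrite (form_sym hB) ?(bform_suml hB) //; try exact: hz.
rewrite (bigD1 j) //= big1 => [|l /andP[lS lj]].
  rewrite (bformZl hB) ?(bformZr hB) //; try exact: hp; try exact: hz.
  by rewrite (form_phi hB) ?cG // eqxx mulr1 -expr2 cc // addr0.
rewrite (bformZl hB) ?(bformZr hB) //; try exact: hp; try exact: hz.
rewrite (form_phi hB) ?cG //; case: eqP => [/G_inj e|]; last by rewrite !mulr0.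
by rewrite e // eqxx in lj.
Qed.

(** Without inversions the leg consists of the largest labels, and [T E] is one of the
    two normalised vectors: a sum of distinct basis vectors with signs. *)
Lemma T_norm_base k E : E \in EE N m k ->
  (forall i j, j = i.+1 :> nat -> i \in leg k E -> j \in leg k E) ->
  B (T E) (T E) = (nu N m k)%:R.
Proof.
move=> hE up; have := leg_top up.
have := hE; rewrite EE_leg // => /andP[/eqP -> hmax] eA.
have E_eq : E = if k then E1set N m else E0set N m.
  rewrite -(legK k E) eA; case: (k) => /=; apply/setP=> i; rewrite !inE /legsize; lia.
rewrite E_eq /nu; case: (k) hE E_eq eA => hE E_eq eA.
  rewrite (T_E1 hT).
  have -> : \sum_(j : 'I_N | (m <= j.+1)%N) phi R (j |: E1set N m)
      = \sum_(j in ~: E1set N m) (1 : R) *: phi R (j |: E1set N m).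
    by apply: eq_big => [j|j _]; rewrite ?scale1r // !inE; lia.
  rewrite form_phi_signs.
  - by have := hE; rewrite EE_leg // /leg /legsize E_eq => /andP[/eqP -> _]; congr _%:R; lia.
  - move=> x y; rewrite !inE => hx hy /setP/(_ x); rewrite !inE eqxx /= => /esym/orP[/eqP //|].
    by rewrite (negbTE hx).
  - move=> j; rewrite inE => hj; rewrite cardsU1 hj; have := cardsC (E1set N m).
    have := hE; rewrite EE_leg // /leg /legsize E_eq card_ord => /andP[/eqP -> _]; lia.
  - by move=> j _; rewrite expr1n.
rewrite (T_E0 hT) form_phi_signs.
- by have := hE; rewrite EE_leg // /leg /legsize E_eq => /andP[/eqP -> _]; rewrite addn1.
- move=> x y hx hy /setP/(_ x); rewrite !inE eqxx /= => /esym; move: hx; rewrite inE => ->.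
  by rewrite andbT => /negbFE/eqP.
- move=> j hj; have := hE; rewrite EE_leg // /leg /legsize E_eq => /andP[].
  by rewrite (cardsD1 j) hj => /eqP [].
- by move=> j _; rewrite -exprM mulnC exprM sqrrN !expr1n.
Qed.

(** Induction on the inversions of the leg: creating one by an adjacent exchange
    multiplies both sides by [(1 + 1 / delta) * (1 - 1 / delta)]. *)
Lemma T_norm k E : E \in EE N m k ->
  B (T E) (T E) = (nu N m k)%:R * (Cprod R k 0 E * Cprod R k 1 E).
Proof.
have [d] := ubnP (inversions (leg k E)); elim: d => // d IHd in E *; rewrite ltnS => hd hE.
have [[i [j [ij /andP[iA jA]]]]|noex] :=
  adjacentP (fun i j => (i \in leg k E) && (j \notin leg k E)); last first.
  have up i j : j = i.+1 :> nat -> i \in leg k E -> j \in leg k E.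
    by move=> ij iA; have := noex i j ij; rewrite iA negbK.
  have none (p : 'I_N * 'I_N) :
      [&& (p.1 < p.2)%N, p.1 \in leg k E & p.2 \notin leg k E] = false.
    apply/negbTE/and3P=> -[lt xA]; rewrite (leg_top up) inE -leqNgt.
    by move: xA; rewrite {1}(leg_top up) inE; lia.
  by rewrite (T_norm_base hE up) !(Cprod_leg R hm _ hE) !(big_pred0 _ _ _ _ none) !mulr1.
pose s := tperm i j; pose E' := s @: E.
have eE : E = s @: E' by rewrite tperm_imsetK.
have jmax : j != ord_max by apply: contraNneq jA => ->; apply: leg_corner hE.
have hE' : E' \in EE N m k := EE_tperm hm hE ij jmax.
have iA' : i \notin leg k E' by rewrite leg_imset tperm_mem tpermL.
have jA' : j \in leg k E' by rewrite leg_imset tperm_mem tpermR.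
have := T_step_leg hE' ij jmax iA' jA'; rewrite -/s -eE => ->.
rewrite (T_reflection_norm hE' ij) IHd //; last first.
  by apply: leq_trans hd; rewrite leg_imset inversions_step.
(* The new pair is [(j, i)], whose contents differ by [- delta]. *)
rewrite eE !(Cprod_step _ hm hE' ij jmax iA' jA') /Cfactor /= expr0 expr1.
have -> : (content k j E' - content k i E')%:~R = - (content k i E' - content k j E')%:~R :> R.
  by rewrite -intrN opprB.
rewrite !invrN mulrN mulN1r opprK mul1r; ring.
Qed.

End TFamily.

(** * Linear spans, and a weight that refines the order of the exponents *)

Lemma linear_fun0 (R : realFieldType) (V W : lmodType R) (L : V -> W) : linear L -> L 0 = 0.
Proof. by move=> /(_ (-1) 0 0); rewrite scaler0 addr0 scaleN1r addNr. Qed.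

Lemma linear_funZ (R : realFieldType) (V W : lmodType R) (L : V -> W) : linear L ->
  forall c f, L (c *: f) = c *: L f.
Proof. by move=> Llin c f; rewrite -[c *: f]addr0 Llin (linear_fun0 Llin) addr0. Qed.

Section LinearSpan.
Context (R : realFieldType) (V : lmodType R).
Implicit Types (S : V -> Prop) (f g : V) (c : R).

(** The span is a predicate because the spaces of superpolynomials have infinite
    dimension. *)
Inductive lspan S : V -> Prop :=
| lspan0 : lspan S 0
| lspanS c g f : S g -> lspan S f -> lspan S (c *: g + f).

Lemma lspan_mem S f : S f -> lspan S f.
Proof. by move=> hf; rewrite -[f]addr0 -[f]scale1r; apply: lspanS => //; apply: lspan0. Qed.

Lemma lspanD S f g : lspan S f -> lspan S g -> lspan S (f + g).
Proof.
move=> hf hg; elim: hf => [|c h f' Sh _ IH]; first by rewrite add0r.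
by rewrite -addrA; apply: lspanS.
Qed.

Lemma lspanZ S c f : lspan S f -> lspan S (c *: f).
Proof.
elim=> [|d g h Sg _ IH]; first by rewrite scaler0; apply: lspan0.
by rewrite scalerDr scalerA; apply: lspanS.
Qed.

Lemma lspanB S f g : lspan S f -> lspan S g -> lspan S (f - g).
Proof. by move=> hf hg; rewrite -scaleN1r; apply/lspanD/lspanZ. Qed.

Lemma lspan_sum S (I : Type) (r : seq I) (P : pred I) (G : I -> V) :
  (forall x, P x -> lspan S (G x)) -> lspan S (\sum_(x <- r | P x) G x).
Proof.
by move=> h; apply: (big_ind (lspan S)) => //; [apply: lspan0 | move=> *; apply: lspanD].
Qed.

Lemma lspan_map S (S' : V -> Prop) (L : V -> V) : linear L ->
  (forall g, S g -> lspan S' (L g)) -> forall f, lspan S f -> lspan S' (L f).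
Proof.
move=> Llin hL f; elim=> [|c g h Sg _ IH].
  by rewrite (linear_fun0 Llin); apply: lspan0.
by rewrite Llin; apply: lspanD => //; apply/lspanZ/hL.
Qed.

Lemma lspan_sub S (S' : V -> Prop) f : (forall g, S g -> lspan S' g) -> lspan S f -> lspan S' f.
Proof. by move=> h; apply: (@lspan_map S S' id) => // c g g'. Qed.
End LinearSpan.

Lemma lspan_ker (R : realFieldType) (V W : lmodType R) (S : V -> Prop) (L : V -> W) :
  linear L -> (forall g, S g -> L g = 0) -> forall f, lspan S f -> L f = 0.
Proof.
move=> Llin hL f; elim=> [|c g h Sg _ IH].
  exact: linear_fun0.
by rewrite Llin hL // scaler0 add0r.
Qed.

Section Weights.
Context (N : nat).
Implicit Types (alpha beta : 'X_{1..N}) (i j : 'I_N).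

(** The sum of all partial sums, which increases strictly along [prec]. *)
Definition psums alpha : nat := \sum_(i < N) \sum_(j < N | (j <= i)%N) alpha j.

Lemma prec_psums alpha beta : prec alpha beta -> (psums alpha < psums beta)%N.
Proof.
case/andP=> ne /forallP le; rewrite ltn_neqAle leq_sum ?andbT; last by move=> i _; apply: le.
apply: contraNneq ne => e.
have := @leqif_sum _ predT
  (fun i : 'I_N => \sum_(j < N | (j <= i)%N) alpha j == \sum_(j < N | (j <= i)%N) beta j)%N
  (fun i : 'I_N => \sum_(j < N | (j <= i)%N) alpha j)%N
  (fun i : 'I_N => \sum_(j < N | (j <= i)%N) beta j)%N.
case=> [i _|_]; first exact/leqif_eq/le.
rewrite -/(psums alpha) -/(psums beta) e eqxx => /esym/forallP eqs.
apply/eqP/mnmP=> i.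
have step gamma : (\sum_(j < N | (j <= i)%N) gamma j
    = gamma i + \sum_(j < N | (j < i)%N) gamma j)%N.
  by move=> *; rewrite (bigD1 i) //=; congr (_ + _)%N; apply: eq_bigl => j; rewrite -val_eqE /=; lia.
have below : (\sum_(j < N | (j < i)%N) alpha j = \sum_(j < N | (j < i)%N) beta j)%N.
  have [i0|i0] := posnP i; first by rewrite !big_pred0 // => j; rewrite i0.
  have lt : (i.-1 < N)%N by rewrite (leq_ltn_trans (leq_pred _)).
  have := eqs (Ordinal lt) => /= /eqP.
  by congr (_ = _); apply: eq_bigl => j; rewrite -ltnS prednK.
by have := eqs i => /= /eqP; rewrite !step below => /addIn.
Qed.

Lemma psums_le alpha : (psums alpha <= N * mdeg alpha)%N.
Proof.
rewrite /psums -[X in (_ <= X * _)%N]card_ord -sum_nat_const; apply: leq_sum => i _.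
by rewrite mdegE [X in (_ <= X)%N](bigID (fun j : 'I_N => (j <= i)%N)) /= leq_addr.
Qed.

(** A number that increases strictly along [lhd]. In a fixed degree, [psums_le] bounds
    the second summand by less than one unit of the first: the order is lexicographic. *)
Definition lhd_weight alpha : nat := psums (aplus alpha) * (N * mdeg alpha).+1 + psums alpha.

Lemma lhd_weight_lt alpha beta : lhd alpha beta -> (lhd_weight alpha < lhd_weight beta)%N.
Proof.
case/andP=> /eqP ed /orP[/prec_psums lt|/andP[/eqP ea /prec_psums lt]]; rewrite /lhd_weight ed; last first.
  by rewrite ea ltn_add2l.
have := psums_le alpha; rewrite ed; move: (N * mdeg beta)%N => M; nia.
Qed.

Definition mperm alpha (s : 'S_N) : 'X_{1..N} := [multinom alpha (s i) | i < N].

Lemma mdeg_perm alpha (s : 'S_N) : mdeg (mperm alpha s) = mdeg alpha.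
Proof. exact: mdeg_mperm. Qed.

Lemma aplus_perm alpha (s : 'S_N) : aplus (mperm alpha s) = aplus alpha.
Proof.
apply/mnmP=> i; rewrite !mnmE; congr nth.
apply/perm_sortP.
- by move=> x y; apply: leq_total.
- by move=> x y z /= h1 h2; apply: leq_trans h2 h1.
- by move=> x y /= h; apply/eqP; rewrite eqn_leq andbC.
by apply/tuple_permP; exists s; congr (tval _); apply: eq_from_tnth => j; rewrite !tnth_mktuple.
Qed.

Lemma psums_swap alpha i j : j = i.+1 :> nat -> (alpha i < alpha j)%N ->
  (psums alpha < psums (mperm alpha (tperm i j)))%N.
Proof.
move=> ij lt; apply: prec_psums; apply/andP; split.
  by apply/eqP=> /mnmP/(_ i); rewrite mnmE tpermL => e; rewrite e ltnn in lt.
apply/forallP=> x.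
have nij : i != j by rewrite -val_eqE /= ij; lia.
have [xi|xi] := leqP i x; last first.
  rewrite leq_eqVlt; apply/orP; left; apply/eqP; apply: eq_bigr => y yx.
  by rewrite mnmE tpermD // -val_eqE /= ?ij; lia.
have [xj|xj] := leqP j x.
  rewrite leq_eqVlt; apply/orP; left; apply/eqP.
  rewrite [RHS](reindex_inj (@perm_inj _ (tperm i j))) /=.
  apply: eq_big => [y|y _]; last by rewrite mnmE tpermK.
  by case: tpermP => // ->; rewrite ?xi ?xj; lia.
rewrite (bigD1 i) //= [X in (_ <= X)%N](bigD1 i) //= mnmE tpermL.
apply: leq_add; first exact: ltnW.
apply: leq_sum => y /andP[yx yi]; rewrite mnmE tpermD //; first by rewrite eq_sym.
by rewrite -val_eqE /=; lia.
Qed.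

Lemma lhd_weight_swap alpha i j : j = i.+1 :> nat -> (alpha i < alpha j)%N ->
  (lhd_weight alpha < lhd_weight (mperm alpha (tperm i j)))%N.
Proof. by move=> ij lt; rewrite /lhd_weight mdeg_perm aplus_perm ltn_add2l psums_swap. Qed.
End Weights.

(** * Rank permutations and spectra *)

Section Rank.
Context (n : nat).
Local Notation N := n.+1.
Implicit Types (alpha beta : 'X_{1..N}) (i j x y : 'I_N).

Lemma rperm_val alpha x : rperm alpha x
  = #|[set y : 'I_N | (alpha x < alpha y)%N || (y < x)%N && (alpha y == alpha x)]| :> nat.
Proof. by rewrite permE /= rnkE. Qed.

(** Exchanging two adjacent unequal entries does not affect the order of equal entries. *)
Lemma rperm_swap alpha i j : j = i.+1 :> nat -> alpha i != alpha j ->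
  rperm (mperm alpha (tperm i j)) = (tperm i j * rperm alpha)%g.
Proof.
move=> ij ne; apply/permP=> x; apply: val_inj; rewrite permM /= !rperm_val.
rewrite -(card_imset _ (@perm_inj _ (tperm i j))); apply: eq_card => y.
rewrite -{1}(tpermK i j y) (mem_imset _ _ (@perm_inj _ _)) !inE !mnmE tpermK.
congr (_ || _); case: (eqVneq (alpha y) _) => [e|_]; rewrite ?andbF // !andbT.
apply/idP/idP => h.
  rewrite -[y](tpermK i j); apply: tperm_adj_lt => //; rewrite -negb_and.
  apply: contraNN ne => /andP[/eqP ey /eqP ex]; rewrite -[y](tpermK i j) ey ex tpermL tpermR in e.
  by rewrite e.
rewrite -[x](tpermK i j); apply: tperm_adj_lt => //; rewrite -negb_and.
by apply: contraNN ne => /andP[/eqP ey /eqP ex]; rewrite ey ex in e; rewrite e.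
Qed.

(** The leading exponent of [affine f] when that of [f] is [alpha]: the first entry
    moves to the end and grows by one. *)
Definition affine_mon alpha : 'X_{1..N} := (mperm alpha (cyc n)^-1%g + U_(ord_max))%MM.

Lemma affine_mon_cyc alpha x : affine_mon alpha (cyc n x) = (alpha x + (x == ord0))%N.
Proof.
rewrite /affine_mon mnmDE mnmE permK mnmE; congr (_ + nat_of_bool _)%N.
by rewrite -(cyc0 n) (inj_eq perm_inj) eq_sym.
Qed.

Lemma cyc_lt x y : x != ord0 -> y != ord0 -> (cyc n x < cyc n y)%N = (x < y)%N.
Proof.
case: (unliftP ord0 x) => [x' ->|->] //; case: (unliftP ord0 y) => [y' ->|->] // _ _.
rewrite (@cycS n (widen_ord (leqnSn n) x')) ?lift0 //.
by rewrite (@cycS n (widen_ord (leqnSn n) y')) ?lift0.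
Qed.

(** The entry [alpha_1 + 1] in last place is outranked by the entries [>= alpha_1 + 1],
    ties included; these are the entries that outrank [alpha_1] in first place. *)
Lemma rperm_affine alpha : rperm (affine_mon alpha) = ((cyc n)^-1 * rperm alpha)%g.
Proof.
apply/permP=> x; rewrite -[x](permKV (cyc n)); set y := ((cyc n)^-1)%g x.
rewrite permM permK; apply: val_inj => /=; rewrite !rperm_val.
rewrite -[RHS](card_imset _ (@perm_inj _ (cyc n))); apply: eq_card => z'.
rewrite -[z'](permKV (cyc n)); set z := ((cyc n)^-1)%g z'.
rewrite (mem_imset _ _ (@perm_inj _ _)) !inE !affine_mon_cyc.
have [->|y0] := eqVneq y ord0; have [->|z0] := eqVneq z ord0.
- by rewrite !ltnn.
- have -> : (cyc n z < cyc n ord0)%N.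
    rewrite cyc0; case: (unliftP ord0 z) z0 => [z1 ->|->] // _.
    by rewrite (@cycS n (widen_ord (leqnSn n) z1)) ?lift0 //=.
  by rewrite /= addn0 orbF; lia.
- have -> : (cyc n ord0 < cyc n y)%N = false.
    by rewrite cyc0 ltnNge -ltnS ltn_ord.
  have y1 : (ord0 < y)%N by move: y0; rewrite -(inj_eq val_inj) /= -lt0n.
  by rewrite y1 /= addn0; lia.
- by rewrite cyc_lt // !addn0.
Qed.

Lemma mdeg_affine_mon alpha : mdeg (affine_mon alpha) = (mdeg alpha).+1.
Proof. by rewrite mdegD mdeg_perm mdeg1 addn1. Qed.
End Rank.

Section Spectrum.
Context (R : realFieldType) (n m : nat) (hm : (1 <= m <= n)%N) (kappa : R).
Local Notation N := n.+1.
Hypothesis hkappa : generic N kappa.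
Implicit Types (E F : {set 'I_N}) (i j x y : 'I_N) (alpha beta : 'X_{1..N}).

(** If [d] is nonzero, a zero gives [kappa = - a / d] with [1 <= |d| <= N], which
    genericity excludes. *)
Lemma generic_neq (a d : int) : (a != 0) || (d != 0) -> `|d| <= N%:Z ->
  a%:~R + kappa * d%:~R != 0 :> R.
Proof.
clear hm; move=> nz hd; have [d0|d0] := eqVneq d 0.
  by move: nz; rewrite d0 eqxx orbF mulr0 addr0 intr_eq0.
have dR : (d%:~R : R) != 0 by rewrite intr_eq0.
apply/eqP=> e; have ek : kappa = - a%:~R / d%:~R.
  by apply: (mulIf dR); rewrite mulfVK //; apply/eqP; rewrite -addr_eq0 addrC e.
have hb : (1 <= `|d|%N <= N)%N by lia.
have [dpos|dneg] := ltrP 0 d.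
  apply: (hkappa (a := - a) hb); rewrite ek rmorphN; congr (_ / _).
  by rewrite -[in LHS](gtz0_abs dpos) pmulrn.
apply: (hkappa (a := a) hb); rewrite ek mulNr -mulrN -invrN; congr (_ / _).
by rewrite pmulrn -rmorphN; congr (_%:~R); lia.
Qed.

Lemma kappa_neq0 : kappa != 0.
Proof. by have := @generic_neq 0 1 isT isT; rewrite add0r mulr1. Qed.

(** All these hooks have the same shape, whose contents are N consecutive integers. *)
Lemma content_bound k E F i j : E \in EE N m k -> F \in EE N m k ->
  `|content k i E - content k j F| <= n%:Z.
Proof.
rewrite !EE_leg // => /andP[/eqP cE _] /andP[/eqP cF _].
have := hook_content_bound (leg k E) i; have := hook_content_bound (leg k F) j; rewrite cE cF.
have -> : legsize n m k == 0%N = false by rewrite /legsize; case: (k).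
by rewrite !content_leg; case: (k) => /=; rewrite ?expr1 ?expr0; lia.
Qed.

(** The sign of its content tells whether a label belongs to the leg. *)
Lemma content_set_inj k E F : (forall x, content k x E = content k x F) -> E = F.
Proof.
move=> e; rewrite -(legK k E) -(legK k F); congr leg; apply/setP=> x.
have {e} : hook_content (leg k E) x = hook_content (leg k F) x.
  by have := e x; rewrite !content_leg; case: (k); rewrite ?expr1 ?expr0 ?mul1r ?mulN1r // => /oppr_inj.
case: (boolP (x \in leg k E)) => xE; case: (boolP (x \in leg k F)) => xF // e.
  by have := hook_content_le0 xE; have := hook_content_ge1 xF; lia.
by have := hook_content_le0 xF; have := hook_content_ge1 xE; lia.
Qed.

Definition ranked_content k alpha E i : int := content k (rperm alpha i) E.
(** The eigenvalue of [U_i] on [J_(alpha,E)]. *)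
Definition spectrum k alpha E i : R := (alpha i + 1)%:R + kappa * (ranked_content k alpha E i)%:~R.

Lemma spectrum_sub k alpha beta E F i j :
  spectrum k alpha E i - spectrum k beta F j
    = ((alpha i)%:Z - (beta j)%:Z)%:~R
      + kappa * (ranked_content k alpha E i - ranked_content k beta F j)%:~R.
Proof. by rewrite /spectrum !natrD !intrB -!pmulrn; ring. Qed.

(** Genericity separates the integer part of an eigenvalue from the multiple of [kappa]. *)
Lemma spectrum_eq k alpha beta E F i j : E \in EE N m k -> F \in EE N m k ->
  spectrum k alpha E i = spectrum k beta F j ->
  alpha i = beta j /\ ranked_content k alpha E i = ranked_content k beta F j.
Proof.
move=> hE hF /eqP; rewrite -subr_eq0 spectrum_sub.
have hb := content_bound (rperm alpha i) (rperm beta j) hE hF.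
set a := (_ - _ : int); set d := (_ - _ : int) => e.
have : ~~ ((a != 0) || (d != 0)).
  by apply: contraTN e => nz; apply: generic_neq => //; rewrite /d /ranked_content; lia.
by rewrite negb_or !negbK /a /d => /andP[/eqP h1 /eqP h2]; split; lia.
Qed.

Lemma spectrum_inj k alpha beta E F : E \in EE N m k -> F \in EE N m k ->
  (forall i, spectrum k alpha E i = spectrum k beta F i) -> alpha = beta /\ E = F.
Proof.
move=> hE hF e; have ea : alpha = beta by apply/mnmP=> i; have [] := spectrum_eq hE hF (e i).
split=> //; apply: (@content_set_inj k) => x.
have [_] := spectrum_eq hE hF (e ((rperm alpha)^-1%g x)).
by rewrite /ranked_content -ea permKV.
Qed.

Lemma spectrum_separates k alpha beta E F : E \in EE N m k -> F \in EE N m k ->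
  (alpha, E) != (beta, F) -> exists i, spectrum k alpha E i != spectrum k beta F i.
Proof.
move=> hE hF ne; apply/existsP; apply: contraNT ne; rewrite negb_exists => /forallP h.
have [-> ->] : alpha = beta /\ E = F; last by rewrite eqxx.
by apply: (spectrum_inj hE hF) => i; apply/eqP/negPn/h.
Qed.

Lemma spectrum_diff_neq0 k alpha E i j : E \in EE N m k -> i != j ->
  spectrum k alpha E i - spectrum k alpha E j != 0.
Proof.
move=> hE ne; rewrite subr_eq0; apply: contraNneq ne => e.
have [_ /content_inj /perm_inj -> //] := spectrum_eq hE hE e.
Qed.

Lemma spectrum_swap k alpha E i j x : j = i.+1 :> nat -> alpha i != alpha j ->
  spectrum k (mperm alpha (tperm i j)) E x = spectrum k alpha E (tperm i j x).
Proof. by move=> ij ne; rewrite /spectrum /ranked_content rperm_swap // permM mnmE. Qed.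

Lemma spectrum_affine k alpha E x :
  spectrum k (affine_mon alpha) E (cyc n x) = spectrum k alpha E x + (x == ord0)%:R.
Proof.
rewrite /spectrum /ranked_content rperm_affine permM permK affine_mon_cyc addnAC natrD.
by rewrite addrAC.
Qed.
End Spectrum.

(** * Uniqueness and recursions for the nonsymmetric Jack polynomials *)

Section Jack.
Context (R : realFieldType) (n m : nat) (hm : (1 <= m <= n)%N) (kappa : R).
Local Notation N := n.+1.
Local Notation V := (superpoly R N).
Hypothesis hkappa : generic N kappa.
Context (B : V -> V -> R) (hB : is_form kappa m B).
Context (T : {set 'I_N} -> V) (hT : is_Tfamily m T).
Context (J : 'X_{1..N} -> {set 'I_N} -> V).
Hypothesis hJ : forall k alpha F, F \in EE N m k -> is_Jack kappa m T k alpha F (J alpha F).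
Implicit Types (E F G : {set 'I_N}) (i j x y : 'I_N) (alpha beta : 'X_{1..N}) (f g v : V) (w : 'S_N).

(** Away from the corner, the contents of a label of the leg and of one of the arm
    differ by at least 2. *)
Lemma Cfactor_neq0 k z E p : E \in EE N m k -> p.1 \in leg k E -> p.2 \notin leg k E ->
  p.1 != ord_max -> Cfactor R k z E p != 0.
Proof.
move=> hE h1 h2 hne; rewrite /Cfactor.
have := hook_content_lt0 (leg_corner hm hE) h1 hne; have := hook_content_ge1 h2.
move=> g1 g2; have : 2%:Z <= `|content k p.1 E - content k p.2 E|.
  by rewrite !content_leg; case: (k) g1 g2 => /=; rewrite ?expr1 ?expr0; lia.
set d := (_ - _) => hd; have dn0 : (d%:~R : R) != 0 by rewrite intr_eq0; lia.
rewrite -signr_odd; case: (odd z); rewrite ?expr1 ?expr0.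
  rewrite -(inj_eq (mulIf dn0)) mul0r mulrDl mul1r (mulfVK dn0) -(rmorphN1 intr).
  by rewrite -intrD intr_eq0; lia.
rewrite -(inj_eq (mulIf dn0)) mul0r mulrDl !mul1r (mulVf dn0).
by rewrite -[1](mulr1z 1) -intrD intr_eq0; lia.
Qed.

Lemma Cprod_neq0 k z E : E \in EE N m k -> Cprod R k z E != 0.
Proof.
move=> hE; rewrite (Cprod_leg R hm _ hE); apply/prodf_neq0 => p /and3P[lt h1 h2].
apply: Cfactor_neq0 => //; apply: contraTneq lt => ->.
by rewrite -leqNgt -ltnS ltn_ord.
Qed.

Lemma nu_neq0 k : (nu N m k)%:R != 0 :> R.
Proof. by rewrite pnatr_eq0 /nu; case: k; rewrite addn1. Qed.

Lemma T_neq0 k E : E \in EE N m k -> T E <> 0.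
Proof.
move=> hE e; have := T_norm hm hB hT hE; rewrite e (bform0l hB); last exact: in_sP0.
move/esym/eqP; apply/negP; rewrite !mulf_neq0 ?nu_neq0 ?Cprod_neq0 //.
Qed.

Definition T_span k : V -> Prop := lspan (fun f => exists2 E, E \in EE N m k & f = T E).

Lemma T_span_T k E : E \in EE N m k -> T_span k (T E).
Proof. by move=> hE; apply: lspan_mem; exists E. Qed.

(** If [j] is the last label, then [s_i] is a Jucys-Murphy element; if both labels
    lie in one line, then [s_i] acts by a sign; otherwise [s_i] preserves the plane spanned
    by [T E] and [T (s_i E)]. *)
Lemma T_span_simple k E i j : E \in EE N m k -> j = i.+1 :> nat ->
  T_span k (sact (tperm i j) (T E)).
Proof.
move=> hE ij; have [jmax|jmax] := eqVneq j ord_max.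
  have := JM_T hT i hE; rewrite /JM (big_pred1 j); last first.
    move=> l; rewrite /= -val_eqE /=; have := ltn_ord l; have := ltn_ord i.
    by move: ij; rewrite jmax /=; lia.
  by move=> ->; apply/lspanZ/T_span_T.
have [e|ne] := eqVneq (i \in leg k E) (j \in leg k E).
  by rewrite (T_reflection_scalar hB hT hE ij) ?(adj_same_leg hE) //; apply/lspanZ/T_span_T.
have hE' := EE_tperm hm hE ij jmax.
case: (boolP (j \in leg k E)) ne => jA ne.
  have iA : i \notin leg k E by move: ne; case: (i \in _).
  have := T_step_leg hT hE ij jmax iA jA => /eqP; rewrite -subr_eq opprK => /eqP <-.
  by apply: lspanD; [apply: T_span_T | apply/lspanZ/T_span_T].
have iA : i \in leg k E by move: ne; case: (i \in _).
have iA' : i \notin leg k (tperm i j @: E) by rewrite leg_imset tperm_mem tpermL.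
have jA' : j \in leg k (tperm i j @: E) by rewrite leg_imset tperm_mem tpermR.
have := T_step_leg hT hE' ij jmax iA' jA'; rewrite tperm_imsetK; set d := (_)^-1 => e.
have e' : sact (tperm i j) (T (tperm i j @: E)) = T E + d *: T (tperm i j @: E).
  by rewrite e subrK.
rewrite e sactB sactZ tpermS_sact; apply: lspanB; first exact: T_span_T.
by apply: lspanZ; rewrite e'; apply: lspanD; [apply: T_span_T | apply/lspanZ/T_span_T].
Qed.

Lemma T_span_sact k w v : T_span k v -> T_span k (sact w v).
Proof.
move: w v; apply: perm_simple_ind => [v|w i j ij IH v hv]; first by rewrite sact1.
rewrite sactM; apply: IH; move: hv; apply: lspan_map.
  by move=> c f g; rewrite sactD sactZ.
by move=> g [E hE ->]; apply: T_span_simple.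
Qed.

Definition monomial_span k (d : nat) : V -> Prop :=
  lspan (fun f => exists beta E, [/\ mdeg beta = d, E \in EE N m k & f = xmul 'X_[beta] (T E)]).

Lemma monomial_span_xmul k d beta v : mdeg beta = d -> T_span k v ->
  monomial_span k d (xmul 'X_[beta] v).
Proof.
move=> hd; apply: lspan_map; first by move=> c f g; rewrite xmulDr xmulZr.
by move=> g [E hE ->]; apply: lspan_mem; exists beta, E.
Qed.

Lemma sact_monomial w beta v :
  sact w (xmul 'X_[beta] v) = xmul 'X_[mperm beta w^-1%g] (sact w v).
Proof. by rewrite sact_xmul msymX. Qed.

Lemma affine_monomial beta v :
  affine (xmul 'X_[beta] v) = xmul 'X_[affine_mon beta] (sact (cyc n) v).
Proof. by rewrite /affine sact_monomial xmulA -mpolyXD addmC. Qed.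

Lemma monomial_span_sact k d w f : monomial_span k d f -> monomial_span k d (sact w f).
Proof.
apply: lspan_map; first by move=> c f' g; rewrite sactD sactZ.
move=> g [beta [E [hd hE ->]]]; rewrite sact_monomial; apply: monomial_span_xmul; first by rewrite mdeg_perm.
exact/T_span_sact/T_span_T.
Qed.

Lemma monomial_span_affine k d f : monomial_span k d f -> monomial_span k d.+1 (affine f).
Proof.
apply: lspan_map; first exact: affine_is_linear.
move=> g [beta [E [hd hE ->]]]; rewrite affine_monomial; apply: monomial_span_xmul.
  by rewrite mdeg_affine_mon hd.
exact/T_span_sact/T_span_T.
Qed.

Lemma monomial_span_sP k d f : monomial_span k d f -> in_sP m f.
Proof.
elim=> [|c g h [beta [E [_ hE ->]]] _ IH]; first exact: in_sP0.
by apply: in_sPD => //; apply/in_sPZ/in_sP_xmul/(T_in_sP hT hE).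
Qed.

(** The terms below the leading one, compared by weight: unlike the partial order [lhd],
    the weight directly supports the inductions. *)
Definition lower_span k alpha : V -> Prop := lspan (fun f => exists beta E,
  [/\ mdeg beta = mdeg alpha, (lhd_weight beta < lhd_weight alpha)%N, E \in EE N m k
    & f = xmul 'X_[beta] (T E)]).

Lemma Jack_lead k alpha E : E \in EE N m k ->
  lower_span k alpha (J alpha E - xmul 'X_[alpha] (sact (rperm alpha)^-1%g (T E))).
Proof.
move=> hE; have [[a ->] _] := hJ alpha hE; rewrite [X in X - _]addrC addrK.
apply: lspan_sum => beta lt; rewrite xmul_sumr; apply: lspan_sum => F hF.
rewrite xmulZr; apply/lspanZ/lspan_mem; exists beta, F; split=> //; last exact: lhd_weight_lt.
by case/andP: lt => /eqP.
Qed.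

Lemma Jack_mono k alpha E : E \in EE N m k -> monomial_span k (mdeg alpha) (J alpha E).
Proof.
move=> hE; rewrite -[J alpha E](subrK (xmul 'X_[alpha] (sact (rperm alpha)^-1%g (T E)))).
apply: lspanD; last exact/monomial_span_xmul/T_span_sact/T_span_T.
apply: lspan_sub (Jack_lead alpha hE) => g [beta [F [hd _ hF ->]]].
by apply: lspan_mem; exists beta, F.
Qed.

Lemma Jack_in_sP k alpha E : E \in EE N m k -> in_sP m (J alpha E).
Proof. by move=> hE; apply: monomial_span_sP (Jack_mono alpha hE). Qed.

Lemma Jack_eigen k alpha E i : E \in EE N m k ->
  cherednik kappa i (J alpha E) = spectrum kappa k alpha E i *: J alpha E.
Proof. by move=> hE; have [_ ->] := hJ alpha hE. Qed.

Definition Jack_span k (d : nat) : V -> Prop :=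
  lspan (fun f => exists beta E, [/\ mdeg beta = d, E \in EE N m k & f = J beta E]).

(** Unitriangularity: solve for the leading term, by induction on its weight. *)
Lemma monomial_span_Jack k d f : monomial_span k d f -> Jack_span k d f.
Proof.
apply: lspan_sub => g [beta [E [hd hE ->]]].
suff H W : (lhd_weight beta < W)%N -> forall v, T_span k v -> Jack_span k d (xmul 'X_[beta] v).
  by apply: (H _ (ltnSn _)); apply: T_span_T.
elim: W => // W IHW in beta hd *; rewrite ltnS => hW v hv.
rewrite -(sactVK (rperm beta) v).
have {hv} : T_span k (sact (rperm beta) v) by apply: T_span_sact.
move: (sact _ _) => u.
apply: (lspan_map (L := fun u => xmul 'X_[beta] (sact (rperm beta)^-1%g u))).
  by move=> c f1 g1; rewrite sactD sactZ xmulDr xmulZr.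
move=> g1 [F hF ->]; have := Jack_lead beta hF; set low := _ - _ => hlow.
have -> : xmul 'X_[beta] (sact (rperm beta)^-1%g (T F)) = J beta F - low.
  by rewrite /low opprB addrC subrK.
apply: lspanB; first by apply: lspan_mem; exists beta, F.
apply: lspan_sub hlow => g2 [gam [F' [hd' lt hF' ->]]].
by apply: IHW; [rewrite hd' | apply: leq_trans lt hW | apply: T_span_T].
Qed.

(** [L] is a Lagrange interpolation polynomial in the Cherednik operators. For every
    [J_(beta,F)] occurring in [g], other than [J_(alpha,E)], it has a factor
    [(U_i - zB) / (zA - zB)], where [U_i] separates the two eigenvalues [zA] and [zB]: this
    factor kills [J_(beta,F)] and fixes the joint eigenvectors with the spectrum of
    [J_(alpha,E)]. *)
Lemma Jack_projection k d alpha E g : E \in EE N m k -> Jack_span k d g ->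
  exists L : V -> V, [/\ linear L,
    (forall f, (forall i, cherednik kappa i f = spectrum kappa k alpha E i *: f) -> L f = f),
    (forall beta F, F \in EE N m k -> exists c, L (J beta F) = c *: J beta F)
    & exists c, L g = c *: J alpha E].
Proof.
move=> hE; elim=> [|c _ g' [beta [F [hd hF ->]]] _ [L [Llin Lid LJ [c0 e0]]]].
  exists id; split=> //; first by move=> beta F _; exists 1; rewrite scale1r.
  by exists 0; rewrite scale0r.
have [[eb eF]|ne] := eqVneq (beta, F) (alpha, E).
  exists L; split=> //; exists (c + c0); rewrite Llin eb eF Lid ?e0 ?scalerDl //.
  by move=> i; apply: Jack_eigen.
have [i hi] := spectrum_separates hm hkappa hF hE ne.
pose zA := spectrum kappa k alpha E i; pose zB := spectrum kappa k beta F i.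
pose P f := (zA - zB)^-1 *: (cherednik kappa i f - zB *: f).
have dn0 : zA - zB != 0 by rewrite subr_eq0 eq_sym.
have Plin : linear P.
  move=> a f1 f2; rewrite /P (linearP (cherednik kappa i)) /=.
  rewrite [a *: (_ *: _)]scalerA [a * _]mulrC -scalerA -scalerDr; congr (_ *: _).
  by rewrite [zB *: (_ + _)]scalerDr opprD addrACA [in RHS]scalerBr !scalerA [zB * a]mulrC.
have PJ b F' : F' \in EE N m k ->
    P (J b F') = ((zA - zB)^-1 * (spectrum kappa k b F' i - zB)) *: J b F'.
  by move=> hF'; rewrite /P (Jack_eigen b i hF') -scalerBl scalerA.
have PA : P (J alpha E) = J alpha E by rewrite PJ // mulVf // scale1r.
exists (fun f => P (L f)); split.
- by move=> a f1 f2 /=; rewrite Llin Plin.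
- by move=> f hf /=; rewrite Lid // /P hf -scalerBl scalerA mulVf // scale1r.
- move=> b F' hF' /=; have [c1 ->] := LJ b F' hF'.
  by rewrite (linear_funZ Plin) PJ // scalerA; eexists.
exists c0; rewrite /= Llin e0; have [c1 ->] := LJ beta F hF.
by rewrite scalerA Plin (linear_funZ Plin) PJ // subrr mulr0 scale0r scaler0 add0r PA.
Qed.

Lemma Jack_multiple k d alpha E f : E \in EE N m k -> monomial_span k d f ->
  (forall i, cherednik kappa i f = spectrum kappa k alpha E i *: f) ->
  exists c, f = c *: J alpha E.
Proof.
move=> hE /monomial_span_Jack hf ef; have [L [_ Lid _ [c e]]] := Jack_projection alpha hE hf.
by exists c; rewrite -e Lid.
Qed.

(** The target [R^o] makes this a linear map between modules. *)
Definition coef_at beta G f : R^o := (f G)@_beta.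

Lemma coef_at_is_linear beta G : linear (coef_at beta G).
Proof. by move=> c f g; rewrite /coef_at !ffunE mcoeffD mcoeffZ. Qed.

Lemma coef_at_xmul beta gam G v : in_P m v ->
  coef_at beta G (xmul 'X_[gam] v) = (gam == beta)%:R * coef_at 0%MM G v.
Proof.
move=> [_ /(_ G) [c e]]; rewrite /coef_at ffunE e mulrC mcoeffCM mcoeffX mulrC.
by rewrite mcoeffC eqxx mulr1.
Qed.

Lemma in_P_eq0 v : in_P m v -> (forall G, coef_at 0%MM G v = 0) -> v = 0.
Proof.
move=> [_ hv] h; apply/ffunP=> G; have := h G; rewrite /coef_at ffunE.
by have [c ->] := hv G; rewrite mcoeffC eqxx mulr1 => ->; rewrite mpolyC0.
Qed.

Lemma sact_T_in_P k E w : E \in EE N m k -> in_P m (sact w (T E)).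
Proof. by move=> hE; apply: sact_in_P; apply: (T_in_P hT hE). Qed.

Lemma coef_at_J k alpha E G : E \in EE N m k ->
  coef_at alpha G (J alpha E) = coef_at 0%MM G (sact (rperm alpha)^-1%g (T E)).
Proof.
move=> hE; rewrite -[J alpha E](subrK (xmul 'X_[alpha] (sact (rperm alpha)^-1%g (T E)))).
rewrite -[X in X + _]scale1r coef_at_is_linear (lspan_ker (@coef_at_is_linear alpha G) _ (Jack_lead alpha hE)).
  by rewrite scaler0 add0r coef_at_xmul ?eqxx ?mul1r //; apply: (sact_T_in_P _ hE).
move=> g [beta [F [_ lt hF ->]]]; rewrite coef_at_xmul; last exact: (T_in_P hT hF).
by case: eqP lt => [->|_ _]; rewrite ?ltnn // mul0r.
Qed.

(** The joint eigenspace is a line, so the coefficient of the leading monomial fixes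
    the normalisation. *)
Lemma Jack_unique k d alpha E f : E \in EE N m k -> monomial_span k d f ->
  (forall i, cherednik kappa i f = spectrum kappa k alpha E i *: f) ->
  (forall G, coef_at alpha G f = coef_at 0%MM G (sact (rperm alpha)^-1%g (T E))) ->
  f = J alpha E.
Proof.
move=> hE hf ef lead; have [c ec] := Jack_multiple hE hf ef.
suff e1 : c = 1 by rewrite ec e1 scale1r.
have [->//|c1] := eqVneq c 1; case: (T_neq0 hE).
apply: (can_inj (sactVK (rperm alpha)^-1%g)); rewrite [RHS]linear0.
apply: in_P_eq0 => [|G]; first exact: (sact_T_in_P _ hE).
have := lead G; rewrite ec -[c *: _]addr0 coef_at_is_linear (coef_at_J _ _ hE) => /eqP.
have -> : coef_at alpha G 0 = 0 by rewrite /coef_at ffunE mcoeff0.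
rewrite addr0 -subr_eq0 -[X in _ - X]scale1r -scalerBl scaler_eq0 subr_eq0 (negbTE c1).
by move/eqP.
Qed.

(** By the Hecke relations the right-hand side has the spectrum of the exchanged exponent,
    and among its terms only [s_i] applied to the leading term of [J alpha E] contributes to
    the new leading coefficient. *)
Lemma Jack_swap k alpha E i j : E \in EE N m k -> j = i.+1 :> nat -> (alpha i < alpha j)%N ->
  J (mperm alpha (tperm i j)) E
    = sact (tperm i j) (J alpha E)
      - (kappa / (spectrum kappa k alpha E i - spectrum kappa k alpha E j)) *: J alpha E.
Proof.
move=> hE ij lt; have nea : alpha i != alpha j by rewrite neq_ltn lt.
have nij : i != j by rewrite -val_eqE /= ij; lia.
set b := kappa / _; have bE : b * (spectrum kappa k alpha E i - spectrum kappa k alpha E j) = kappa.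
  by rewrite mulfVK // (spectrum_diff_neq0 hm hkappa).
apply/esym/(@Jack_unique k (mdeg alpha)) => //.
- by apply: lspanB; [apply: monomial_span_sact|apply: lspanZ]; apply: Jack_mono.
- move=> x; rewrite spectrum_swap // linearB linearZ /= (Jack_eigen _ _ hE) scalerBr !scalerA.
  have [->|xi] := eqVneq x i.
    rewrite tpermL (cherednik_simple_r _ ij) (Jack_eigen _ _ hE) sactZ -addrA; congr (_ + _).
    rewrite -scalerBl -scaleNr; congr (_ *: _); rewrite -[X in X - _]bE; ring.
  have [->|xj] := eqVneq x j.
    rewrite tpermR (cherednik_simple_l _ ij) (Jack_eigen _ _ hE) sactZ -addrA; congr (_ + _).
    rewrite -opprD -scalerDl; congr (- (_ *: _)); rewrite -[X in X + _]bE; ring.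
  have -> : tperm i j x = x by rewrite tpermD // eq_sym.
  rewrite (cherednik_simple_other kappa ij _ xi xj) (Jack_eigen _ _ hE) sactZ.
  by rewrite [b * _]mulrC.
move=> G; rewrite rperm_swap // invMg tpermV sactM.
have coefB (f g : V) a : coef_at a G (f - g) = coef_at a G f - coef_at a G g.
  by rewrite /coef_at !ffunE mcoeffB.
set lead := xmul 'X_[alpha] (sact (rperm alpha)^-1%g (T E)); set al' := mperm _ _.
have hlow := Jack_lead alpha hE; rewrite -/lead in hlow.
have al'ne : alpha == al' = false.
  by apply/eqP=> e; have := lhd_weight_swap ij lt; rewrite -/al' -e ltnn.
have -> : coef_at al' G (sact (tperm i j) (J alpha E) - b *: J alpha E)
   = coef_at al' G (sact (tperm i j) lead).
  rewrite coefB -[b *: _]addr0 coef_at_is_linear.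
  have -> : coef_at al' G (J alpha E) = 0.
    rewrite -[J alpha E](subrK lead) -[X in X + _]scale1r coef_at_is_linear.
    rewrite (lspan_ker (@coef_at_is_linear al' G) _ hlow).
      by rewrite scaler0 add0r coef_at_xmul ?al'ne ?mul0r //; apply: (sact_T_in_P _ hE).
    move=> g [beta [F [_ lt' hF ->]]]; rewrite coef_at_xmul; last exact: (T_in_P hT hF).
    case: eqP lt' => [->|_ _]; last by rewrite mul0r.
    by rewrite ltnNge ltnW // lhd_weight_swap.
  have -> : coef_at al' G 0 = 0 by rewrite /coef_at ffunE mcoeff0.
  rewrite scaler0 addr0 subr0 -[J alpha E](subrK lead) sactD -[X in X + _]scale1r coef_at_is_linear.
  have lin : linear (fun f => coef_at al' G (sact (tperm i j) f)).
    by move=> c f g; rewrite sactD sactZ coef_at_is_linear.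
  rewrite (lspan_ker lin _ hlow) ?scaler0 ?add0r // => g [beta [F [_ lt' hF ->]]].
  rewrite sact_monomial coef_at_xmul; last exact: (sact_T_in_P _ hF).
  rewrite tpermV; case: eqP => [/mnmP e|]; last by rewrite mul0r.
  have eb : beta = alpha by apply/mnmP=> x; have := e (tperm i j x); rewrite !mnmE tpermK.
  by rewrite eb ltnn in lt'.
rewrite sact_monomial tpermV coef_at_xmul ?eqxx ?mul1r //.
by apply: sact_in_P; apply: (sact_T_in_P _ hE).
Qed.

(** The raising operator changes the spectrum as in [spectrum_affine] and maps leading
    terms to leading terms. *)
Lemma Jack_affine k alpha E : E \in EE N m k -> J (affine_mon alpha) E = affine (J alpha E).
Proof.
move=> hE; apply/esym/(@Jack_unique k (mdeg alpha).+1) => //.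
- by apply: monomial_span_affine; apply: Jack_mono.
- move=> x; rewrite -[x](permKV (cyc n)); set y := ((cyc n)^-1)%g x.
  rewrite spectrum_affine; case: (unliftP ord0 y) => [y' ->|->].
    rewrite (@cycS n (widen_ord (leqnSn n) y')) ?lift0 //.
    rewrite (@cherednik_affine _ _ _ _ (lift ord0 y')) ?lift0 // (Jack_eigen _ _ hE).
    by rewrite addr0 linearZ.
  by rewrite cyc0 cherednik_affine_max (Jack_eigen _ _ hE) linearD linearZ /= ?eqxx [RHS]scalerDl mulr1n scale1r.
move=> G; set lead := xmul 'X_[alpha] (sact (rperm alpha)^-1%g (T E)).
have hlow := Jack_lead alpha hE; rewrite -/lead in hlow.
have lin : linear (fun f => coef_at (affine_mon alpha) G (affine f)).
  by move=> c f g; rewrite linearP /= coef_at_is_linear.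
rewrite -[J alpha E](subrK lead) -[X in X + _]scale1r lin.
rewrite (lspan_ker lin _ hlow) ?scaler0 ?add0r => [|g [beta [F [_ lt' hF ->]]]].
  rewrite affine_monomial coef_at_xmul ?eqxx ?mul1r; last by apply: sact_in_P; apply: (sact_T_in_P _ hE).
  by rewrite rperm_affine invMg invgK sactM.
rewrite affine_monomial coef_at_xmul; last exact: (sact_T_in_P _ hF).
case: eqP => [/mnmP e|]; last by rewrite mul0r.
have eb : beta = alpha by apply/mnmP=> x; have := e (cyc n x); rewrite !affine_mon_cyc => /addIn.
by rewrite eb ltnn in lt'.
Qed.

(** Some self-adjoint operator [U_i] has different eigenvalues on the two polynomials. *)
Lemma Jack_orth k alpha beta E F : E \in EE N m k -> F \in EE N m k ->
  (alpha, E) != (beta, F) -> B (J alpha E) (J beta F) = 0.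
Proof.
move=> hE hF /(spectrum_separates hm hkappa hE hF)[i hi].
apply: (form_eigen_orth hB (cherednik_sym hB i) (Jack_in_sP alpha hE) (Jack_in_sP beta hF)
  (Jack_eigen alpha i hE) (Jack_eigen beta i hF) hi).
Qed.

(** The exchanged polynomial is orthogonal to [J alpha E], so [form_pythagoras] applies
    to [Jack_swap]. *)
Lemma Jack_norm_swap k alpha E i j : E \in EE N m k -> j = i.+1 :> nat -> (alpha i < alpha j)%N ->
  B (J (mperm alpha (tperm i j)) E) (J (mperm alpha (tperm i j)) E)
   = (1 - (kappa / (spectrum kappa k alpha E i - spectrum kappa k alpha E j)) ^+ 2)
     * B (J alpha E) (J alpha E).
Proof.
move=> hE ij lt; have o := Jack_orth (alpha := mperm alpha (tperm i j)) (beta := alpha) hE hE.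
rewrite (Jack_swap hE ij lt) in o *; apply: (form_pythagoras hB); first exact: (Jack_in_sP _ hE).
apply: o; apply/eqP=> -[/mnmP/(_ i)]; rewrite mnmE tpermL => e.
by rewrite e ltnn in lt.
Qed.

Lemma Jack_norm_affine k alpha E : E \in EE N m k ->
  B (J (affine_mon alpha) E) (J (affine_mon alpha) E)
   = spectrum kappa k alpha E ord0 * B (J alpha E) (J alpha E).
Proof.
move=> hE; rewrite (Jack_affine alpha hE) (form_affine hB); last exact: (Jack_in_sP _ hE).
by rewrite (Jack_eigen _ _ hE) (bformZr hB) //; apply: (Jack_in_sP _ hE).
Qed.

Lemma Jack_zero k E : E \in EE N m k -> J 0%MM E = T E.
Proof.
move=> hE; have [[a ->] _] := hJ 0%MM hE; rewrite big1 => [|beta /lhd_weight_lt]; last first.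
  have -> : val beta = 0%MM by apply/eqP; rewrite -mdeg_eq0; have := bmdeg beta; rewrite [X in (_ < X.+1)%N]mdeg0 ltnS leqn0.
  by rewrite ltnn.
rewrite addr0 mpolyX0 xmul1; have -> : rperm 0%MM = 1%g :> 'S_N; last by rewrite invg1 sact1.
apply: perm_homo_id => i j ij; rewrite !rperm_val; apply: proper_card; apply/properP; split.
  by apply/subsetP=> x; rewrite !inE !mnmE ij ltnn /= !andbT; lia.
by exists i; rewrite !inE !mnmE ?ij ltnn /= ?eqxx ?ltnSn /= ?ltnn.
Qed.

End Jack.

(** * The norm formula for the nonsymmetric Jack polynomials *)

Section SortedRearrangement.
Context (n : nat).
Local Notation N := n.+1.
Implicit Types (alpha lambda : 'X_{1..N}) (i j x y : 'I_N).

Lemma rperm_lt alpha x y : (alpha y < alpha x)%N || (alpha x == alpha y) && (x < y)%N ->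
  (rperm alpha x < rperm alpha y)%N.
Proof.
move=> h; rewrite !rperm_val; apply: proper_card; apply/properP; split.
  apply/subsetP=> z; rewrite !inE; move: h; case: (ltngtP (alpha y) (alpha x)) => //= lt.
    by move=> _ /orP[h|/andP[_ /eqP ->]]; rewrite ?lt // (ltn_trans lt h).
  by rewrite -lt => lxy /orP[-> //|/andP[h ->]]; rewrite (ltn_trans h lxy) orbT.
exists x; last by rewrite !inE !ltnn.
by rewrite inE andbC.
Qed.

Lemma aplus_nonincr lambda : (forall i j, (i <= j)%N -> (lambda j <= lambda i)%N) ->
  aplus lambda = lambda.
Proof.
move=> h; apply/mnmP=> i; rewrite mnmE sorted_sort; first by rewrite (mnm_nth 0).
  by move=> x y z /= h1 h2; apply: leq_trans h2 h1.
apply/(sortedP 0%N) => a; rewrite size_tuple => lt.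
have lt' : (a < N)%N by apply: ltnW.
have := h (Ordinal lt') (Ordinal lt) (leqnSn a).
by rewrite !(mnm_nth 0).
Qed.

Lemma aplus_nonincreasing alpha x y : (x <= y)%N -> (aplus alpha y <= aplus alpha x)%N.
Proof.
move=> le; rewrite !mnmE.
have tr : transitive geq by move=> a b c /= h1 h2; apply: leq_trans h2 h1.
have so : sorted geq (sort geq alpha) by apply: sort_sorted => a b; apply: leq_total.
by apply: (sorted_leq_nth tr leqnn 0%N so) => //; rewrite inE size_sort size_tuple.
Qed.

Lemma aplus_rperm alpha i : aplus alpha (rperm alpha i) = alpha i.
Proof.
rewrite -(aplus_perm alpha (rperm alpha)^-1%g) aplus_nonincr ?mnmE ?permK // => x y.
rewrite !mnmE leq_eqVlt => /orP[/eqP/val_inj -> //|lt].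
rewrite leqNgt; apply/negP=> h.
have := @rperm_lt alpha ((rperm alpha)^-1%g y) ((rperm alpha)^-1%g x).
by rewrite h !permKV => /(_ isT); rewrite ltnNge ltnW.
Qed.
End SortedRearrangement.

Section NormFormula.
Context (R : realFieldType) (n m : nat) (hm : (1 <= m <= n)%N) (kappa : R).
Local Notation N := n.+1.
Local Notation V := (superpoly R N).
Hypothesis hkappa : generic N kappa.
Implicit Types (E F G : {set 'I_N}) (i j x y : 'I_N) (alpha beta : 'X_{1..N}) (p : 'I_N * 'I_N).

(** The product over [l] in [Pprod], for two parts with gap [a] and contents with
    difference [d]. *)
Definition gap_product (a : nat) (d : int) : R :=
  \prod_(1 <= l < a.+1) (1 - (kappa / (l%:R + kappa * d%:~R)) ^+ 2).

Lemma gap_product0 d : gap_product 0 d = 1. Proof. by rewrite /gap_product big_geq. Qed.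

Lemma gap_productS a d :
  gap_product a.+1 d = gap_product a d * (1 - (kappa / (a.+1%:R + kappa * d%:~R)) ^+ 2).
Proof. by rewrite /gap_product big_nat_recr. Qed.

(** The contribution of a pair of positions to the norm of [J_alpha]. While the larger
    entry comes second, the factor whose index [l] is the whole gap is missing;
    [Jack_norm_swap] supplies it when the two entries are exchanged. *)
Definition pair_factor alpha (c : 'I_N -> int) p : R :=
  if (alpha p.2 <= alpha p.1)%N then gap_product (alpha p.1 - alpha p.2) (c p.1 - c p.2)
  else gap_product (alpha p.2 - alpha p.1).-1 (c p.2 - c p.1).

Definition norm_product alpha (c : 'I_N -> int) : R :=
  (\prod_x poch (1 + kappa * (c x)%:~R) (alpha x))
  * \prod_(p : 'I_N * 'I_N | (p.1 < p.2)%N) pair_factor alpha c p.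

Definition pair_map (w : 'S_N) p := (w p.1, w p.2).
Lemma pair_map_inj w : injective (pair_map w).
Proof. by case=> [a b] [c d] [/perm_inj -> /perm_inj ->]. Qed.

Lemma pair_factor_reindex (w : 'S_N) alpha beta c d p :
  (forall x, alpha (w x) = beta x) -> (forall x, c (w x) = d x) ->
  pair_factor alpha c (pair_map w p) = pair_factor beta d p.
Proof. by move=> h1 h2; rewrite /pair_factor /= !h1 !h2. Qed.

Lemma norm_product_swap alpha c c' i j : j = i.+1 :> nat -> (alpha i < alpha j)%N ->
  (forall x, c' (tperm i j x) = c x) ->
  norm_product (mperm alpha (tperm i j)) c'
   = (1 - (kappa / ((alpha j - alpha i)%:R + kappa * (c j - c i)%:~R)) ^+ 2) * norm_product alpha c.
Proof.
move=> ij lt hc; pose s := tperm i j.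
have ha x : mperm alpha s (s x) = alpha x by rewrite mnmE tpermK.
rewrite /norm_product (reindex_inj (@perm_inj _ s)) /=.
under eq_bigr => x _ do rewrite ha hc.
rewrite mulrCA; congr (_ * _).
rewrite (reindex_inj (@pair_map_inj s)) (bigD1 (j, i)) /=; last by rewrite /s tpermL tpermR ij.
rewrite [in RHS](bigD1 (i, j)) /=; last by rewrite ij.
rewrite mulrA; congr (_ * _).
  rewrite (@pair_factor_reindex s _ _ _ _ (j, i) ha hc) /pair_factor /= ltnW // leqNgt lt /=.
  have -> : (alpha j - alpha i)%N = (alpha j - alpha i).-1.+1 by rewrite prednK // subn_gt0.
  by rewrite gap_productS mulrC.
apply: eq_big => [[x y]|p _]; last exact: pair_factor_reindex.
rewrite /= !xpair_eqE; have [/andP[/eqP -> /eqP ->]|n1] := boolP ((x == j) && (y == i)).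
  by rewrite andbF ltnNge ij leqnSn.
have [/andP[/eqP -> /eqP ->]|n2] := boolP ((x == i) && (y == j)).
  by rewrite /s tpermL tpermR ij ltnNge leqnSn andbF.
rewrite !andbT; apply/idP/idP => h; last by apply: tperm_adj_lt; rewrite // -negb_and.
rewrite -[x](tpermK i j) -[y](tpermK i j); apply: tperm_adj_lt; rewrite // -negb_and.
apply: contraNN n1 => /andP[/eqP ex /eqP ey].
by rewrite -[x](tpermK i j) -[y](tpermK i j) ex ey tpermL tpermR !eqxx.
Qed.

(** The pairs containing the first position are reversed while its entry grows by one,
    and this leaves their factors unchanged. *)
Lemma norm_product_affine alpha c c' : (forall x, c' (cyc n x) = c x) ->
  norm_product (affine_mon alpha) c'
    = ((alpha ord0 + 1)%:R + kappa * (c ord0)%:~R) * norm_product alpha c.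
Proof.
move=> hc; rewrite /norm_product (reindex_inj (@perm_inj _ (cyc n))) /= mulrA; congr (_ * _).
  rewrite (bigD1 ord0) //= [in RHS](bigD1 ord0) //= mulrA; congr (_ * _).
    rewrite affine_mon_cyc hc eqxx -[nat_of_bool true]/1%N addn1 /poch big_ord_recr /= [LHS]mulrC.
    by congr (_ * _); rewrite -natr1; ring.
  by apply: eq_bigr => x x0; rewrite affine_mon_cyc hc (negbTE x0) addn0.
rewrite (reindex_inj (@pair_map_inj (cyc n))) /=.
rewrite (bigID (fun p => p.2 == ord0)) /= [RHS](bigID (fun p => p.1 == ord0)) /=.
have pos x : (0 < x)%N = (x != ord0) by rewrite lt0n -(inj_eq val_inj).
have cmax x : (cyc n x < n)%N = (x != ord0).
  case: (unliftP ord0 x) => [x' ->|->]; last by rewrite cyc0 ltnn eqxx.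
  by rewrite (@cycS n (widen_ord (leqnSn n) x')) ?lift0 //= ltn_ord.
congr (_ * _).
  rewrite (reindex_inj (can_inj (@swap_pairK _ _))) /=; apply: eq_big => [[x y]|[x y]] /=.
    by case: (eqVneq x ord0) => [->|]; rewrite ?andbF // !andbT cyc0 cmax pos.
  case/andP=> lt /eqP ex; have y0 : y != ord0 by apply: contraTneq lt => ->; rewrite ex ltnn.
  rewrite ex /pair_factor /= !affine_mon_cyc !hc eqxx.
  rewrite (negbTE y0).
  rewrite addn0 -?[nat_of_bool true]/1%N addn1; case: (ltngtP (alpha ord0) (alpha y)) => h.
  - by rewrite subnS.
  - by rewrite subSn ?(ltnW h).
  - by rewrite -h subSnn subnn.
apply: eq_big => [[x y]|[x y]] /=.
  case: (eqVneq x ord0) => [->|x0]; case: (eqVneq y ord0) => [->|y0]; rewrite ?andbF ?andbT //.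
    by rewrite cyc0 ltnNge -ltnS ltn_ord.
  by rewrite cyc_lt.
case/andP=> lt y0; have x0 : x != ord0.
  by apply: contraTneq lt => ->; rewrite cyc0 -leqNgt -ltnS ltn_ord.
by rewrite /pair_factor /= !affine_mon_cyc !hc (negbTE x0) (negbTE y0) !addn0.
Qed.

Lemma Rprod_pair k z alpha E : Rprod kappa k z alpha E
  = \prod_(p : 'I_N * 'I_N | (p.1 < p.2)%N && (alpha p.1 < alpha p.2)%N)
     (1 + (-1) ^+ z * kappa / ((alpha p.2 - alpha p.1)%:R
          + kappa * (ranked_content k alpha E p.2 - ranked_content k alpha E p.1)%:~R)).
Proof. by rewrite /Rprod pair_big_dep. Qed.

Lemma Pprod_pair k alpha E (w : 'S_N) (lambda : 'X_{1..N}) :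
  (forall x, lambda (w x) = alpha x) -> (forall i j, (i <= j)%N -> (lambda j <= lambda i)%N) ->
  Pprod kappa k lambda E
   = (\prod_x poch (1 + kappa * (content k (w x) E)%:~R) (alpha x))
     * \prod_(p : 'I_N * 'I_N | (alpha p.2 < alpha p.1)%N)
         gap_product (alpha p.1 - alpha p.2) (content k (w p.1) E - content k (w p.2) E).
Proof.
move=> hl dec; rewrite /Pprod (reindex_inj (@perm_inj _ w)) /=; congr (_ * _).
  by apply: eq_bigr => x _; rewrite hl.
rewrite pair_big_dep /= (bigID (fun p => (lambda p.2 < lambda p.1)%N)) /=.
rewrite [X in _ * X]big1 ?mulr1 => [|[x y] /= /andP[_]]; last first.
  by rewrite -leqNgt -subn_eq0 => /eqP ->; rewrite big_geq.
rewrite (reindex_inj (@pair_map_inj w)) /=; apply: eq_big => [[x y]|[x y] _] /=; last by rewrite !hl.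
rewrite !hl andbC; case: ltnP => //= h.
by rewrite ltnNge; apply/negP=> /dec; rewrite !hl leqNgt h.
Qed.

(** The factor [1 - (kappa / X)^2] that is missing for a pair in the wrong order is the
    product of its factors in [R_0] and [R_1]. *)
Lemma norm_product_Pprod k alpha E : E \in EE N m k ->
  norm_product alpha (ranked_content k alpha E)
    * (Rprod kappa k 0 alpha E * Rprod kappa k 1 alpha E)
   = Pprod kappa k (aplus alpha) E.
Proof.
move=> hE; rewrite (@Pprod_pair k alpha E (rperm alpha)); first last.
- by move=> i j; apply: aplus_nonincreasing.
- exact: aplus_rperm.
rewrite /norm_product -mulrA; congr (_ * _); rewrite !Rprod_pair -big_split /=.
rewrite (bigID (fun p => (alpha p.1 < alpha p.2)%N)) /= mulrAC -big_split /=.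
rewrite [RHS](bigID (fun p => (p.2 < p.1)%N)) /=; congr (_ * _).
  rewrite (reindex_inj (can_inj (@swap_pairK _ _))) /=; apply: eq_big => [[x y]|[x y]] /=; first by rewrite andbC.
  case/andP=> _ lt; rewrite /pair_factor /= leqNgt lt /=.
  rewrite -[in RHS](prednK (_ : 0 < alpha x - alpha y)%N) ?subn_gt0 // gap_productS prednK ?subn_gt0 //.
  by congr (_ * _); rewrite /ranked_content expr0 expr1; set X := (_%:R + kappa * _); move: (X^-1) => Y; ring.
rewrite (bigID (fun p => alpha p.1 == alpha p.2)) /= big1 ?mul1r => [|[x y] /= /andP[_ /eqP e]].
  apply: eq_big => [[x y]|[x y]] /=.
    by case: (ltngtP x y) => [_|_|/val_inj ->]; rewrite ?ltnn ?andbF ?andbT /=; case: (ltngtP (alpha x) (alpha y)).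
  by case/andP=> /andP[_]; rewrite -leqNgt /pair_factor /= => ->.
by rewrite /pair_factor /= e leqnn subnn gap_product0.
Qed.

Context (B : V -> V -> R) (hB : is_form kappa m B).
Context (T : {set 'I_N} -> V) (hT : is_Tfamily m T).
Context (J : 'X_{1..N} -> {set 'I_N} -> V).
Hypothesis hJ : forall k alpha F, F \in EE N m k -> is_Jack kappa m T k alpha F (J alpha F).

(** Induction on the degree, then on [psums]. If the last entry of [alpha] is positive,
    [J alpha E] is raised from a lower degree; otherwise it comes from an exchange, unless
    [alpha] is nondecreasing, and then [alpha = 0]. *)
Lemma Jack_norm_product k alpha E : E \in EE N m k ->
  B (J alpha E) (J alpha E) = B (T E) (T E) * norm_product alpha (ranked_content k alpha E).
Proof.
move=> hE; have [d] := ubnP (mdeg alpha); elim: d => // d IHd in alpha *; rewrite ltnS => hd.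
have [b] := ubnP (psums alpha); elim: b => // b IHb in alpha hd *; rewrite ltnS => hb.
have [a0|apos] := posnP (alpha ord_max); last first.
  pose beta : 'X_{1..N} := [multinom (alpha (cyc n x) - (x == ord0))%N | x < N].
  have e : alpha = affine_mon beta.
    apply/mnmP=> x; rewrite -[x](permKV (cyc n)) affine_mon_cyc mnmE subnK //.
    by case: eqP => [->|//]; rewrite cyc0.
  rewrite e (Jack_norm_affine hm hkappa hB hT hJ _ hE) IHd; last first.
    by move: hd; rewrite e mdeg_affine_mon.
  rewrite mulrCA; congr (_ * _).
  by rewrite (@norm_product_affine beta (ranked_content k beta E)) // => x; rewrite /ranked_content rperm_affine permM permK.
have [[i [j [ij lt]]]|noex] := adjacentP (fun i j => alpha j < alpha i)%N.
  pose beta := mperm alpha (tperm i j).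
  have e : alpha = mperm beta (tperm i j) by apply/mnmP=> x; rewrite !mnmE tpermK.
  have lt' : (beta i < beta j)%N by rewrite !mnmE tpermL tpermR.
  have ne : beta i != beta j by rewrite neq_ltn lt'.
  rewrite e (Jack_norm_swap hm hkappa hB hT hJ hE ij lt') IHb; first last.
  - by apply: leq_trans hb; rewrite [X in (_ < psums X)%N]e; apply: psums_swap.
  - by rewrite mdeg_perm.
  rewrite mulrCA; congr (_ * _).
  rewrite (@norm_product_swap beta (ranked_content k beta E) _ i j ij lt'); last first.
    by move=> x; rewrite /ranked_content rperm_swap // permM tpermK.
  have -> : spectrum kappa k beta E i - spectrum kappa k beta E j
      = - ((beta j - beta i)%:R + kappa * (ranked_content k beta E j - ranked_content k beta E i)%:~R).
    by rewrite spectrum_sub natrB ?(ltnW lt') // !intrB -!pmulrn; ring.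
  by rewrite invrN mulrN sqrrN.
have -> : alpha = 0%MM.
  apply/mnmP=> x; rewrite mnm0E; apply/eqP; rewrite -leqn0 -a0.
  suff mono x' y : (x' <= y)%N -> (alpha x' <= alpha y)%N by apply: mono; rewrite -ltnS.
  rewrite leq_eqVlt => /orP[/eqP/val_inj -> //|].
  (* Adding [z] turns weakly increasing entries into strictly increasing ones. *)
  move/(@ord_adj_homo _ (fun z : 'I_N => (alpha z * N + z)%N)) => h.
  have {h} : (alpha x' * N + x' < alpha y * N + y)%N.
    apply: h => i j ij; have := noex i j ij; rewrite ij -leqNgt => le.
    by rewrite -addnS leq_add2r leq_mul2r le orbT.
  have := ltn_ord y; move: (nat_of_ord y) (nat_of_ord x') (alpha x') (alpha y) => a b' u v.
  by clear; nia.
rewrite (Jack_zero hm hJ hE) /norm_product !big1 ?mulr1 // => [[x y] _|x _].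
  by rewrite /pair_factor /= !mnm0E subnn gap_product0.
by rewrite mnm0E /poch big_ord0.
Qed.

Lemma Jack_norm k alpha E : E \in EE N m k ->
  B (J alpha E) (J alpha E) * (Rprod kappa k 0 alpha E * Rprod kappa k 1 alpha E)
   = B (T E) (T E) * Pprod kappa k (aplus alpha) E.
Proof. by move=> hE; rewrite (Jack_norm_product _ hE) -mulrA norm_product_Pprod. Qed.
End NormFormula.

(** * An antisymmetrisation identity for Young subgroups *)

Section YoungIdentity.
Context (R : realFieldType) (N : nat) (C : eqType) (f : 'I_N -> C).
Implicit Types (w : 'S_N) (i j x y : 'I_N) (p : 'I_N * 'I_N) (mm : 'X_{1..N}).

(** The Young subgroup that preserves the fibres of [f]. *)
Definition young w : bool := [forall i, f (w i) == f i].
Definition fibre_pair p : bool := (p.1 < p.2)%N && (f p.1 == f p.2).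

Lemma youngP w : reflect (forall i, f (w i) = f i) (young w).
Proof. exact: (iffP 'forall_eqP). Qed.

Lemma young_tperm i j : f i = f j -> forall x, f (tperm i j x) = f x.
Proof. by move=> e x; case: tpermP => // ->. Qed.

(** Up to sign, the product of the Vandermonde determinants of the fibres. *)
Definition fibre_vandermonde (y : 'I_N -> R) : R :=
  \prod_(p : 'I_N * 'I_N | fibre_pair p) (y p.1 - y p.2).

(** Besides [(i, j)] itself, each point of the fibre between [i] and [j] lies in
    exactly two inverted pairs. *)
Lemma card_inversions_tperm i j : (i < j)%N -> f i = f j ->
  odd #|[set p : 'I_N * 'I_N | fibre_pair p && (tperm i j p.2 < tperm i j p.1)%N]|.
Proof.
move=> lt fij; pose S := [set x : 'I_N | [&& (i < x)%N, (x < j)%N & f x == f i]].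
have tE z : val (tperm i j z) = if z == i then val j else if z == j then val i else val z.
  by case: tpermP => [->|->|/eqP/negbTE -> /eqP/negbTE -> //]; rewrite ?eqxx //; case: eqP => // ->.
have -> : [set p : 'I_N * 'I_N | fibre_pair p && (tperm i j p.2 < tperm i j p.1)%N]
    = (i, j) |: ([set (i, x) | x in S] :|: [set (x, j) | x in S]).
  apply/setP=> -[a b]; rewrite !inE /fibre_pair /= xpair_eqE.
  have -> : ((a, b) \in [set (i, x) | x in S]) = (a == i) && (b \in S).
    by apply/imsetP/andP => [[x xS [-> ->]]|[/eqP -> bS]]; [rewrite eqxx | exists b].
  have -> : ((a, b) \in [set (x, j) | x in S]) = (b == j) && (a \in S).
    by apply/imsetP/andP => [[x xS [-> ->]]|[/eqP -> bS]]; [rewrite eqxx | exists a].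
  rewrite !inE -[(_ < tperm i j a)%N]/(val (tperm i j b) < val (tperm i j a))%N !tE.
  have [->|ai] := eqVneq a i; have [->|bj] := eqVneq b j; rewrite ?eqxx ?fij ?eqxx ?lt ?andbT ?orbT ?orbF /=.
  - by rewrite -val_eqE /= gtn_eqF.
  - rewrite (eq_sym (f j)); case: (eqVneq b i) => [->|bi]; first by rewrite ltnn.
    by rewrite andbA andbAC.
  - rewrite (negbTE (_ : j != i)) ?eqxx; last by rewrite -val_eqE /= gtn_eqF.
    rewrite (_ : (a == j) = (val a == val j)) //.
    move: ai; rewrite -val_eqE /= => ai; case: (f a == f j); rewrite ?andbF // !andbT.
    by case: eqP => h; lia.
  - rewrite (_ : (a == j) = (val a == val j)) // (_ : (b == i) = (val b == val i)) //.
    move: ai bj; rewrite -!val_eqE /= => ai bj; case: (f a == f b); rewrite ?andbF // !andbT.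
    by case: eqP => h1; case: eqP => h2; lia.
rewrite cardsU1 cardsU.
have -> : [set (i, x) | x in S] :&: [set (x, j) | x in S] = set0.
  apply/setP=> -[a b]; rewrite !inE; apply/negP=> /andP[/imsetP[x xS [ea eb]] /imsetP[y yS [ea' eb']]].
  by move: yS; rewrite -ea' ea !inE ltnn.
rewrite cards0 subn0 !card_imset; [| by move=> x y [] | by move=> x y []].
rewrite oddD addnn odd_double addbF !inE negb_or.
have -> : (i, j) \notin [set (i, x) | x in S].
  by apply/imsetP=> -[x xS [e]]; move: xS; rewrite -e !inE ltnn andbF.
have -> // : (i, j) \notin [set (x, j) | x in S].
by apply/imsetP=> -[x xS [e]]; move: xS; rewrite -e !inE ltnn.
Qed.

Lemma fibre_vandermonde_tperm (y : 'I_N -> R) i j : i != j -> f i = f j ->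
  fibre_vandermonde (y \o tperm i j) = - fibre_vandermonde y.
Proof.
wlog lt : i j / (i < j)%N => [hw ne fij|_ fij].
  case: (ltngtP i j) => [lt|lt|/val_inj e]; [exact: hw | | by rewrite e eqxx in ne].
  by rewrite tpermC; apply: hw => //; rewrite eq_sym.
set t := tperm i j; pose F p := y p.1 - y p.2.
pose h p := (t p.1, t p.2); have h_inj : injective h by case=> [a b] [d e] [/perm_inj -> /perm_inj ->].
have ft x : f (t x) = f x by apply: young_tperm.
rewrite /fibre_vandermonde (reindex_inj h_inj) /=.
under eq_bigr => p _ do rewrite !tpermK.
rewrite (bigID (fun p => (p.1 < p.2)%N)) /= [X in _ * X](reindex_inj (can_inj (@swap_pairK _ _))) /=.
pose Inv := [set p : 'I_N * 'I_N | fibre_pair p && (t p.2 < t p.1)%N].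
have geN p : (p.1 < p.2)%N -> ~~ (t p.1 < t p.2)%N = (t p.2 < t p.1)%N.
  move=> ltp; rewrite -leqNgt leq_eqVlt.
  by case: eqP => // /val_inj/perm_inj e; rewrite e ltnn in ltp.
rewrite [X in _ = - X](bigID (fun p => (t p.1 < t p.2)%N)) /= -mulrN; congr (_ * _).
  apply: eq_bigl => -[a b]; rewrite /fibre_pair /= !ft.
  by case: (a < b)%N; rewrite ?andbF ?andbT //= andbC.
have -> : \prod_(p | fibre_pair p && ~~ (t p.1 < t p.2)%N) (y p.1 - y p.2) = \prod_(p in Inv) F p.
  apply: eq_bigl => p; rewrite inE /fibre_pair; case: (boolP (p.1 < p.2)%N) => //= /geN ->.
  by [].
transitivity (\prod_(p in Inv) - F p).
  apply: eq_big => [[a b]|[a b] _]; last by rewrite /F /= opprB.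
  rewrite inE /fibre_pair /= !ft eq_sym -leqNgt.
  case: (ltngtP a b) => [l|l|/val_inj ->] /=; rewrite ?andbF ?andbT ?ltnn //=.
  by rewrite andbC.
under eq_bigr => p _ do rewrite -mulN1r.
by rewrite big_split /= prodr_const -signr_odd (card_inversions_tperm lt fij) expr1 mulN1r.
Qed.

(** If the exponents are distinct within each fibre, then [mm i] is at least the
    number of smaller exponents in the fibre of [i]; summing over [i] counts every pair of a
    fibre once. *)
Lemma low_degree_repeats mm : (mdeg mm < #|[set p | fibre_pair p]|)%N ->
  exists i j, [/\ i != j, f i = f j & mm i = mm j].
Proof.
move=> lt.
have [/existsP[i /existsP[j /and3P[ne /eqP e1 /eqP e2]]]|noex] :=
  boolP [exists i, exists j, [&& i != j, f i == f j & mm i == mm j]]; first by exists i, j.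
have mm_inj i j : f i = f j -> mm i = mm j -> i = j.
  move=> e1 e2; apply/eqP; apply: contraNT noex => ne.
  by apply/existsP; exists i; apply/existsP; exists j; rewrite ne e1 e2 !eqxx.
pose S i := [set j | (f j == f i) && (mm j < mm i)%N].
have cardS i : (#|S i| <= mm i)%N.
  rewrite cardE -(size_map mm) -[X in (_ <= X)%N](size_iota 0); apply: uniq_leq_size.
    rewrite map_inj_in_uniq ?enum_uniq // => x y; rewrite !mem_enum !inE.
    by move=> /andP[/eqP ex _] /andP[/eqP ey _]; apply: mm_inj; rewrite ex ey.
  by move=> _ /mapP[x xS ->]; move: xS; rewrite mem_enum inE mem_iota => /andP[_].
suff : (#|[set p | fibre_pair p]| <= mdeg mm)%N by rewrite leqNgt lt.
rewrite mdegE; have le : (\sum_i #|S i| <= \sum_i mm i)%N by apply: leq_sum => i _.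
apply: leq_trans le.
have -> : (\sum_i #|S i| = \sum_(p : 'I_N * 'I_N | (f p.1 == f p.2) && (mm p.2 < mm p.1)) 1)%N.
  rewrite (eq_bigr (fun i => \sum_(j | (f i == f j) && (mm j < mm i)) 1)%N); last first.
    by move=> i _; rewrite sum1dep_card; apply: eq_card => j; rewrite !inE eq_sym.
  by rewrite pair_big_dep.
rewrite -sum1dep_card (bigID (fun p => (mm p.2 < mm p.1)%N)) /=.
rewrite [X in (_ <= X)%N](bigID (fun p => (p.1 < p.2)%N)) /=; apply: leq_add.
  by rewrite leq_eqVlt; apply/orP; left; apply/eqP; apply: eq_bigl => p; rewrite /fibre_pair; case: (_ < _)%N; rewrite ?andbF ?andbT //= ?andbC.
rewrite [X in (_ <= X)%N](reindex_inj (can_inj (@swap_pairK _ _))) /= leq_eqVlt; apply/orP; left; apply/eqP.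
apply: eq_bigl => -[a b]; rewrite /fibre_pair /= eq_sym.
case: (ltngtP a b) => [l|l|/val_inj ->] /=; rewrite ?andbF ?ltnn ?andbF //= ?andbT.
case: (eqVneq (f a) (f b)) => [e|] //=; rewrite -leqNgt leq_eqVlt.
case: (eqVneq (mm a) (mm b)) => [/(mm_inj _ _ e) eab|_] //.
by rewrite eab ltnn in l.
Qed.

Section Identity.
Context (z : 'I_N -> R) (z_inj : forall i j, f i = f j -> z i = z j -> i = j) (c : R).

Lemma fibre_vandermonde_neq0 w : young w -> fibre_vandermonde (z \o w) != 0.
Proof.
move=> /youngP hw; apply/prodf_neq0 => -[a b] /andP[/= lt /eqP e].
rewrite subr_eq0; apply: contraTneq lt => /z_inj; rewrite !hw => /(_ e)/perm_inj ->.
by rewrite ltnn.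
Qed.

(** Exchanging two points of a fibre with the same exponent fixes the monomial and
    negates the denominator. *)
Lemma young_low_degree mm : (mdeg mm < #|[set p | fibre_pair p]|)%N ->
  \sum_(w | young w) (\prod_i z (w i) ^+ mm i) / fibre_vandermonde (z \o w) = 0.
Proof.
move=> /low_degree_repeats [i [j [ne fij mij]]]; set S := \sum_(_ | _) _.
suff : S = - S by move=> e; lra.
rewrite [LHS](reindex_inj (mulgI (tperm i j))) -sumrN.
have ft := young_tperm fij; apply: eq_big => [w|w _].
  apply/youngP/youngP => hw x; last by rewrite permM hw ft.
  by have := hw (tperm i j x); rewrite permM tpermK ft.
rewrite -mulrN -invrN; congr (_ / _).
  rewrite (reindex_inj (@perm_inj _ (tperm i j))) /=; apply: eq_bigr => x _.
  by rewrite permM tpermK; congr (_ ^+ _); case: tpermP => [->|->|].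
by rewrite -(fibre_vandermonde_tperm _ ne fij); apply: eq_bigr => p _; rewrite /= !permM.
Qed.

Definition shifted : {mpoly R[N]} :=
  \prod_(p : 'I_N * 'I_N | fibre_pair p) ('X_(p.1) - 'X_(p.2) + c%:MP).
Definition unshifted : {mpoly R[N]} :=
  \prod_(p : 'I_N * 'I_N | fibre_pair p) ('X_(p.1) - 'X_(p.2)).

(** Adding a constant to the factors does not change the terms of top degree. *)
Lemma msize_shift (s : seq ('I_N * 'I_N)) :
  (msize (\prod_(p <- s) ('X_(p.1) - 'X_(p.2)) : {mpoly R[N]}) <= (size s).+1)%N /\
  (msize (\prod_(p <- s) ('X_(p.1) - 'X_(p.2) + c%:MP)
          - \prod_(p <- s) ('X_(p.1) - 'X_(p.2)) : {mpoly R[N]}) <= size s)%N.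
Proof.
have szM (p q : {mpoly R[N]}) : (msize (p * q) <= (msize p + msize q).-1)%N.
  have [->|p0] := eqVneq p 0; first by rewrite mul0r msize0.
  have [->|q0] := eqVneq q 0; first by rewrite mulr0 msize0.
  by rewrite msizeM.
elim: s => [|p s [IH1 IH2]]; first by rewrite !big_nil subrr msize1 msize0.
rewrite !big_cons /=; set P := \prod_(_ <- s) (_ + _) in IH2 *; set Q := \prod_(_ <- s) _ in IH1 IH2 *.
have hX : (msize ('X_(p.1) - 'X_(p.2) : {mpoly R[N]}) <= 2)%N.
  apply: leq_trans (mmeasureD_le _ _ _) _; rewrite geq_max mmeasureN.
  by rewrite !mmeasureX /= !mdeg1.
have hP : (msize P <= (size s).+1)%N.
  rewrite -[P](subrK Q); apply: leq_trans (mmeasureD_le _ _ _) _.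
  by rewrite geq_max IH1 andbT ltnW.
split; first by apply: leq_trans (szM _ _) _; move: hX IH1; lia.
have -> : ('X_(p.1) - 'X_(p.2) + c%:MP) * P - ('X_(p.1) - 'X_(p.2)) * Q
    = ('X_(p.1) - 'X_(p.2)) * (P - Q) + c *: P.
  by rewrite -mul_mpolyC; ring.
apply: leq_trans (mmeasureD_le _ _ _) _; rewrite geq_max; apply/andP; split.
  by apply: leq_trans (szM _ _) _; move: hX IH2; lia.
by apply: leq_trans (msizeZ_le _ _) hP.
Qed.

(** Over the common denominator [fibre_vandermonde] the numerators are
    [\prod (z_i - z_j + c)] and, for [c = 0], [\prod (z_i - z_j)]. Their difference has lower
    degree and antisymmetrises to 0, so the sum is the same as for [c = 0]. *)
Lemma young_identity :
  \sum_(w | young w) \prod_(p : 'I_N * 'I_N | fibre_pair p) (1 + c / (z (w p.1) - z (w p.2)))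
   = #|[set w | young w]|%:R.
Proof.
have diff : (msize (shifted - unshifted) <= #|[set p | fibre_pair p]|)%N.
  have := (msize_shift (enum [set p | fibre_pair p])).2.
  by rewrite -cardE !big_enum /=; under eq_bigl do rewrite inE; under [X in _ - X]eq_bigl do rewrite inE.
have zero : \sum_(w | young w) (shifted - unshifted).@[z \o w] / fibre_vandermonde (z \o w) = 0.
  under eq_bigr => w _ do rewrite mevalE mulr_suml.
  rewrite exchange_big /= big_seq big1 // => mm /msize_mdeg_lt lt.
  under eq_bigr => w _ do rewrite -mulrA.
  by rewrite -mulr_sumr young_low_degree ?mulr0 //; apply: leq_trans lt diff.
have ev w : unshifted.@[z \o w] = fibre_vandermonde (z \o w).
  by rewrite rmorph_prod; apply: eq_bigr => p _; rewrite /= mevalB !mevalXU.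
have evc w : shifted.@[z \o w] = \prod_(p : 'I_N * 'I_N | fibre_pair p) (z (w p.1) - z (w p.2) + c).
  by rewrite rmorph_prod; apply: eq_bigr => p _; rewrite /= mevalD mevalB !mevalXU mevalC.
rewrite -sum1dep_card natr_sum; apply/eqP; rewrite -subr_eq0 -sumrB -[X in _ == X]zero; apply/eqP.
apply: eq_bigr => w hw; rewrite mevalB ev mulrBl divff ?fibre_vandermonde_neq0 //; congr (_ - _).
rewrite evc -prodf_div; apply: eq_bigr => -[a b] /andP[/= lt /eqP e].
have d0 : z (w a) - z (w b) != 0.
  rewrite subr_eq0; apply: contraTneq lt => /z_inj; rewrite !(youngP _ hw) => /(_ e)/perm_inj ->.
  by rewrite ltnn.
by rewrite mulrDl divff.
Qed.
End Identity.

End YoungIdentity.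

(** * Matching the cells of two hook tableaux *)

Section Cells.
Context (n : nat).
Local Notation N := n.+1.
Implicit Types (A E F : {set 'I_N}) (i j x y : 'I_N) (w : 'S_N).

Lemma rev_enum_scount A : map (fun i : 'I_N => scount i A) (rev (enum A)) = iota 0 #|A|.
Proof.
have uq : uniq (map (fun i : 'I_N => scount i A) (rev (enum A))).
  rewrite map_inj_in_uniq ?rev_uniq ?enum_uniq // => x y.
  by rewrite !mem_rev !mem_enum; apply: scount_inj.
apply: (irr_sorted_eq ltn_trans ltnn); last 1 first.
- have sz : (size (iota 0 #|A|) <= size (map (fun i : 'I_N => scount i A) (rev (enum A))))%N.
    by rewrite size_iota size_map size_rev -cardE.
  have sub : {subset map (fun i : 'I_N => scount i A) (rev (enum A)) <= iota 0 #|A|}.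
    move=> z /mapP[x]; rewrite mem_rev mem_enum => xA ->.
    by rewrite mem_iota /= scount_card.
  by have [_ e] := uniq_min_size uq sub sz.
- apply: (@homo_sorted_in _ _ (fun x => x \in A) _ (fun x y : 'I_N => (y < x)%N)).
  + by move=> x y xA yA lt; apply: scount_ltE.
  + by apply/allP=> x; rewrite mem_rev mem_enum.
  + by rewrite rev_sorted; apply: sorted_enum.
- exact: iota_ltn_sorted.
Qed.

Lemma nth_rev_enum A x0 i : i \in A -> nth x0 (rev (enum A)) (scount i A) = i.
Proof.
move=> iA; have hlt := scount_card iA.
have hsz : (scount i A < size (rev (enum A)))%N by rewrite size_rev -cardE.
apply: (@scount_inj _ A) => //; first by rewrite -mem_enum -mem_rev mem_nth.
by rewrite -(nth_map x0 0%N (fun x : 'I_N => scount x A)) // rev_enum_scount nth_iota.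
Qed.

(** [scount i A] is the position of [i] in the decreasing list of the elements of [A]. *)
Lemma map_rev_enumP (h g : 'I_N -> nat) A A' : #|A| = #|A'| ->
  (map h (rev (enum A)) = map g (rev (enum A'))) <->
  (forall i j, i \in A -> j \in A' -> scount i A = scount j A' -> h i = g j).
Proof.
move=> eA; split=> [e i j iA jA ec|e].
  have := congr1 (nth 0%N ^~ (scount i A)) e.
  rewrite (nth_map i) ?(nth_map i) ?size_rev -?cardE -?eA ?scount_card //.
  by rewrite nth_rev_enum // ec nth_rev_enum.
apply: (@eq_from_nth _ 0%N) => [|t]; first by rewrite !size_map !size_rev -!cardE.
rewrite size_map size_rev -cardE => ht.
have x0 : 'I_N := ord0.
rewrite !(nth_map x0) ?size_rev -?cardE -?eA //.
have memA (B : {set 'I_N}) : #|B| = #|A| -> nth x0 (rev (enum B)) t \in B.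
  by move=> eB; rewrite -mem_enum -mem_rev mem_nth // size_rev -cardE eB.
have scA (B : {set 'I_N}) : #|B| = #|A| -> scount (nth x0 (rev (enum B)) t) B = t.
  move=> eB; rewrite -(nth_map x0 0%N (fun x : 'I_N => scount x B)) ?size_rev -?cardE ?eB //.
  by rewrite rev_enum_scount nth_iota ?eB.
by apply: e; rewrite ?memA ?scA.
Qed.

Lemma cell_bound A i : (0 <= hook_content A i + #|A|%:Z - 1 < N%:Z)%R.
Proof.
have hC := cardsC A; rewrite card_ord in hC; rewrite /hook_content; case: ifP => iA.
  by have := scount_card iA; lia.
have iA' : i \in ~: A by rewrite inE iA.
by have := scount_card iA'; lia.
Qed.

(** A numbering of the cells from 0: the contents are consecutive integers. *)
Definition cell_index A i : 'I_N := inord (absz (hook_content A i + #|A|%:Z - 1)%R).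

Lemma cell_indexE A i : (cell_index A i : nat)%:Z = hook_content A i + #|A|%:Z - 1.
Proof.
case/andP: (cell_bound A i); rewrite /cell_index; set z := (_ - 1) => z0 zN.
have hz : (absz z)%:Z = z by rewrite abszE ger0_norm.
by rewrite inordK // -ltz_nat hz.
Qed.

Lemma cell_index_inj A : injective (cell_index A).
Proof.
move=> i j /(congr1 (fun x : 'I_N => (x : nat)%:Z)); rewrite !cell_indexE => e.
by apply: (@hook_content_inj _ A); lia.
Qed.

Definition cell_perm A : 'S_N := perm (@cell_index_inj A).

(** Sends a label of the tableau of [A] to the label of the same cell in that of [A']. *)
Definition match_cells A A' : 'S_N := (cell_perm A * (cell_perm A')^-1)%g.

Lemma hook_content_match_cells A A' x : #|A| = #|A'| ->
  hook_content A' (match_cells A A' x) = hook_content A x.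
Proof.
move=> eA; have e : cell_index A' (match_cells A A' x) = cell_index A x.
  by have := permKV (cell_perm A') (cell_perm A x); rewrite /match_cells permM !permE.
by have := congr1 (fun y : 'I_N => (y : nat)%:Z) e; rewrite !cell_indexE eA; lia.
Qed.

Lemma match_cells_mem A A' x : #|A| = #|A'| -> (match_cells A A' x \in A') = (x \in A).
Proof.
move=> eA; have := hook_content_match_cells x eA.
case: (boolP (x \in A)) => xA; case: (boolP (match_cells A A' x \in A')) => yA //.
  by have := hook_content_le0 xA; have := hook_content_ge1 yA; lia.
by have := hook_content_ge1 xA; have := hook_content_le0 yA; lia.
Qed.

Lemma match_cells_imset A A' : #|A| = #|A'| -> match_cells A A' @: A = A'.
Proof.
move=> eA; apply/eqP; rewrite eqEcard card_imset ?eA ?leqnn ?andbT; last exact: perm_inj.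
by apply/subsetP=> _ /imsetP[x xA ->]; rewrite match_cells_mem.
Qed.

Lemma match_cells_mono A A' : #|A| = #|A'| ->
  {in A &, forall i j, (i < j)%N -> (match_cells A A' i < match_cells A A' j)%N}.
Proof.
move=> eA i j iA jA lt; have := scount_ltE jA lt.
have sc x : x \in A -> scount (match_cells A A' x) A' = scount x A.
  by move=> xA; have := hook_content_match_cells x eA; rewrite /hook_content match_cells_mem // xA; lia.
have sA x : x \in A -> match_cells A A' x \in A' by move=> xA; rewrite match_cells_mem.
rewrite -!sc // => lts; rewrite ltnNge leq_eqVlt; apply/negP=> /orP[/eqP e|ge].
  by rewrite (val_inj e) ltnn in lts.
by have := scount_ltE (sA i iA) ge; lia.
Qed.

Lemma match_cells_monoC A A' : #|A| = #|A'| ->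
  {in ~: A &, forall i j, (i < j)%N -> (match_cells A A' i < match_cells A A' j)%N}.
Proof.
move=> eA i j; rewrite !inE => iA jA lt; have jA' : j \in ~: A by rewrite inE.
have := scount_ltE jA' lt.
have sc x : x \notin A -> scount (match_cells A A' x) (~: A') = scount x (~: A).
  by move=> xA; have := hook_content_match_cells x eA; rewrite /hook_content match_cells_mem // (negbTE xA); lia.
have sA x : x \notin A -> match_cells A A' x \in ~: A' by move=> xA; rewrite inE match_cells_mem.
rewrite -!sc // => lts; rewrite ltnNge leq_eqVlt; apply/negP=> /orP[/eqP e|ge].
  by rewrite (val_inj e) ltnn in lts.
by have := scount_ltE (sA i iA) ge; lia.
Qed.
End Cells.

Section Fillings.
Context (n m : nat) (hm : (1 <= m <= n)%N).
Local Notation N := n.+1.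
Implicit Types (E F : {set 'I_N}) (i j x y : 'I_N) (w : 'S_N) (alpha beta lambda : 'X_{1..N}).

Lemma leg_card k E F : E \in EE N m k -> F \in EE N m k -> #|leg k E| = #|leg k F|.
Proof. by rewrite !EE_leg // => /andP[/eqP -> _] /andP[/eqP ->]. Qed.

Definition match_labels k E F : 'S_N := match_cells (leg k E) (leg k F).

Lemma match_labels_imset k E F : E \in EE N m k -> F \in EE N m k -> match_labels k E F @: E = F.
Proof.
move=> hE hF; rewrite -[in RHS](legK k F) -(match_cells_imset (leg_card hE hF)) -/(match_labels k E F).
by rewrite leg_imset legK.
Qed.

Lemma match_labels_content k E F x : E \in EE N m k -> F \in EE N m k ->
  content k (match_labels k E F x) F = content k x E.
Proof. by move=> hE hF; rewrite !content_leg hook_content_match_cells //; apply: leg_card. Qed.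

Lemma match_labels_uniq k E w : E \in EE N m k -> w @: E \in EE N m k ->
  (forall x, content k (w x) (w @: E) = content k x E) -> match_labels k E (w @: E) = w.
Proof.
move=> hE hF hw; apply/permP=> x; apply: (@content_inj _ k (w @: E)).
by rewrite hw match_labels_content.
Qed.

(** The corner cell is listed in both lines of a tableau, but its second occurrence adds
    no condition. *)
Lemma filling_eqE k alpha beta E F : E \in EE N m k -> F \in EE N m k ->
  (filling k alpha F == filling k beta E) =
  [forall x, aplus alpha (match_labels k E F x) == aplus beta x].
Proof.
move=> hE hF; have cA := leg_card hF hE.
have cAC : #|~: leg k F| = #|~: leg k E|.
  by have := cardsC (leg k F); have := cardsC (leg k E); lia.
set a := aplus alpha; set b := aplus beta.
have -> : (filling k alpha F == filling k beta E)
   = (map a (rev (enum (leg k F))) == map b (rev (enum (leg k E))))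
     && (map a (rev (enum (~: leg k F))) == map b (rev (enum (~: leg k E)))).
  have t1 G : size (take 1 (rev (enum (leg k G)))) = (0 < #|leg k G|)%N :> nat.
    by rewrite size_take size_rev -cardE; case: (#|_|) => [|[|c]].
  have key : (map a (take 1 (rev (enum (leg k F))) ++ rev (enum (~: leg k F)))
        == map b (take 1 (rev (enum (leg k E))) ++ rev (enum (~: leg k E))))
      && (map a (rev (enum (leg k F))) == map b (rev (enum (leg k E))))
    = (map a (rev (enum (leg k F))) == map b (rev (enum (leg k E))))
     && (map a (rev (enum (~: leg k F))) == map b (rev (enum (~: leg k E)))).
    rewrite andbC; case: eqP => //= e; rewrite !map_cat eqseq_cat; last by rewrite !size_map !t1 cA.
    by rewrite !map_take e eqxx.
  rewrite -key /filling xpair_eqE /tableau; case: (k) => //=.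
    by rewrite !setCK andbC.
apply/andP/forallP => [[/eqP /(map_rev_enumP _ _ cA) e1 /eqP /(map_rev_enumP _ _ cAC) e2] x|h].
  apply/eqP; have := hook_content_match_cells x (esym cA); have := match_cells_mem x (esym cA); rewrite -/(match_labels k E F).
  case: (boolP (x \in leg k E)) => xE yF; rewrite /hook_content yF ?xE ?(negbTE xE) => ec.
    by apply: e1 => //; lia.
  by apply: e2; rewrite ?inE ?yF //; lia.
have sgx i j : hook_content (leg k F) i = hook_content (leg k E) j -> a i = b j.
  move=> ec; rewrite -(eqP (h j)); congr (a _).
  by apply: (@hook_content_inj _ (leg k F)); rewrite ec /match_labels hook_content_match_cells.
split; apply/eqP; apply/map_rev_enumP => // i j.
  by move=> iF jE ec; apply: sgx; rewrite /hook_content iF jE ec.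
rewrite !inE => iF jE ec; apply: sgx.
by rewrite /hook_content (negbTE iF) (negbTE jE) ec.
Qed.

(** The entries of a filling determine the partition of which they are the parts. *)
Lemma filling_partition k alpha lambda E F : E \in EE N m k -> F \in EE N m k ->
  (forall i j, (i <= j)%N -> (lambda j <= lambda i)%N) ->
  (filling k alpha F == filling k lambda E)
   = (aplus alpha == lambda) && [forall x, lambda (match_labels k E F x) == lambda x].
Proof.
move=> hE hF dec; rewrite filling_eqE // (aplus_nonincr dec).
apply/forallP/andP => [h|[/eqP -> /forallP //]].
suff e : aplus alpha = lambda.
  by rewrite e eqxx; split=> //; apply/forallP=> x; rewrite -{1}e; apply: h.
have e1 : mperm (aplus alpha) (match_labels k E F) = lambda.
  by apply/mnmP=> x; rewrite mnmE; apply/eqP/h.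
have nonincr := @aplus_nonincreasing _ alpha.
by rewrite -(aplus_nonincr nonincr) -(aplus_perm _ (match_labels k E F)) e1 aplus_nonincr.
Qed.
End Fillings.

(** * Levels and classes of labels at the root and the sink *)

Lemma uniq_map_inj (S T : eqType) (h : S -> T) (s : seq S) :
  uniq (map h s) -> {in s &, injective h}.
Proof.
elim: s => //= a s IHs /andP[na us] x y; rewrite !inE.
case/orP=> [/eqP ->|xs]; case/orP=> [/eqP ->|ys] e //.
- by case/negP: na; rewrite e map_f.
- by case/negP: na; rewrite -e map_f.
- exact: IHs.
Qed.

Section RootSink.
Context (n m : nat) (hm : (1 <= m <= n)%N) (k : bool) (lambda : 'X_{1..n.+1}).
Local Notation N := n.+1.
Hypothesis dec : forall i j : 'I_N, (i <= j)%N -> (lambda j <= lambda i)%N.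
Implicit Types (A E F : {set 'I_N}) (i j x y a b p q : 'I_N) (w : 'S_N).

Lemma level_lt a b : (lambda b < lambda a)%N -> (a < b)%N.
Proof. by move=> h; rewrite ltnNge; apply/negP=> /dec; rewrite leqNgt h. Qed.

Lemma level_between a x b : lambda a = lambda b -> (a <= x)%N -> (x <= b)%N -> lambda x = lambda a.
Proof. by move=> e /dec h1 /dec h2; apply/eqP; rewrite eqn_leq h1 e h2. Qed.

Lemma exists_adjacent (P : pred 'I_N) a b : (a < b)%N -> P a -> ~~ P b ->
  exists i j, [/\ j = i.+1 :> nat, (a <= i)%N, (j <= b)%N, P i & ~~ P j].
Proof.
have [d] := ubnP (b - a); elim: d => // d IHd in a *; rewrite ltnS => hd lt Pa Pb.
have hlt : (a.+1 < N)%N by apply: leq_ltn_trans lt _.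
pose c : 'I_N := Ordinal hlt.
have [Pc|Pc] := boolP (P c); last by exists a, c.
have ltc : (c < b)%N.
  rewrite ltn_neqAle lt andbT; apply: contraTneq Pc => e.
  by have -> : c = b by apply: val_inj.
have [|i [j [h1 h2 h3 h4 h5]]] := IHd c _ ltc Pc Pb; first by rewrite /=; lia.
by exists i, j; split=> //; apply: leq_trans h2; rewrite /= leqnSn.
Qed.

Lemma inv_leg E : Defs.inv E = if k then inversions (~: leg k E) else inversions (leg k E).
Proof.
rewrite /Defs.inv /inversions /leg; case: (k); rewrite ?setCK.
  by apply: eq_card => -[a b]; rewrite !inE /= andbA andbC.
by apply: eq_card => -[a b]; rewrite !inE /= andbA andbC.
Qed.

(** Exchanging two adjacent labels at which [lambda] takes the same value changes no
    entry of the filling. *)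
Lemma same_filling_step E F i j : E \in EE N m k -> F \in same_filling m k lambda E ->
  j = i.+1 :> nat -> j != ord_max -> (i \in leg k F) != (j \in leg k F) -> lambda i = lambda j ->
  tperm i j @: F \in same_filling m k lambda E.
Proof.
move=> hE; rewrite !inE => /andP[hF hfill] ij jmax ne el.
have hF' := EE_tperm hm hF ij jmax.
rewrite hF' /=; move: hfill; rewrite !(filling_partition hm) // => /andP[-> /forallP h] /=.
apply/forallP=> x; set y := match_labels k E F x.
have -> : match_labels k E (tperm i j @: F) x = tperm i j y.
  apply: (@content_inj _ k (tperm i j @: F)); rewrite (match_labels_content hm) //.
  by rewrite [RHS]content_leg leg_imset hook_content_tperm // -content_leg (match_labels_content hm).
rewrite -(eqP (h x)) -/y; apply/eqP.
by case: tpermP => [->|->|].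
Qed.

Lemma same_filling_refl E : E \in EE N m k -> E \in same_filling m k lambda E.
Proof. by move=> hE; rewrite inE hE eqxx. Qed.

Section Root.
Context (E : {set 'I_N}) (hE : E \in EE N m k).

Lemma root_set_in : root_set m k lambda E \in same_filling m k lambda E.
Proof.
by rewrite /root_set; case: (k) (same_filling_refl hE) => h; [case: arg_maxnP | case: arg_minnP].
Qed.

Lemma sink_set_in : sink_set m k lambda E \in same_filling m k lambda E.
Proof.
by rewrite /sink_set; case: (k) (same_filling_refl hE) => h; [case: arg_minnP | case: arg_maxnP].
Qed.

Lemma root_set_min F : F \in same_filling m k lambda E ->
  if k then (Defs.inv F <= Defs.inv (root_set m k lambda E))%N
  else (Defs.inv (root_set m k lambda E) <= Defs.inv F)%N.
Proof.
move=> hF; have h0 := same_filling_refl hE; rewrite /root_set; case: (k) h0 hF => h0 hF.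
  by case: arg_maxnP => // G _; apply.
by case: arg_minnP => // G _; apply.
Qed.

Lemma sink_set_max F : F \in same_filling m k lambda E ->
  if k then (Defs.inv (sink_set m k lambda E) <= Defs.inv F)%N
  else (Defs.inv F <= Defs.inv (sink_set m k lambda E))%N.
Proof.
move=> hF; have h0 := same_filling_refl hE; rewrite /sink_set; case: (k) h0 hF => h0 hF.
  by case: arg_minnP => // G _; apply.
by case: arg_maxnP => // G _; apply.
Qed.

(** Otherwise two adjacent labels of the level would be inverted, and exchanging them
    would contradict the extremality of the root. *)
Lemma root_order a b : (a < b)%N -> lambda a = lambda b ->
  a \in leg k (root_set m k lambda E) -> b \in leg k (root_set m k lambda E).
Proof.
move=> lt el; set G := root_set m k lambda E; have hG : G \in same_filling m k lambda E.
  exact: root_set_in.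
move=> aA; apply: contraT => bA.
have [i [j [ij ai jb iA jA]]] := exists_adjacent (P := fun x => x \in leg k G) lt aA bA.
have hGE : G \in EE N m k by move: hG; rewrite inE => /andP[].
have jmax : j != ord_max by apply: contraNneq jA => ->; apply: leg_corner hGE.
have eij : lambda i = lambda j.
  rewrite (level_between el ai); last by apply: leq_trans jb; rewrite ij.
  by rewrite (level_between el _ jb) //; apply: leq_trans ai _; rewrite ij.
have hF : tperm i j @: G \in same_filling m k lambda E.
  by apply: same_filling_step => //; rewrite iA (negbTE jA).
have := root_set_min hF; rewrite -/G !inv_leg !leg_imset -imset_permC.
(* For [k = 1] the set [E] is the arm, and the exchange gives it one more inversion. *)
case: (k) iA jA => iA jA.
  have := @inversions_step _ (tperm i j @: (~: leg true G)) i j ij.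
  rewrite tperm_imsetK !tperm_mem tpermL tpermR [j \in ~: _]in_setC [i \in ~: _]in_setC.
  rewrite negbK iA jA => /(_ isT isT).
  by rewrite ltnNge => /negbTE ->.
by have := inversions_step ij iA jA; rewrite ltnNge => /negbTE ->.
Qed.

(** As for the root, with the opposite extremum; the label N of the corner is an exception
    because it cannot be exchanged. *)
Lemma sink_order a b : (a < b)%N -> lambda a = lambda b ->
  a \notin leg k (sink_set m k lambda E) -> b \in leg k (sink_set m k lambda E) -> b = ord_max.
Proof.
move=> lt el; set G := sink_set m k lambda E; have hG : G \in same_filling m k lambda E.
  exact: sink_set_in.
move=> aA bA; apply/eqP; apply: contraT => bmax.
have bA' : ~~ (b \notin leg k G) by rewrite negbK.
have [i [j [ij ai jb iA jA]]] := exists_adjacent (P := fun x => x \notin leg k G) lt aA bA'.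
rewrite negbK in jA; have hGE : G \in EE N m k by move: hG; rewrite inE => /andP[].
have jmax : j != ord_max by apply: (@lt_neq_max _ j ord_max); apply: leq_ltn_trans jb _; apply: lt_ord_max.
have eij : lambda i = lambda j.
  rewrite (level_between el ai); last by apply: leq_trans jb; rewrite ij.
  by rewrite (level_between el _ jb) //; apply: leq_trans ai _; rewrite ij.
have hF : tperm i j @: G \in same_filling m k lambda E.
  by apply: same_filling_step => //; rewrite (negbTE iA) jA.
have := sink_set_max hF; rewrite -/G !inv_leg !leg_imset -imset_permC.
case: (k) iA jA => iA jA.
  have := @inversions_step _ (~: leg true G) i j ij.
  rewrite [j \in ~: _]in_setC [i \in ~: _]in_setC negbK iA jA => /(_ isT isT).
  by rewrite ltnNge => /negbTE ->.
have := @inversions_step _ (tperm i j @: leg false G) i j ij.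
rewrite tperm_imsetK !tperm_mem tpermL tpermR.
by rewrite iA jA => /(_ isT isT); rewrite ltnNge => /negbTE ->.
Qed.
End Root.

Section Geometry.
Context (E : {set 'I_N}) (hE : E \in EE N m k) (hcs : column_strict k lambda E).
Hypothesis hroot : forall a b, (a < b)%N -> lambda a = lambda b ->
  a \in leg k E -> b \in leg k E.
Local Notation A := (leg k E).

(** The labels of the cells of column 1 below the corner. Call [lambda p] the level of [p]:
    column strictness says that the special labels and the corner have distinct levels. *)
Definition special p : bool := if k then p \notin A else (p \in A) && (p != ord_max).

Lemma special_corner : special ord_max = false.
Proof. by have := leg_corner hm hE; rewrite /special; case: (k) => -> //; rewrite eqxx. Qed.

Lemma column_injective p q : special p || (p == ord_max) -> special q || (q == ord_max) ->
  lambda p = lambda q -> p = q.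
Proof.
move: hcs; rewrite /column_strict /filling /= (aplus_nonincr dec) => h hp hq el.
have hmem x : special x || (x == ord_max) -> x \in (tableau k E).2.
  rewrite /special /tableau; have := leg_corner hm hE; rewrite /leg; case: (k) => /= hmax.
    rewrite mem_cat inE negbK => /orP[xE|/eqP ->].
      by rewrite [x \in rev (enum E)]mem_rev mem_enum xE orbT.
    have sc : scount (ord_max : 'I_N) (~: E) = 0%N.
      by have := hook_content_corner hmax; rewrite /hook_content hmax; lia.
    have := nth_rev_enum ord0 hmax; rewrite sc.
    have : ord_max \in rev (enum (~: E)) by rewrite mem_rev mem_enum.
    by case: (rev (enum (~: E))) => //= c s _ ->; rewrite take0 inE eqxx.
  by case/orP=> [/andP[xA _]|/eqP ->]; rewrite mem_rev mem_enum.
exact: (uniq_map_inj h (hmem p hp) (hmem q hq) el).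
Qed.

Lemma special_level p q : special p -> special q -> lambda p = lambda q -> p = q.
Proof. by move=> hp hq; apply: column_injective; rewrite ?hp ?hq. Qed.

Lemma special_not_corner p : special p -> lambda p <> lambda ord_max.
Proof.
move=> hp /column_injective; rewrite hp eqxx orbT => /(_ isT isT) e.
by rewrite e special_corner in hp.
Qed.

(** By [hroot] the labels of the leg come last in each level, and the special label of a
    level belongs to the leg for [k = 0] and to the arm for [k = 1]. *)
Lemma special_order a b : (a < b)%N -> lambda a = lambda b ->
  if k then ~~ special b else ~~ special a.
Proof.
move=> lt el; have hr := hroot lt el; have bmax := lt_neq_max lt.
have nab : a != b by apply: contraTneq lt => ->; rewrite ltnn.
move: (@special_level a b) (@special_not_corner a) hr; rewrite /special.
case: (k) => /= sp nc hr.
  apply/negP=> sb; move: nab; rewrite (sp _ sb el) ?eqxx //.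
  by apply: contra sb.
apply/negP=> sa; have bA : b \in leg false E by apply: hr; case/andP: sa.
have [eb|nb] := eqVneq b ord_max; first by apply: (nc sa); rewrite el eb.
by move: nab; rewrite (sp sa _ el) ?eqxx // bA nb.
Qed.

(** The classes will turn out to be the orbits of the stabiliser of [lambda] and [T E]: it
    permutes the labels of a level freely, except that it fixes the special one. *)
Definition level_class p : nat * bool := (lambda p, special p).

(** Two cells of column 1 cannot have the same level. *)
Lemma same_leg_class a b : (a < b)%N -> lambda a = lambda b -> (a \in A) = (b \in A) ->
  level_class a = level_class b.
Proof.
move=> lt el ea; rewrite /level_class el; congr pair.
have amax := lt_neq_max lt; have nab : a <> b by move=> e; rewrite e ltnn in lt.
move: (@special_level a b) (@special_not_corner a); rewrite /special.
case: (k) ea => ea sp nc; first by rewrite ea.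
move: ea sp nc; rewrite amax andbT; case: (b \in leg false E) => -> //= sp nc.
have [eb|nb] := eqVneq b ord_max; first by case: (nc isT); rewrite el eb.
by case: nab; apply: sp.
Qed.

(** For [k = 0] the corner belongs to the leg without being special, so it joins the
    labels of row 1 with the same level. *)
Lemma class_leg a b : (a < b)%N -> level_class a = level_class b ->
  (a \in A) = (b \in A) \/ a \notin A /\ b = ord_max /\ k = false.
Proof.
move=> lt; have amax := lt_neq_max lt.
rewrite /level_class /special => -[_]; case: (k) => [/negb_inj ->|]; first by left.
rewrite amax andbT => ->; case: (eqVneq b ord_max) => [->|nb]; last by left; rewrite andbT.
by right; rewrite andbF; split=> //; rewrite andbF.
Qed.

(** A class with more than one element consists of adjacent cells of row 1, where the
    labels decrease from left to right. *)
Lemma class_content i j : j = i.+1 :> nat -> level_class i = level_class j ->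
  content k i E = content k j E + 1.
Proof.
move=> ij e; have lt : (i < j)%N by rewrite ij.
have [el es] : lambda i = lambda j /\ special i = special j by case: e.
have ns : ~~ special j.
  apply/negP=> sj; have si : special i by rewrite es.
  by have := special_level si sj el => eij; rewrite eij ltnn in lt.
rewrite !content_leg; case: (class_leg lt e) => [eA|[iA [jmax k0]]].
  rewrite (hook_content_succ ij eA); have imax := lt_neq_max lt.
  move: ns (es); rewrite /special imax andbT eA.
  case: (k) => /=; first by rewrite negbK => -> _; rewrite expr1; lia.
  by case: (j \in leg false E) => /= [ns' e'|_ _]; [rewrite -e' in ns' | rewrite expr0; lia].
rewrite k0 expr0 !mul1r jmax hook_content_corner; last by rewrite -k0; apply: leg_corner hE.
rewrite /hook_content; move: iA; rewrite k0 => /negbTE ->.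
have -> : scount i (~: leg false E) = 0%N; last by [].
apply/eqP; rewrite cards_eq0; apply/eqP/setP=> x; rewrite !inE; apply/negP=> /andP[xA lx].
case/negP: xA; have -> : x = ord_max.
  by apply: val_inj => /=; have := ltn_ord x; move: ij; rewrite jmax /=; lia.
by rewrite -k0; apply: leg_corner hE.
Qed.

(** A level contains at most one special label, and the side on which it stands is
    determined by [k]. *)
Lemma class_block a b i j : j = i.+1 :> nat -> (a < b)%N ->
  level_class a = level_class j -> level_class b = level_class i ->
  level_class i = level_class j.
Proof.
move=> ij lt [ela esa] [elb esb]; have el : lambda i = lambda j.
  apply/eqP; rewrite eqn_leq; apply/andP; split; last by apply: dec; rewrite ij.
  by rewrite -elb -ela; apply/dec/ltnW.
rewrite /level_class el; congr pair.
have lij : (i < j)%N by rewrite ij.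
have := special_order lt (etrans ela (etrans (esym el) (esym elb))).
have := special_order lij el; rewrite esa esb.
case: (special i); case: (special j) => //; by case: (k).
Qed.

(** Levels are intervals because [lambda] is nonincreasing, and a special label stands at
    an end of its level. *)
Lemma class_between a x b : (a <= x)%N -> (x <= b)%N ->
  level_class a = level_class b -> level_class x = level_class a.
Proof.
move=> ax xb e; have [el es] : lambda a = lambda b /\ special a = special b by case: e.
have [->//|nax] := eqVneq x a; have [->//|nxb] := eqVneq x b.
have lax : (a < x)%N by rewrite ltn_neqAle ax andbT eq_sym; move: nax; rewrite -val_eqE.
have lxb : (x < b)%N by rewrite ltn_neqAle xb andbT; move: nxb; rewrite -val_eqE.
have elx := level_between el ax xb; rewrite /level_class elx; congr pair.
have h1 := special_order lax (esym elx); have h2 := special_order lxb (etrans elx el).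
have h3 := special_order (ltn_trans lax lxb) el.
case: (k) h1 h2 h3 => h1 h2 h3; first by rewrite es (negbTE h1) (negbTE h2).
by rewrite (negbTE h1) (negbTE h2).
Qed.

Lemma class_step (K : 'I_N -> nat) :
  (forall i j, j = i.+1 :> nat -> level_class i = level_class j -> (K i < K j)%N) ->
  forall a b, (a < b)%N -> level_class a = level_class b -> (K a < K b)%N.
Proof.
move=> hK a b; have [d] := ubnP (b - a); elim: d => // d IHd in b *; rewrite ltnS => hd lt e.
have lt' : (b.-1 < N)%N by rewrite (leq_ltn_trans (leq_pred _)).
pose c := Ordinal lt'; have ec : b = c.+1 :> nat by rewrite /= prednK // (leq_trans _ lt).
have ac : (a <= c)%N by rewrite /= -ltnS prednK // (leq_trans _ lt).
have ecls : level_class c = level_class a by apply: (@class_between _ c b) => //; rewrite ec.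
have ltcb : (K c < K b)%N by apply: hK => //; rewrite ecls.
have [<-//|nac] := eqVneq c a; apply: ltn_trans ltcb; apply: IHd => //.
  by move: hd lt; rewrite /=; lia.
by rewrite ltn_neqAle ac andbT eq_sym; move: nac; rewrite -val_eqE.
Qed.
End Geometry.
End RootSink.

(** * Products over the orderings of the cells *)

Section Weights.
Context (R : realFieldType) (n m : nat) (hm : (1 <= m <= n)%N) (kappa : R).
Local Notation N := n.+1.
Hypothesis hkappa : generic N kappa.
Context (k : bool) (lambda : 'X_{1..N}).
Hypothesis dec : forall i j : 'I_N, (i <= j)%N -> (lambda j <= lambda i)%N.
Context (E : {set 'I_N}) (hE : E \in EE N m k) (hcs : column_strict k lambda E).
Hypothesis hroot : forall a b : 'I_N, (a < b)%N -> lambda a = lambda b ->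
  a \in leg k E -> b \in leg k E.
Local Notation A := (leg k E).
Implicit Types (F G : {set 'I_N}) (i j x y a b : 'I_N) (w u : 'S_N).
Implicit Types (p : 'I_N * 'I_N) (alpha : 'X_{1..N}).

(** The variables of the antisymmetrisation identity. In these coordinates the factors of
    [R_z] and, within a level, those of [C_z] have the form [1 +- kappa / (z_p - z_q)]. *)
Definition cell_coord x : R := (lambda x)%:R + kappa * (content k x E)%:~R.

Lemma cell_coord_diff x y : cell_coord x - cell_coord y
  = ((lambda x)%:Z - (lambda y)%:Z)%:~R + kappa * (content k x E - content k y E)%:~R.
Proof. by rewrite /cell_coord !intrB -!pmulrn; ring. Qed.

Lemma cell_coord_inj x y : cell_coord x = cell_coord y -> x = y.
Proof.
clear hcs; move/eqP; rewrite -subr_eq0 cell_coord_diff => e; apply: (@content_inj _ k E); apply/eqP.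
rewrite -subr_eq0; apply: contraTT e => ne; apply: (generic_neq hkappa); first by rewrite ne orbT.
by have := content_bound hm x y hE hE; lia.
Qed.

Definition hook_factor p : R := 1 + kappa / (cell_coord p.1 - cell_coord p.2).

(** Within a level [kappa] cancels. *)
Lemma hook_factor_level p : lambda p.1 = lambda p.2 -> hook_factor p = Cfactor R k 0 E p.
Proof.
move=> el; rewrite /hook_factor /Cfactor cell_coord_diff el subrr add0r expr0 div1r invfM mulrA.
by rewrite divff ?mul1r // (kappa_neq0 hkappa).
Qed.

Lemma hook_factor_level_sym p : lambda p.1 = lambda p.2 ->
  hook_factor (p.2, p.1) = Cfactor R k 1 E p.
Proof.
move=> el; rewrite hook_factor_level // /Cfactor /= expr0 expr1 mulN1r div1r.
by rewrite -[in RHS]invrN -intrN opprB.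
Qed.

(** An ordering [v] puts the cell with label [p] in position [v p]; it selects one of the
    two factors of every pair of cells. *)
Definition word_product (v : 'I_N -> 'I_N) : R :=
  \prod_(p : 'I_N * 'I_N | (v p.1 < v p.2)%N) hook_factor p.

(** [young_identity] for the full symmetric group. *)
Lemma word_product_sum : \sum_(u : 'S_N) word_product u^-1%g = N`!%:R.
Proof.
have := @young_identity R N bool (fun _ => true) cell_coord (fun i j _ => @cell_coord_inj i j) kappa.
move=> yi; rewrite -(card_Sn N).
have yT w : young (fun _ : 'I_N => true) w by apply/youngP.
have -> : #|'S_N| = #|[set w : 'S_N | young (fun _ : 'I_N => true) w]|.
  by apply: eq_card => w; rewrite !inE yT.
rewrite -yi; apply: eq_big => [w|w _]; first by rewrite yT.
rewrite /word_product (reindex_inj (@pair_map_inj _ w)) /=.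
by apply: eq_big => [p|p _]; rewrite /fibre_pair ?andbT /= ?permK.
Qed.

Section Pair.
Context (alpha : 'X_{1..N}) (F : {set 'I_N}) (hF : F \in EE N m k).
Context (hal : aplus alpha = lambda) (s : 'S_N).
Hypothesis hs : forall x, content k (s x) F = content k x E.
Hypothesis hls : forall x, lambda (s x) = lambda x.
Local Notation v := (s * (rperm alpha)^-1)%g.

Lemma cell_order_alpha x : alpha (v x) = lambda x.
Proof. by rewrite permM -aplus_rperm hal permKV hls. Qed.

Lemma cell_order_level x y : lambda x = lambda y -> (v x < v y)%N = (s x < s y)%N.
Proof.
move=> el; have key a b : alpha a = alpha b -> (a < b)%N -> (rperm alpha a < rperm alpha b)%N.
  by move=> e lt; apply: rperm_lt; rewrite e eqxx lt orbT.
have sv z : s z = rperm alpha (v z) by rewrite permM permKV.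
have ea : alpha (v x) = alpha (v y) by rewrite !cell_order_alpha.
rewrite !sv; apply/idP/idP => [|h]; first exact: key.
rewrite ltnNge leq_eqVlt; apply/negP=> /orP[/eqP/val_inj e|h']; first by rewrite e ltnn in h.
by have := key _ _ (esym ea) h'; rewrite ltnNge ltnW.
Qed.

(** The inversions [alpha_i < alpha_j] are the pairs of cells of different levels that [v]
    puts in the wrong order. *)
Lemma Rprod_cells z : Rprod kappa k z alpha F
  = \prod_(p : 'I_N * 'I_N | (v p.1 < v p.2)%N && (lambda p.1 < lambda p.2)%N)
      (1 + (-1) ^+ z * kappa / (cell_coord p.2 - cell_coord p.1)).
Proof.
rewrite Rprod_pair (reindex_inj (@pair_map_inj _ v)) /=.
apply: eq_big => [p|p /andP[_]]; rewrite /= !cell_order_alpha // => lt.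
have rc x : ranked_content k alpha F (v x) = content k x E.
  by rewrite /ranked_content [in LHS]permM permKV hs.
rewrite !rc cell_coord_diff natrB ?(ltnW lt) //; congr (1 + _ / (_ + _)).
by rewrite intrB -!pmulrn.
Qed.

(** Numerator and denominator of [(z_q - z_p +- kappa) / (z_q - z_p)] are both nonzero by
    genericity. *)
Lemma Rprod_factor_neq0 z p : (lambda p.1 < lambda p.2)%N ->
  1 + (-1) ^+ z * kappa / (cell_coord p.2 - cell_coord p.1) != 0.
Proof.
clear hcs hF; move=> lt; have hb := content_bound hm p.2 p.1 hE hE.
have hd : cell_coord p.2 - cell_coord p.1 != 0.
  by rewrite cell_coord_diff; apply: (generic_neq hkappa); [apply/orP; left; lia | lia].
have [e [-> he]] : exists e : int, (-1 : R) ^+ z = e%:~R /\ `|e| = 1.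
  by exists ((-1) ^+ z); rewrite rmorphXn rmorphN1 normrX normrN1 expr1n.
have -> : 1 + e%:~R * kappa / (cell_coord p.2 - cell_coord p.1)
    = (cell_coord p.2 - cell_coord p.1 + e%:~R * kappa) / (cell_coord p.2 - cell_coord p.1).
  by rewrite mulrDl divff.
rewrite mulf_neq0 ?invr_eq0 // cell_coord_diff -addrA [e%:~R * _]mulrC -mulrDr -intrD.
by apply: (generic_neq hkappa); [apply/orP; left; lia | lia].
Qed.

Lemma Rprod_neq0 z : Rprod kappa k z alpha F != 0.
Proof. by rewrite Rprod_cells; apply/prodf_neq0 => p /andP[_ lt]; apply: Rprod_factor_neq0. Qed.

(** The factors of [word_product v] for pairs of cells in one level. *)
Definition level_product : R :=
  \prod_(p : 'I_N * 'I_N | (s p.1 < s p.2)%N && (lambda p.1 == lambda p.2)) hook_factor p.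

Definition cross_product : R :=
  \prod_(p : 'I_N * 'I_N | (lambda p.2 < lambda p.1)%N) hook_factor p.

(** A pair of cells of different levels contributes to [cross_product] the same factor as
    to the word if it is in order; otherwise its factor in the word belongs to [R_1] and its
    factor in [cross_product] to [R_0]. *)
Lemma word_product_cells :
  word_product v * Rprod kappa k 0 alpha F = cross_product * Rprod kappa k 1 alpha F * level_product.
Proof.
rewrite /word_product (bigID (fun p => lambda p.1 == lambda p.2)) /=.
have -> : \prod_(p | (v p.1 < v p.2)%N && (lambda p.1 == lambda p.2)) hook_factor p = level_product.
  by apply: eq_bigl => p; case: eqP => [e|]; rewrite ?andbF // cell_order_level.
rewrite (bigID (fun p => lambda p.2 < lambda p.1)%N) /=.
have -> : \prod_(p | (v p.1 < v p.2)%N && (lambda p.1 != lambda p.2)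
      && ~~ (lambda p.2 < lambda p.1)%N) hook_factor p = Rprod kappa k 1 alpha F.
  rewrite Rprod_cells; apply: eq_big => [p|p _].
    by rewrite -andbA; congr (_ && _); rewrite -leqNgt ltn_neqAle.
  by rewrite /hook_factor expr1 -[cell_coord p.1 - _]opprB invrN mulrN mulN1r mulNr.
rewrite /cross_product [in RHS](bigID (fun p => v p.1 < v p.2)%N) /=.
have -> : \prod_(p | (lambda p.2 < lambda p.1)%N && ~~ (v p.1 < v p.2)%N) hook_factor p
    = Rprod kappa k 0 alpha F.
  rewrite (reindex_inj (can_inj (@swap_pairK _ _))) Rprod_cells; apply: eq_big => [p|p _] /=.
    rewrite andbC -leqNgt; case: ltnP => lt; rewrite ?andbF // !andbT leq_eqVlt.
    by case: eqP => // /val_inj/perm_inj e; rewrite e ltnn in lt.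
  by rewrite /hook_factor /= expr0 mul1r.
have -> : \prod_(p | (v p.1 < v p.2)%N && (lambda p.1 != lambda p.2)
      && (lambda p.2 < lambda p.1)%N) hook_factor p
    = \prod_(p | (lambda p.2 < lambda p.1)%N && (v p.1 < v p.2)%N) hook_factor p.
  apply: eq_bigl => p; case: (ltnP (lambda p.2) (lambda p.1)) => h; rewrite ?andbF // andbT.
  by rewrite (gtn_eqF h) andbT.
ring.
Qed.

(** The part of [Cprod k z F] that depends on [F], transported to the labels of [E]. *)
Definition mixed_product z : R :=
  \prod_(p : 'I_N * 'I_N | [&& (s p.1 < s p.2)%N, p.1 \in A, p.2 \notin A
                            & lambda p.1 == lambda p.2]) Cfactor R k z E p.

Hypothesis sF : s @: E = F.
Hypothesis smono : {in A &, forall i j, (i < j)%N -> (s i < s j)%N}.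
Hypothesis smonoC : {in ~: A &, forall i j, (i < j)%N -> (s i < s j)%N}.

(** Pairs in different levels are ordered by their levels, in the same way for [E] and
    [F]; for pairs in one level, no label of the leg precedes one of the arm in [E]. *)
Lemma Cprod_cells z : Cprod R k z F = Cprod R k z E * mixed_product z.
Proof.
rewrite -{1}sF (Cprod_imset R hm z hE) ?sF //.
rewrite (bigID (fun p => lambda p.1 == lambda p.2)) /= mulrC; congr (_ * _); last first.
  by apply: eq_bigl => p; rewrite -!andbA.
rewrite (Cprod_leg R hm z hE); apply: eq_bigl => -[x y] /=.
case: (boolP (x \in A)) => xA; rewrite ?andbF //; case: (boolP (y \in A)) => yA; rewrite ?andbF //= !andbT.
case: (ltngtP (lambda x) (lambda y)) => h; rewrite ?andbF ?andbT.
- have -> : (s x < s y)%N = false.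
    by apply/negbTE; rewrite -leqNgt ltnW // (level_lt dec) // !hls.
  by apply/esym/negbTE; rewrite -leqNgt ltnW // (level_lt dec).
- by rewrite !(level_lt dec) // !hls.
- by apply/esym/negbTE/negP=> lt; have := hroot lt h xA; rewrite (negbTE yA).
Qed.

(** Pairs in one line are ordered alike for all [F]. A mixed pair contributes a factor of
    [C_0] if its label in the leg comes first and one of [C_1] otherwise; multiplication by
    [mixed_product 1] completes the latter to a product over all the mixed pairs. *)
Lemma level_product_cells : level_product * mixed_product 1
   = \prod_(p : 'I_N * 'I_N | [&& (p.1 < p.2)%N, (p.1 \in A) == (p.2 \in A)
                                & lambda p.1 == lambda p.2]) hook_factor p
     * mixed_product 0
     * \prod_(p : 'I_N * 'I_N | [&& p.1 \in A, p.2 \notin A & lambda p.1 == lambda p.2])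
      Cfactor R k 1 E p.
Proof.
rewrite /level_product (bigID (fun p => (p.1 \in A) == (p.2 \in A))) /= -!mulrA; congr (_ * _).
  apply: eq_bigl => -[x y] /=; rewrite -andbA [(_ == _) && _]andbC.
  case: (boolP (lambda x == lambda y)) => [/eqP el|]; rewrite ?andbF //= ?andbT.
  case: eqP => [eA|]; rewrite ?andbF // !andbT.
  have mono a b : (a \in A) = (b \in A) -> (a < b)%N -> (s a < s b)%N.
    by move=> e lt; case: (boolP (a \in A)) => aA; [apply: smono | apply: smonoC];
       rewrite ?inE -?e ?aA.
  apply/idP/idP; last exact: mono.
  move=> h; rewrite ltnNge leq_eqVlt; apply/negP=> /orP[/eqP/val_inj e|h'].
    by rewrite e ltnn in h.
  by have := mono _ _ (esym eA) h'; rewrite ltnNge ltnW.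
rewrite (bigID (fun p => p.1 \in A)) /= -mulrA; congr (_ * _).
  apply: eq_big => [[x y]|[x y] /andP[/andP[/andP[_ /eqP el] _] _]]; last by rewrite hook_factor_level.
  by rewrite /=; case: (x \in A); case: (y \in A); case: (_ < _)%N; case: (_ == _).
rewrite (reindex_inj (can_inj (@swap_pairK _ _))) /= [RHS](bigID (fun p => (s p.1 < s p.2)%N)) /= mulrC; congr (_ * _).
  by apply: eq_bigl => p; rewrite [RHS]andbC.
apply: eq_big => [[x y]|[x y] /andP[/andP[/andP[_ /eqP el] _] _]].
  rewrite /= -leqNgt [(s y <= s x)%N]leq_eqVlt; case: (boolP (s y == s x :> nat)) => [/eqP/val_inj/perm_inj ->|_].
    by rewrite ?ltnn /= ?eqxx; case: (_ \in A); rewrite ?andbF ?andbT.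
  by rewrite (eq_sym (lambda y)); case: (x \in A); case: (y \in A); case: (_ < _)%N; case: (_ == _).
by rewrite -hook_factor_level_sym.
Qed.

End Pair.
End Weights.

(** * The norm of the symmetric sum *)

Lemma aminus_perm n (lambda : 'X_{1..n.+1}) : exists s : 'S_n.+1, aminus lambda = mperm lambda s.
Proof.
have : perm_eq (sort leq lambda) lambda by rewrite perm_sort.
case/tuple_permP=> s e; exists s; apply/mnmP=> i.
by rewrite !mnmE e -tnth_nth tnth_mktuple mnm_tnth.
Qed.

Lemma aminus_nondecr n (lambda : 'X_{1..n.+1}) (i j : 'I_n.+1) : (i <= j)%N ->
  (aminus lambda i <= aminus lambda j)%N.
Proof.
move=> le; rewrite !mnmE.
have so : sorted leq (sort leq lambda) by apply: sort_sorted; apply: leq_total.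
by apply: (sorted_leq_nth leq_trans leqnn 0%N so) => //; rewrite inE size_sort size_tuple.
Qed.

Section Orthogonal.
Context (R : realFieldType) (N : nat) (kappa : R) (m : nat).
Context (B : superpoly R N -> superpoly R N -> R) (hB : is_form kappa m B).

Lemma form_orth_sum (I : finType) (P : pred I) (c : I -> R) (G : I -> superpoly R N) :
  (forall q, P q -> in_sP m (G q)) ->
  (forall q q', P q -> P q' -> q != q' -> B (G q) (G q') = 0) ->
  B (\sum_(q | P q) c q *: G q) (\sum_(q | P q) c q *: G q)
   = \sum_(q | P q) c q ^+ 2 * B (G q) (G q).
Proof.
move=> hG orth.
have hz q : P q -> in_sP m (c q *: G q) by move=> Pq; apply/in_sPZ/hG.
have hs : in_sP m (\sum_(q | P q) c q *: G q) by apply: in_sP_sum.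
rewrite (bform_suml hB) //; apply: eq_bigr => q Pq.
have hq := hz q Pq; have hGq := hG q Pq.
rewrite (form_sym hB) // (bform_suml hB) // (bigD1 q) //= big1 ?addr0 => [|q' /andP[Pq' ne]].
  by rewrite (bformZl hB) // (bformZr hB) // mulrA.
have hGq' := hG q' Pq'.
by rewrite (bformZl hB) // (bformZr hB) // orth // !mulr0.
Qed.
End Orthogonal.

Section SymmetricNorm.
Context (R : realFieldType) (n m : nat) (hm : (1 <= m <= n)%N) (kappa : R).
Local Notation N := n.+1.
Hypothesis hkappa : generic N kappa.
Context (k : bool) (lambda : 'X_{1..N}).
Hypothesis dec : forall i j : 'I_N, (i <= j)%N -> (lambda j <= lambda i)%N.
Context (E : {set 'I_N}) (hE : E \in EE N m k) (hcs : column_strict k lambda E).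
Hypothesis hroot : forall a b : 'I_N, (a < b)%N -> lambda a = lambda b ->
  a \in leg k E -> b \in leg k E.
Local Notation A := (leg k E).
Implicit Types (F G : {set 'I_N}) (i j x y a b : 'I_N) (w u : 'S_N).
Implicit Types (p : 'I_N * 'I_N) (alpha : 'X_{1..N}).

Local Notation cls := (level_class k lambda E).
Local Notation hfac := (hook_factor kappa k lambda E).
Local Notation gprod := (word_product kappa k lambda E).
Local Notation crossprod := (cross_product kappa k lambda E).
Definition root_level_product : R := level_product kappa k lambda E 1%g.

Let mono1 (S : {set 'I_N}) : {in S &, forall i j, (i < j)%N -> ((1%g : 'S_N) i < (1%g : 'S_N) j)%N}.
Proof. by move=> i j _ _; rewrite !perm1. Qed.

Lemma mixed_product1 z : mixed_product R k lambda E 1%g z = 1.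
Proof.
rewrite /mixed_product big_pred0 // => -[x y] /=; apply/negbTE; rewrite !perm1.
by apply/and4P=> -[lt xA yA /eqP el]; rewrite (hroot lt el xA) in yA.
Qed.

Definition same_leg_product : R :=
  \prod_(p : 'I_N * 'I_N | [&& (p.1 < p.2)%N, (p.1 \in A) == (p.2 \in A)
                                & lambda p.1 == lambda p.2]) hfac p.
Definition all_mixed_product : R :=
  \prod_(p : 'I_N * 'I_N | [&& p.1 \in A, p.2 \notin A & lambda p.1 == lambda p.2])
      Cfactor R k 1 E p.

Lemma root_level_product_cells : root_level_product = same_leg_product * all_mixed_product.
Proof.
have := level_product_cells hkappa lambda (s := 1%g) (@mono1 A) (@mono1 (~: A)).
by rewrite /root_level_product !mixed_product1 !mulr1 => ->.
Qed.

(** Up to factors that depend on the root only, the weight [(R_1 / R_0) (C_0 / C_1)] of a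
    pair is the product over the ordering of the cells that it defines. *)
Lemma pair_weight alpha F : F \in EE N m k -> aplus alpha = lambda ->
  (forall x, lambda (match_labels k E F x) = lambda x) ->
  gprod (match_labels k E F * (rperm alpha)^-1)%g
    * (Rprod kappa k 0 alpha F * Cprod R k 1 F * Cprod R k 0 E)
  = crossprod * root_level_product * (Rprod kappa k 1 alpha F * Cprod R k 0 F * Cprod R k 1 E).
Proof.
move=> hF hal hls; have hs x := match_labels_content hm x hE hF.
have cA := leg_card hm hE hF; have sF := match_labels_imset hm hE hF.
have sm := match_cells_mono cA; have smC := match_cells_monoC cA.
have e1 := word_product_cells kappa hal hs hls.
have e2 z := Cprod_cells R hm dec hE hroot hF hls sF sm smC z.
have e3 := level_product_cells hkappa lambda (s := match_labels k E F) sm smC.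
rewrite -/same_leg_product -/all_mixed_product in e3.
rewrite !e2 root_level_product_cells; move: e1 e3.
set g := gprod _; set l := level_product _ _ _ _ _; set M0 := mixed_product _ _ _ _ _ 0%N; set M1 := mixed_product _ _ _ _ _ 1%N.
set R0 := Rprod _ _ 0 _ _; set R1 := Rprod _ _ 1 _ _ => e1 e3.
transitivity (g * R0 * (Cprod R k 1 E * M1 * Cprod R k 0 E)); first by ring.
rewrite e1; transitivity (crossprod * R1 * (l * M1) * (Cprod R k 1 E * Cprod R k 0 E)); first by ring.
by rewrite e3; ring.
Qed.

Lemma aplus_aminus : aplus (aminus lambda) = lambda.
Proof. by have [s ->] := aminus_perm lambda; rewrite aplus_perm aplus_nonincr. Qed.

(** The nondecreasing rearrangement puts all the pairs of different levels in the wrong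
    order. *)
Lemma Rprod_aminus : Rprod kappa k 0 (aminus lambda) E = crossprod.
Proof.
have id1 x : content k ((1%g : 'S_N) x) E = content k x E by rewrite perm1.
have id2 x : lambda ((1%g : 'S_N) x) = lambda x by rewrite perm1.
rewrite (Rprod_cells kappa aplus_aminus id1 id2) (reindex_inj (can_inj (@swap_pairK _ _))) /=.
apply: eq_big => [p|p _] /=; last by rewrite expr0 mul1r.
rewrite andb_idl // => lt; rewrite ltnNge; apply/negP=> /(aminus_nondecr lambda).
by rewrite !(cell_order_alpha aplus_aminus id2) leqNgt lt.
Qed.

Lemma cross_product_neq0 : crossprod != 0.
Proof.
have id1 x : content k ((1%g : 'S_N) x) E = content k x E by rewrite perm1.
have id2 x : lambda ((1%g : 'S_N) x) = lambda x by rewrite perm1.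
by rewrite -Rprod_aminus (Rprod_neq0 hm hkappa hE aplus_aminus id1 id2).
Qed.

Definition class_product : R :=
  \prod_(p : 'I_N * 'I_N | (p.1 < p.2)%N && (cls p.1 == cls p.2)) hfac p.

(** [young_identity] for the classes, with the contents as variables. Contents decrease by 1
    along a class, so any [w] other than the identity has a factor [1 + 1 / (- 1)]. *)
Lemma class_product_card : class_product = #|[set w : 'S_N | young cls w]|%:R.
Proof.
pose z x : R := (content k x E)%:~R.
have z_inj i j : cls i = cls j -> z i = z j -> i = j.
  by move=> _ /eqP; rewrite eqr_int => /eqP; apply: content_inj.
(* All the terms but that of the identity vanish. *)
rewrite -(young_identity z_inj 1) (bigD1 1%g) /=; last by apply/youngP=> i; rewrite perm1.
rewrite [X in _ + X]big1 ?addr0 => [|w /andP[/youngP hw ne]].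
  apply: eq_bigr => p /andP[_ /eqP e]; rewrite !perm1 (hook_factor_level hkappa); last by case: e.
  by rewrite /Cfactor expr0 intrB.
have hwV x : cls (w^-1%g x) = cls x by rewrite -[in RHS](permKV w x) hw.
have [e|[i [j [ij lt]]]] := perm_descentP w^-1%g.
  by case/eqP: ne; apply: invg_inj; rewrite invg1.
have eij := class_block hm dec hE hcs hroot ij lt (hwV j) (hwV i).
have ec := class_content hm dec hE hcs hroot ij eij.
rewrite (bigD1 (w^-1%g j, w^-1%g i)) /=; last by rewrite /fibre_pair /= lt !hwV eij eqxx.
rewrite !permKV /z ec intrD; set c := _%:~R.
have -> : c - (c + 1%:~R) = -1 by ring.
by rewrite invrN1 mul1r addrN mul0r.
Qed.

(** A class lies in one line of the hook, except that for [k = 0] the corner may join a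
    class of row 1. *)
Lemma class_product_cells : class_product = same_leg_product
  * \prod_(y | (y \notin A) && (lambda ord_max == lambda y)) Cfactor R k 1 E (ord_max, y).
Proof.
rewrite /class_product (bigID (fun p => (p.1 \in A) == (p.2 \in A))) /=; congr (_ * _).
  apply: eq_bigl => -[x y] /=; case: (boolP (x < y)%N) => //= lt.
  case: (boolP ((x \in A) == (y \in A))) => [/eqP eA|_]; rewrite ?andbF ?andbT //=.
  apply/eqP/eqP => [[] //|el].
  exact: (same_leg_class hm dec hE hcs lt el eA).
rewrite [RHS](eq_bigr (fun y => hfac (y, ord_max))) => [|y /andP[_ /eqP el]]; last first.
  by rewrite -(@hook_factor_level_sym _ _ _ hkappa k lambda E (ord_max, y) el).
pose S := [set y | (y \notin A) && (lambda ord_max == lambda y)].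
rewrite [RHS](eq_bigl (fun y => y \in S)) => [|y]; last by rewrite inE.
have h_inj' : {in S &, injective (fun y : 'I_N => (y, ord_max : 'I_N))} by move=> x y _ _ [].
rewrite -(big_imset (fun p => hfac p) h_inj') /=; apply: eq_bigl => -[x y] /=.
apply/idP/imsetP => [/andP[/andP[lt /eqP e] ne]|[z]].
  case: (class_leg lt e) => [eA|[xA [ey _]]]; first by rewrite eA eqxx in ne.
  by exists x; rewrite ?ey // inE xA -ey; case: e => ->; rewrite eqxx.
rewrite inE => /andP[zA /eqP el] [-> ->].
have ltz : (z < (ord_max : 'I_N))%N.
  by apply: lt_ord_max; apply: contraNneq zA => ->; apply: (leg_corner hm hE).
rewrite ltz (leg_corner hm hE) (negbTE zA) /= andbT.
have szA : special k E z = k.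
  by move: zA; rewrite /special; case: (k) => // /negbTE ->.
have nk : k = false.
  apply/negP=> kT; have := special_not_corner hm dec hE hcs (p := z); rewrite szA kT.
  by move=> /(_ isT); rewrite el.
by rewrite /level_class el szA (special_corner hm hE) nk.
Qed.

(** In [F] all the mixed pairs of a level that avoid the corner have their label in the leg
    first, so they make up [C_1(F) / C_1(E)]. The mixed pairs with the corner complete the
    pairs in one line to the product over the classes. *)
Lemma root_level_product_sink F : F \in EE N m k ->
  (forall x, lambda (match_labels k E F x) = lambda x) ->
  (forall a b, (a < b)%N -> lambda a = lambda b -> a \notin leg k F -> b \in leg k F ->
    b = ord_max) ->
  root_level_product * Cprod R k 1 E = #|[set w : 'S_N | young cls w]|%:R * Cprod R k 1 F.
Proof.
move=> hF hls hsink; have cA := leg_card hm hE hF; have sF := match_labels_imset hm hE hF.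
rewrite (Cprod_cells R hm dec hE hroot hF hls sF (match_cells_mono cA) (match_cells_monoC cA) 1).
rewrite mulrCA mulrC; congr (_ * _).
rewrite -class_product_card class_product_cells.
rewrite root_level_product_cells -mulrA; congr (_ * _).
set s := match_labels k E F; have smem x : (s x \in leg k F) = (x \in A) by apply: match_cells_mem.
have smax : s ord_max = ord_max.
  apply: (@content_inj _ k F); rewrite (match_labels_content hm) // !content_leg !hook_content_corner //.
    exact: (leg_corner hm hF).
  exact: (leg_corner hm hE).
rewrite /all_mixed_product (bigID (fun p => p.1 == ord_max)) /=; congr (_ * _).
  pose S := [set y | (y \notin A) && (lambda ord_max == lambda y)].
  rewrite [RHS](eq_bigl (fun y => y \in S)) => [|y]; last by rewrite inE.
  have h_inj : {in S &, injective (fun y : 'I_N => (ord_max : 'I_N, y))} by move=> x y _ _ [].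
  rewrite -(big_imset (fun p => Cfactor R k 1 E p) h_inj) /=; apply: eq_bigl => -[x y] /=.
  apply/idP/imsetP => [/andP[/and3P[_ yA el] /eqP ex]|[z]].
    by exists y; rewrite ?ex // inE yA -ex.
  by rewrite inE => /andP[zA el] [-> ->]; rewrite eqxx (leg_corner hm hE) zA el.
(* Away from the corner every mixed pair of a level is in the order leg, arm. *)
apply: eq_bigl => -[x y] /=; rewrite -!andbA.
case: (boolP (x \in A)) => xA; rewrite ?andbF //=; case: (boolP (y \in A)) => yA; rewrite ?andbF //=.
case: (eqVneq (lambda x) (lambda y)) => el; rewrite ?andbF //= andbT.
have [ex|nx] := eqVneq x ord_max.
  by rewrite ex smax; apply/esym/negbTE; rewrite -leqNgt -ltnS ltn_ord.
rewrite ltnNge leq_eqVlt; apply/esym/negP=> /orP[/eqP/val_inj/perm_inj e|lt].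
  by rewrite e xA in yA.
have := hsink _ _ lt; rewrite !hls !smem xA yA el => /(_ erefl isT isT).
by rewrite -smax => /perm_inj e; rewrite e eqxx in nx.
Qed.

(** A word [w] puts the cell of [Y_E] with label [x] in position [w x]. This is the word of
    the pair [(alpha, F)], where the position is that of the entry of the cell in [alpha]. *)
Definition cellword alpha F : 'S_N := (match_labels k E F * (rperm alpha)^-1)%g.
(** With [word_set], the only pair that can have the word [w]: the entries are those of
    [lambda] at the prescribed positions, and [word_perm] relabels the cells accordingly. *)
Definition word_mon w : 'X_{1..N} := mperm lambda w^-1%g.
Definition word_perm w : 'S_N := (w * rperm (word_mon w))%g.
Definition word_set w : {set 'I_N} := word_perm w @: E.

Lemma aplus_word w : aplus (word_mon w) = lambda.
Proof. by rewrite aplus_perm aplus_nonincr. Qed.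

Lemma word_mon_val w x : word_mon w (w x) = lambda x.
Proof. by rewrite mnmE permK. Qed.

Lemma word_level w x : lambda (word_perm w x) = lambda x.
Proof. by rewrite -(aplus_word w) permM aplus_rperm word_mon_val aplus_word. Qed.

Lemma word_order w x y : lambda x = lambda y ->
  (w x < w y)%N = (word_perm w x < word_perm w y)%N.
Proof.
move=> el; have := @cell_order_level _ lambda (word_mon w) (aplus_word w) (word_perm w) (word_level w) x y el.
by rewrite /word_perm mulgK.
Qed.

(** For adjacent labels of a class the contents differ by 1, so if they are reversed, the
    word product has a factor [1 + kappa / (- kappa)]. *)
Lemma word_class w a b : gprod w != 0 -> (a < b)%N -> cls a = cls b ->
  (word_perm w a < word_perm w b)%N.
Proof.
move=> nz; apply: (class_step hm dec hE hcs hroot (K := fun x => val (word_perm w x))) => i j ij e /=.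
have el : lambda i = lambda j by case: e.
rewrite -word_order // ltnNge leq_eqVlt; apply/negP=> /orP[/eqP/val_inj/perm_inj e'|lt].
  by move: ij; rewrite e'; lia.
move: nz; rewrite /word_product (bigD1 (j, i)) //= /hook_factor /= cell_coord_diff el subrr add0r.
rewrite (class_content hm dec hE hcs hroot ij e) opprD addrA subrr add0r.
by rewrite mulrN1 invrN mulrN divff ?subrr ?mul0r ?eqxx // (kappa_neq0 hkappa).
Qed.

(** In a word with nonzero product the labels of each class are in increasing order, hence
    so are those of the leg and those of the arm within each level. *)
Lemma word_support w : gprod w != 0 ->
  [/\ word_set w \in EE N m k, filling k (word_mon w) (word_set w) == filling k lambda E
    & cellword (word_mon w) (word_set w) = w].
Proof.
move=> nz; set s := word_perm w; have hls x : lambda (s x) = lambda x by apply: word_level.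
have mono x y : (x \in A) = (y \in A) -> (x < y)%N -> (s x < s y)%N.
  move=> eA lt; case: (ltngtP (lambda x) (lambda y)) => [l|l|el].
  - by have := level_lt dec l; rewrite ltnNge ltnW.
  - by apply: (level_lt dec); rewrite !hls.
  - by apply: word_class => //; apply: (same_leg_class hm dec hE hcs lt el eA).
(* The corner is the last label of its class, and all the classes keep their order. *)
have smax : s ord_max = ord_max.
  apply/eqP; apply: contraT => ne; set y := s^-1%g ord_max.
  have sy : s y = ord_max by rewrite permKV.
  have ny : y != ord_max by apply: contraNneq ne => ey; rewrite -{1}ey sy.
  have lty := lt_ord_max ny.
  have el : lambda y = lambda ord_max by rewrite -sy hls.
  have nsy : special k E y = false.
    apply/negP=> hy; exact: (special_not_corner hm dec hE hcs hy el).
  have := @word_class w y ord_max nz lty; rewrite /level_class el nsy (special_corner hm hE) => /(_ erefl).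
  by rewrite -/s sy ltnNge -ltnS ltn_ord.
have sm1 : {in A &, forall i j, (i < j)%N -> (s i < s j)%N} by move=> i j iA jA; apply: mono; rewrite iA jA.
have sm2 : {in ~: A &, forall i j, (i < j)%N -> (s i < s j)%N}.
  by move=> i j; rewrite !inE => iA jA; apply: mono; rewrite (negbTE iA) (negbTE jA).
have hF : word_set w \in EE N m k.
  apply: EE_imset => //; apply/imsetP; exists ord_max; last by rewrite smax.
  exact: (leg_corner hm hE).
have hsg : match_labels k E (word_set w) = s.
  by apply: (match_labels_uniq hm) => // x; rewrite content_mono.
split=> //.
  rewrite (filling_partition hm) // aplus_word eqxx /=; apply/forallP=> x.
  by rewrite hsg hls.
by rewrite /cellword hsg /s /word_perm mulgK.
Qed.

Lemma cellword_inj alpha F w : F \in EE N m k ->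
  filling k alpha F == filling k lambda E -> cellword alpha F = w ->
  alpha = word_mon w /\ F = word_set w.
Proof.
move=> hF; rewrite (filling_partition hm) // => /andP[/eqP hal /forallP hls] ew.
have hls' x : lambda (match_labels k E F x) = lambda x by apply/eqP/hls.
have ea : alpha = word_mon w.
  apply/mnmP=> x; rewrite -[x](permKV w) word_mon_val -ew.
  by rewrite (cell_order_alpha hal hls').
split=> //; rewrite /word_set /word_perm -ea -ew /cellword mulgKV.
by rewrite (match_labels_imset hm).
Qed.

Definition index_set (q : 'X_{1..N < (mdeg lambda).+1} * {set 'I_N}) : bool :=
  (q.2 \in EE N m k) && (filling k q.1 q.2 == filling k lambda E).

(** The nonzero terms of [word_product_sum] are indexed by the pairs [(alpha, F)]. *)
Lemma word_product_index :
  \sum_(q : 'X_{1..N < (mdeg lambda).+1} * {set 'I_N} | index_set q) gprod (cellword q.1 q.2)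
  = N`!%:R.
Proof.
rewrite (partition_big (fun q : 'X_{1..N < (mdeg lambda).+1} * {set 'I_N} =>
  cellword q.1 q.2) xpredT) //=.
rewrite -(word_product_sum hm hkappa lambda hE) [RHS](reindex_inj invg_inj) /=.
apply: eq_bigr => w _; rewrite invgK.
rewrite (eq_bigr (fun _ => gprod w)) => [|q /andP[_ /eqP -> //]].
have [g0|nz] := eqVneq (gprod w) 0; first by rewrite g0 big1.
have [hF hfill hw] := word_support nz.
have hb : (mdeg (word_mon w) < (mdeg lambda).+1)%N by rewrite mdeg_perm.
rewrite (big_pred1 (BMultinom hb, word_set w)) // => -[[alpha ha] F] /=.
rewrite xpair_eqE /index_set /=; apply/andP/andP => [[/andP[h1 h2] /eqP h3]|[/eqP e1 /eqP e2]].
  have [e1 e2] := cellword_inj h1 h2 h3; split; last by rewrite e2.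
  by apply/eqP/val_inj.
have e1' : alpha = word_mon w by have := congr1 val e1.
by rewrite e1' e2 hF hfill hw eqxx.
Qed.

Section Form.
Context (B : superpoly R N -> superpoly R N -> R) (hB : is_form kappa m B).
Context (T : {set 'I_N} -> superpoly R N) (hT : is_Tfamily m T).
Context (J : 'X_{1..N} -> {set 'I_N} -> superpoly R N).
Hypothesis hJ : forall k alpha F, F \in EE N m k -> is_Jack kappa m T k alpha F (J alpha F).

Lemma Pprod_index F : F \in EE N m k ->
  (forall x, lambda (match_labels k E F x) = lambda x) ->
  Pprod kappa k lambda F = Pprod kappa k lambda E.
Proof.
move=> hF hls; rewrite (@Pprod_pair _ _ kappa k lambda F (match_labels k E F) lambda hls dec).
rewrite (@Pprod_pair _ _ kappa k lambda E 1%g lambda _ dec) => [|x]; last by rewrite perm1.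
congr (_ * _); first by apply: eq_bigr => x _; rewrite (match_labels_content hm) // perm1.
by apply: eq_bigr => p _; rewrite !(match_labels_content hm) // !perm1.
Qed.

Lemma norm_index alpha F : F \in EE N m k -> filling k alpha F == filling k lambda E ->
  (Rprod kappa k 1 alpha F / Cprod R k 1 F) ^+ 2 * B (J alpha F) (J alpha F)
    * (Cprod R k 1 E * (crossprod * root_level_product))
  = (nu N m k)%:R * Pprod kappa k lambda E * Cprod R k 0 E * gprod (cellword alpha F).
Proof.
move=> hF; rewrite (filling_partition hm) // => /andP[/eqP hal /forallP hls].
have hls' x : lambda (match_labels k E F x) = lambda x by apply/eqP/hls.
have hs x := match_labels_content hm x hE hF.
have w := pair_weight hF hal hls'.
have nJ := Jack_norm hm hkappa hB hT hJ alpha hF.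
rewrite hal (Pprod_index hF hls') (T_norm hm hB hT hF) in nJ.
have r0 := Rprod_neq0 hm hkappa hE hal hs hls' 0; have r1 := Rprod_neq0 hm hkappa hE hal hs hls' 1.
have c1 := Cprod_neq0 R hm 1 hF.
rewrite -/(cellword alpha F) in w; move: w nJ r0 r1 c1.
set R0 := Rprod _ _ 0 _ _; set R1 := Rprod _ _ 1 _ _; set C1 := Cprod _ _ 1 F.
set C0 := Cprod _ _ 0 F; set g := word_product _ _ _ _ _; set b := B _ _; set P := Pprod _ _ _ _.
move=> w nJ r0 r1 c1.
(* Clear the denominators [R_0] and [C_1], then substitute both norm formulas. *)
apply: (mulfI (mulf_neq0 r0 c1)).
transitivity (b * (R0 * R1) * (crossprod * root_level_product * (R1 * Cprod R k 1 E)) / C1).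
  by field.
rewrite nJ; transitivity ((nu N m k)%:R * P * (crossprod * root_level_product * (R1 * C0 * Cprod R k 1 E))).
  by field.
by rewrite -w; ring.
Qed.

(** By orthogonality the norm is the sum of the weights of the pairs, which are word
    products by [pair_weight]. *)
Lemma super_p_norm :
  let p := super_p kappa m J k lambda E in
  B p p * (Cprod R k 1 E * (crossprod * root_level_product))
   = (nu N m k)%:R * Pprod kappa k lambda E * Cprod R k 0 E * N`!%:R.
Proof.
rewrite /super_p pair_big_dep /=.
rewrite (@form_orth_sum _ _ _ _ _ hB _ index_set
  (fun q => Rprod kappa k 1 q.1 q.2 / Cprod R k 1 q.2) (fun q => J q.1 q.2)); first last.
- move=> [[a ha] F] [[b hb] G] /andP[/= hF _] /andP[/= hG _] ne.
  apply: (Jack_orth hm hkappa hB hT hJ hF hG); apply: contra ne => /eqP[e1 e2].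
  by rewrite e2 xpair_eqE eqxx andbT; apply/eqP/val_inj.
- by move=> [[a ha] F] /andP[/= hF _] /=; apply: (Jack_in_sP hm hB hT hJ _ hF).
rewrite mulr_suml -word_product_index mulr_sumr; apply: eq_bigr => -[[a ha] F] /andP[/= hF hfill].
exact: norm_index.
Qed.

(** * The stabiliser of the root vector *)

(** The Young subgroup is generated by transpositions of adjacent labels of a class, whose
    contents differ by 1. *)
Lemma T_fixed w : young cls w -> sact w (T E) = T E.
Proof.
move: w; apply: perm_descent_ind => [_|w i j ij lt IH hw]; first by rewrite sact1.
have /youngP hw' := hw.
have eij : cls i = cls j.
  by apply: (class_block hm dec hE hcs hroot ij lt); rewrite hw'.
have ec := class_content hm dec hE hcs hroot ij eij.
have sT : sact (tperm i j) (T E) = T E.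
  by rewrite (T_reflection_scalar hB hT hE ij) ec addrC addKr ?scale1r ?normr1.
rewrite -[in RHS]IH; first by rewrite sactM sT.
by apply/youngP=> x; rewrite permM hw' (young_tperm eij).
Qed.

(** A special label stands at an end of its level. *)
Lemma special_neighbour x y : special k E x -> x != y -> lambda x = lambda y ->
  exists i j, [/\ j = i.+1 :> nat, lambda i = lambda x, lambda j = lambda x &
    if k then i = x else j = x].
Proof.
move=> sx ne el; have nsy : ~~ special k E y.
  by apply/negP=> sy; case/eqP: ne; apply: (special_level hm dec hE hcs sx sy el).
case: (ltngtP x y) => [lt|lt|/val_inj e]; last by rewrite e eqxx in ne.
  have kT : k by have := special_order hm dec hE hcs hroot lt el; case: (k) (sx) => // ->.
  have hlt : (x.+1 < N)%N by apply: leq_ltn_trans lt _.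
  exists x, (Ordinal hlt); split=> //; last by rewrite kT.
  by apply: (level_between dec el) => //=.
have kF : k = false.
  have := special_order hm dec hE hcs hroot lt (esym el); case: (k) (sx) => //.
  by move=> ->.
have hlt : (x.-1 < N)%N by rewrite (leq_ltn_trans (leq_pred _)).
have ex : x = (Ordinal hlt).+1 :> nat by rewrite /= prednK // (leq_trans _ lt).
exists (Ordinal hlt), x; split=> //; last by rewrite kF.
rewrite (level_between dec (esym el)) //=; last by rewrite leq_pred.
by rewrite -ltnS prednK // (leq_trans _ lt).
Qed.

(** A reflection can only act by 1 or -1, whereas the content of a special label differs by
    at least 2 from that of its neighbour in the level. *)
Lemma swap_not_scalar i j : j = i.+1 :> nat -> lambda i = lambda j ->
  special k E (if k then i else j) ->
  sact (tperm i j) (T E) <> (content k i E - content k j E)%:~R *: T E.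
Proof.
move=> ij el sp sT; set d := content k i E - content k j E in sT.
have lt : (i < j)%N by rewrite ij.
have dd : d ^+ 2 = 1.
  have /eqP := congr1 (sact (tperm i j)) sT.
  rewrite tpermS_sact sactZ sT scalerA -subr_eq0 -{1}[T E]scale1r -scalerBl scaler_eq0.
  case/orP=> [|/eqP /(T_neq0 hm hB hT hE) //].
  by rewrite -intrM -[1](mulr1z 1) -intrB intr_eq0 subr_eq0 => /eqP e; rewrite expr2 -e.
have hd : 2%:Z <= `|d|.
  have := special_order hm dec hE hcs hroot lt el.
  have imax := lt_neq_max lt.
  have mA := leg_corner hm hE; have nc := special_not_corner hm dec hE hcs sp.
  rewrite /d !content_leg; move: mA sp nc; rewrite /special.
  case: (k) => /= mA sp nc; rewrite ?negbK ?expr1 ?expr0 => h.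
    have jmax : j != ord_max by apply/eqP=> ej; apply: nc; rewrite el ej.
    by have := hook_content_ge1 sp; have := hook_content_lt0 mA h jmax; lia.
  case/andP: sp => jA jmax; move: h; rewrite imax andbT => iA.
  by have := hook_content_ge1 iA; have := hook_content_lt0 mA jA jmax; lia.
move: dd hd; rewrite expr2; nia.
Qed.

(** Suppose that [w] moves [x]. Composing [w] with a permutation that fixes [T E], one may
    assume that [w x] is the neighbour of [x] in its level. Conjugation by [w] then compares
    the Jucys-Murphy elements of [x] and of its neighbour, whose sums differ by the reflection
    [s_i] that exchanges the two labels; so [s_i] acts on [T E] by the difference of the two
    contents, contrary to [swap_not_scalar]. *)
Lemma stab_special w x : (forall z, lambda (w z) = lambda z) -> sact w (T E) = T E ->
  special k E x -> w x = x.
Proof.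
move=> hw hwT sx; apply/eqP; apply: contraT => ne; set y := w x in ne.
have el : lambda x = lambda y by rewrite hw.
have [|i [j [ij ei ej hx]]] := special_neighbour sx _ el; first by rewrite eq_sym.
have nij : i != j by rewrite -val_eqE /= ij; lia.
pose nb := if k then j else i.
have nbx : nb != x by move: hx; rewrite /nb; case: (k) => <-; rewrite // eq_sym.
have enb : lambda nb = lambda x by rewrite /nb; case: (k).
have nonspecial z : z != x -> lambda z = lambda x -> special k E z = false.
  move=> zx ez; apply/negP=> sz; case/eqP: zx.
  exact: (special_level hm dec hE hcs sz sx ez).
have ecls : cls y = cls nb by rewrite /level_class -el enb !nonspecial.
pose w' := (w * tperm y nb)%g.
have hw' z : lambda (w' z) = lambda z.
  by rewrite permM; have := young_tperm ecls (w z) => -[-> _].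
have w'T : sact w' (T E) = T E.
  by rewrite sactM hwT T_fixed //; apply/youngP=> z; apply: young_tperm.
have w'x : w' x = nb by rewrite permM -/y tpermL.
(* [JM x] acts on [T E] by the content of [x]; conjugate it by [w']. *)
have key : (content k x E)%:~R *: T E
    = \sum_(l | (x < w'^-1%g l)%N) sact (tperm nb l) (T E).
  rewrite -[in LHS]w'T -sactZ -(JM_T hT x hE) JM_conj w'x w'T.
  rewrite [RHS](reindex_inj (@perm_inj _ w')) /=.
  by apply: eq_bigl => l; rewrite permK.
have hwV z : lambda (w'^-1%g z) = lambda z by rewrite -hw' permKV.
exfalso; have sp : special k E (if k then i else j).
  by rewrite (_ : (if k then i else j) = x) //; move: hx; case: (k).
apply: (swap_not_scalar ij _ sp); first by rewrite ei ej.
rewrite intrB scalerBl; move: key; rewrite /nb; move: (JM_T hT i hE) (JM_T hT j hE); rewrite /JM.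
have sord a b : (a < b)%N -> lambda a = lambda b -> if k then ~~ special k E b else ~~ special k E a.
  exact: (special_order hm dec hE hcs hroot).
move: hx sord w'x; rewrite /nb; case kE : (k) => hx sord w'x Ji Jj.
  (* The labels before [x] are those of higher level, and [w'] preserves the levels. *)
  have before (l : 'I_N) : (l < x)%N = (lambda x < lambda l)%N.
    apply/idP/idP => [lt|]; last exact: level_lt.
    rewrite ltn_neqAle (dec (ltnW lt)) andbT; apply/eqP=> e.
    by have := sord _ _ lt (esym e); rewrite -kE sx.
  have pos (l : 'I_N) : (x < w'^-1%g l)%N = (x <= l)%N && (l != j).
    rewrite ltn_neqAle andbC leqNgt before hwV -before -leqNgt; congr (_ && ~~ _).
    by rewrite val_eqE -(inj_eq (@perm_inj _ w')) permKV w'x eq_sym.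
  rewrite (eq_bigl _ _ pos) (bigD1 i) /=; last by rewrite -hx leqnn nij.
  rewrite -hx => ->; rewrite tpermC (eq_bigl (fun l : 'I_N => (j < l)%N)) => [|l]; last first.
    by rewrite -!(inj_eq val_inj) /= ij; lia.
  by rewrite Jj addrK.
(* The labels after [x] are those of lower level, and [w'] preserves the levels. *)
have after (l : 'I_N) : (x < l)%N = (lambda l < lambda x)%N.
  apply/idP/idP => [lt|]; last exact: level_lt.
  rewrite ltn_neqAle (dec (ltnW lt)) andbT; apply/eqP=> e.
  by have := sord _ _ lt (esym e); rewrite -kE sx.
rewrite (eq_bigl (fun l : 'I_N => (j < l)%N)) => [e|l]; last by rewrite after hwV -after hx.
rewrite -hx in e; rewrite e -Ji (bigD1 j) /=; last by rewrite ij.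
rewrite (eq_bigl (fun l : 'I_N => (j < l)%N)) => [|l]; last first.
  by rewrite ij -(inj_eq val_inj) /= ij; lia.
by rewrite addrK.
Qed.

Lemma stab_young : stab_root T lambda E = [set w | young cls w].
Proof.
apply/setP=> w; rewrite !inE; apply/andP/idP => [[/eqP hw /eqP hT']|hw]; last first.
  split; last by rewrite T_fixed.
  apply/eqP/mnmP=> x; rewrite mnmE; have /youngP hw' := hw.
  by have := hw' (w^-1%g x); rewrite permKV => -[<-].
have hl z : lambda (w z) = lambda z by rewrite -[in LHS]hw mnmE permK.
have fix_special := stab_special hl hT'.
apply/youngP=> x; rewrite /level_class hl; congr pair.
apply/idP/idP => [sw|sx]; last by rewrite fix_special.
by have /perm_inj <- := fix_special _ sw.
Qed.
End Form.
End SymmetricNorm.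

Theorem theorem9
  (R : realFieldType) (N m : nat) (kappa : R)
  (hN : (2 <= N)%N) (hm : (1 <= m <= N - 1)%N) (hkappa : generic N kappa)
  (T : {set 'I_N} -> superpoly R N) (hT : is_Tfamily m T)
  (J : 'X_{1..N} -> {set 'I_N} -> superpoly R N)
  (hJ : forall (k : bool) (alpha : 'X_{1..N}) (F : {set 'I_N}),
    F \in EE N m k -> is_Jack kappa m T k alpha F (J alpha F))
  (B : superpoly R N -> superpoly R N -> R) (hB : is_form kappa m B)
  (lambda : 'X_{1..N})
  (hlambda : forall i j : 'I_N, (i <= j)%N -> (lambda j <= lambda i)%N)
  (k : bool) (E : {set 'I_N}) (hE : E \in EE N m k)
  (hcs : column_strict k lambda E) :
  let p := super_p kappa m J k lambda E in
  let ER := root_set m k lambda E in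
  let ES := sink_set m k lambda E in
  B p p =
    (nu N m k)%:R * (N`!%:R / #|stab_root T lambda ER|%:R)
    * (Cprod R k 0 ER * Pprod kappa k lambda ER
       / (Rprod kappa k 0 (aminus lambda) ER * Cprod R k 1 ES)).
Proof.
case: N => [//|n] in hN hm hkappa T hT J hJ B hB lambda hlambda E hE hcs *.
rewrite subn1 /= in hm; move=> p ER ES.
have hER : ER \in same_filling m k lambda E by apply: root_set_in.
have hES : ES \in same_filling m k lambda E by apply: sink_set_in.
move: hER hES; rewrite !inE => /andP[hER /eqP fER] /andP[hES /eqP fES].
have csR : column_strict k lambda ER by rewrite /column_strict fER.
have root (a b : 'I_n.+1) : (a < b)%N -> lambda a = lambda b -> a \in leg k ER -> b \in leg k ER.
  exact: (root_order hm hlambda hE).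
have sink (a b : 'I_n.+1) : (a < b)%N -> lambda a = lambda b ->
    a \notin leg k ES -> b \in leg k ES -> b = ord_max by apply: (sink_order hm hlambda hE).
have ep : p = super_p kappa m J k lambda ER by rewrite /super_p fER.
have levels x : lambda (match_labels k ER ES x) = lambda x.
  have := filling_partition hm lambda hER hES hlambda; rewrite fER fES eqxx.
  by move/esym/andP=> [_ /forallP/(_ x)/eqP].
have main := super_p_norm hm hkappa hlambda hER csR root hB hT hJ.
have lev := root_level_product_sink hm hkappa hlambda hER csR root hES levels sink.
rewrite /= -ep in main.
set C1R := Cprod R k 1 ER in main lev; set L := root_level_product kappa k lambda ER in main lev.
(* Trade the constant of the root for the order of the stabiliser and [C_1(E_S)]. *)
rewrite [X in B p p * X]mulrCA [C1R * L]mulrC lev in main.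
rewrite (stab_young hm hlambda hER csR root hB hT) (Rprod_aminus kappa k hlambda ER).
have c0 := cross_product_neq0 hm hkappa hlambda hER; have c1 := Cprod_neq0 R hm 1 hES.
have s0 : #|[set w : 'S_n.+1 | young (level_class k lambda ER) w]|%:R != 0 :> R.
  rewrite pnatr_eq0 -lt0n; apply/card_gt0P; exists 1%g; rewrite inE.
  by apply/youngP=> i; rewrite perm1.
move: main c0 c1 s0; set g := _%:R; set x := cross_product _ _ _ _; set c := Cprod _ _ 1 _ => main c0 c1 s0.
have nz : x * (g * c) != 0 by rewrite !mulf_neq0.
apply: (mulIf nz); rewrite main; field; rewrite c0 c1 s0 //.
Qed.
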